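(* There exists $\epsilon>0$ such that \[ \|\Psi_\lambda-\Psi_\lambda^\infty\|_{\hat{\mathcal H}}=O(e^{-\epsilon\,m(\lambda)})\quad\text{as } m(\lambda)\to\infty, \] where $m(\lambda)=\min_{\alpha\in\boldsymbol{R}^+}\langle\lambda,\alpha^\vee\rangle$ and $\Psi_\lambda^\infty(\xi)=\hat\Delta^{1/2}(\xi)\sum_{w\in W}(-1)^w\hat{\mathcal{C}}(w\xi)e^{i\langle\rho+\lambda,w\xi\rangle}$ (equivalently $\Psi^\infty_\lambda=\sum_{w}(-1)^w\hat S_w^{1/2}(\xi)e^{i\langle\rho+\lambda,w\xi\rangle}$ with $\hat S_w^{1/2}(\xi)=\hat{\mathcal C}(w\xi)/|\hat{\mathcal C}(w\xi)|$, a square root of $\hat S_w(\xi)=\hat{\mathcal{C}}(w\xi)/\hat{\mathcal{C}}(-w\xi)$).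
   Context: Let $\mathbf{E}$ be a real $N$-dimensional Euclidean space with inner product $\langle\cdot,\cdot\rangle$ and $\boldsymbol{R}\subset\mathbf{E}$ an irreducible crystallographic root system (possibly nonreduced) spanning $\mathbf{E}$, with positive roots $\boldsymbol{R}^+$, Weyl group $W$, $(-1)^w=\det w$, coroots $\alpha^\vee=2\alpha/\langle\alpha,\alpha\rangle$, dominant weights $\mathcal{P}^+=\{\lambda\mid\langle\lambda,\alpha^\vee\rangle\in\mathbb{N}\ \forall\alpha\in\boldsymbol{R}^+\}$ (weights $\mathcal P$ defined with $\alpha\in\boldsymbol R$), $\boldsymbol{R}_0=\{\alpha\mid2\alpha\notin\boldsymbol{R}\}$, $\boldsymbol{R}_1=\{\alpha\mid\alpha/2\notin\boldsymbol{R}\}$, $\boldsymbol R_i^+=\boldsymbol R_i\cap\boldsymbol R^+$, $\rho=\frac12\sum_{\alpha\in\boldsymbol{R}_0^+}\alpha$. $\mathbf{A}=\{\xi\mid0<\langle\xi,\alpha\rangle<2\pi\ \forall\alpha\in\boldsymbol{R}^+\}$; $m_\lambda(\xi)=|W_\lambda|^{-1}\sum_{w}e^{i\langle\lambda,w\xi\rangle}$; $\delta(\xi)=\prod_{\alpha\in\boldsymbol{R}_0^+}(e^{i\langle\alpha,\xi\rangle/2}-e^{-i\langle\alpha,\xi\rangle/2})$. For $\alpha\in\boldsymbol{R}_1^+$, $\hat c_{|\alpha|}(z)$ depends only on the $W$-orbit of $\alpha$, is analytic and zero-free on the closed disc $|z|\le\varrho$ for some $\varrho>1$, $\hat c_{|\alpha|}(0)=1$,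 real for real $z$; $\hat{\mathcal{C}}(\xi)=\prod_{\alpha\in\boldsymbol{R}_1^+}\hat c_{|\alpha|}(e^{-i\langle\alpha,\xi\rangle})$, $\hat\Delta(\xi)=1/(\hat{\mathcal{C}}(\xi)\hat{\mathcal{C}}(-\xi))$, $(f,g)_{\hat\Delta}=(|W|\mathrm{Vol}(\mathbf{A}))^{-1}\int_{\mathbf{A}}f\bar g\hat\Delta|\delta|^2d\xi$. $P_\lambda=\sum_{\mu\preceq\lambda}a_{\lambda\mu}m_\mu$ ($a_{\lambda\lambda}>0$) are obtained by Gram–Schmidt w.r.t. $(\cdot,\cdot)_{\hat\Delta}$ and a partial order $\succeq$ on $\mathcal P^+$ refining the dominance order ($\lambda\geqslant\mu\iff\lambda-\mu\in\mathrm{Span}_{\mathbb N}\boldsymbol R^+$) with finite lower sets, assumed fine enough that the $P_\lambda$ are orthonormal. $\hat{\mathcal H}=L^2(\mathbf{A},d\xi)$ with norm $\|\hat f\|_{\hat{\mathcal H}}^2=(|W|\mathrm{Vol}(\mathbf{A}))^{-1}\int_{\mathbf{A}}|\hat f|^2d\xi$, and $\Psi_\lambda=\hat\Delta^{1/2}\delta P_\lambda$. *)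

(* Defs.v *)
(* MathComp + MathComp-Analysis (R : realType), complex numbers R[i]
   from mathcomp-real-closed. *)
From HB Require Import structures.
From mathcomp Require Import all_boot all_order all_algebra.
From mathcomp Require Import all_classical all_reals all_analysis.
From mathcomp Require Import complex.

Set Implicit Arguments.
Unset Strict Implicit.
Unset Printing Implicit Defensive.

Import Order.TTheory GRing.Theory Num.Theory.
Import numFieldNormedType.Exports.

Local Open Scope classical_set_scope.
Local Open Scope ring_scope.
Local Open Scope complex_scope.

(* Lebesgue measure on R^(n+1), as the iterated product measure        *)
(* lambda \x (lambda \x (... \x lambda)).                              *)

Section prodLeb.
Local Open Scope ereal_scope.
Context (R : realType) d (T : measurableType d)
  (m2 : {sigma_finite_measure set T -> \bar R}).

(* lambda \x m2 *)
Definition prodLeb := ((@lebesgue_measure R) \x m2)%E.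
HB.instance Definition _ := Measure.on prodLeb.

Lemma prodLeb_sigma_finite : sigma_finite setT prodLeb.
Proof.
have /sigma_finiteP[F [TF ndF Foo]] := sigma_finiteT (@lebesgue_measure R).
have /sigma_finiteP[G [TG ndG Goo]] := sigma_finiteT m2.
exists (fun n => F n `*` G n).
 rewrite -setXTT TF TG predeqE => -[x y]; split.
    move=> [/= [n _ Fnx] [k _ Gky]]; exists (maxn n k) => //; split.
    - by move: x Fnx; exact/subsetPset/ndF/leq_maxl.
    - by move: y Gky; exact/subsetPset/ndG/leq_maxr.
  by move=> [n _ []/= ? ?]; split; exists n.
move=> k; have [? ?] := Foo k; have [? ?] := Goo k.
split; first exact: measurableX.
by rewrite /prodLeb product_measure1E// lte_mul_pinfty// ge0_fin_numE.
Qed.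

HB.instance Definition _ :=
  Measure_isSigmaFinite.Build _ _ _ prodLeb prodLeb_sigma_finite.
End prodLeb.

Record sfm (R : realType) := SFM {
  sfm_d : measure_display;
  sfm_T : measurableType sfm_d;
  sfm_mu : {sigma_finite_measure set sfm_T -> \bar R} }.

(* Lebesgue measure on R^(n+1) as the product measure lambda \x (... \x lambda) *)
Fixpoint lebRn (R : realType) (n : nat) : sfm R :=
  match n with
  | 0 => SFM (@lebesgue_measure R)
  | n'.+1 => SFM (prodLeb (sfm_mu (lebRn R n')))
  end.

(* coordinates of a point of the iterated product *)
Fixpoint lebRn_coord (R : realType) (n : nat) :
    sfm_T (lebRn R n) -> 'I_n.+1 -> R :=
  match n return sfm_T (lebRn R n) -> 'I_n.+1 -> R with
  | 0 => fun x _ => x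
  | n'.+1 => fun x i =>
      match unlift ord0 i with
      | None => x.1
      | Some j => lebRn_coord x.2 j
      end
  end.

Definition lebRn_vec (R : realType) (n : nat) (x : sfm_T (lebRn R n)) :
  'rV[R]_n.+1 := \row_i lebRn_coord x i.

(* Real-valued Lebesgue integral over D of f on R^N ('rV[R]_N).
   (For N = 0, R^0 is a point carrying the Dirac mass.) *)
Definition RintN (R : realType) (N : nat) :
    set 'rV[R]_N -> ('rV[R]_N -> R) -> R :=
  match N return set 'rV[R]_N -> ('rV[R]_N -> R) -> R with
  | 0 => fun D f => if pselect (D 0) then f 0 else 0
  | n.+1 => fun D f =>
      Rintegral (sfm_mu (lebRn R n)) (@lebRn_vec R n @^-1` D)
                (f \o @lebRn_vec R n)
  end.

(* complex-valued integral: integrate real and imaginary parts *)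
Definition CintN (R : realType) (N : nat) (D : set 'rV[R]_N)
    (f : 'rV[R]_N -> R[i]) : R[i] :=
  (RintN D (fun x => complex.Re (f x)))%:C + 'i * (RintN D (fun x => complex.Im (f x)))%:C.

(* modulus of a complex number *)
Definition cabs (R : realType) (z : R[i]) : R :=
  Num.sqrt (complex.Re z ^+ 2 + complex.Im z ^+ 2).

(* convergence of a complex sequence (componentwise, i.e. in C = R^2) *)
Definition ccvg_to (R : realType) (u : nat -> R[i]) (l : R[i]) : Prop :=
  (fun n => complex.Re (u n)) @ \oo --> complex.Re l /\
  (fun n => complex.Im (u n)) @ \oo --> complex.Im l.

(* e^{i t} *)
Definition expi (R : realType) (t : R) : R[i] := (cos t)%:C + 'i * (sin t)%:C.

(* Root-system data on E = R^N with the standard inner product.        *)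

Section RootData.
Variables (R : realType) (N : nat).
Local Notation vec := 'rV[R]_N.

(* <u, v> *)
Definition dotp (u v : vec) : R := \sum_(k < N) u 0 k * v 0 k.

(* <l, a^vee> with a^vee = 2 a / <a,a> *)
Definition pairing (l a : vec) : R := 2 * dotp l a / dotp a a.

(* the reflection s_a, acting on row vectors: v *m refl a = v - <v,a^vee> a *)
Definition refl (a : vec) : 'M[R]_N := 1%:M - (2 / dotp a a) *: (a^T *m a).

(* rs is a crystallographic (possibly nonreduced) root system spanning E *)
Definition is_root_system (rs : seq vec) : Prop :=
  [/\ uniq rs, (0 : vec) \notin rs,
      (forall v : vec, exists c : nat -> R,
          v = \sum_(k < size rs) c k *: rs`_k),
      {in rs &, forall a b, b *m refl a \in rs} &
      {in rs &, forall a b, pairing b a \is a Num.int}].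

(* irreducible: nonempty and not an orthogonal union of two nonempty parts *)
Definition irreducible_rs (rs : seq vec) : Prop :=
  rs != [::] /\
  forall S : pred vec,
    (forall a b, a \in rs -> b \in rs -> S a -> ~~ S b -> dotp a b = 0) ->
    {in rs, forall a, S a} \/ {in rs, forall a, ~~ S a}.

(* The Weyl group: the group generated by the reflections s_a (a in rs),
   as matrices acting on the right on row vectors (xi |-> xi *m w). *)
Inductive inW (rs : seq vec) : 'M[R]_N -> Prop :=
  | inW1 : inW rs 1%:M
  | inWS w a : inW rs w -> a \in rs -> inW rs (w *m refl a).

Variables (rs : seq vec) (h : vec) (Ws : seq 'M[R]_N).

(* positive roots: those a with <h,a> > 0 for a regular vector h *)
Definition pos (a : vec) : bool := (a \in rs) && (0 < dotp h a).
(* R_0^+ and R_1^+ *)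
Definition R0p (a : vec) : bool := pos a && (2%:R *: a \notin rs).
Definition R1p (a : vec) : bool := pos a && ((2%:R)^-1 *: a \notin rs).

Definition weight (l : vec) : bool :=
  all (fun a => pairing l a \is a Num.int) rs.
Definition dominant (l : vec) : bool :=
  weight l && all (fun a => pos a ==> (0 <= pairing l a)) rs.

(* dominance order: l >= m iff l - m is in Span_N R^+ *)
Definition dom_ge (l m : vec) : Prop :=
  exists k : nat -> nat,
    l - m = \sum_(j < size rs | pos rs`_j) (k j)%:R *: rs`_j.

Definition rho : vec := (2%:R)^-1 *: \sum_(a <- rs | R0p a) a.

(* m(l) = min over positive roots a of <l, a^vee> *)
Definition mlam (l : vec) : R :=
  let s := [seq pairing l a | a <- rs & pos a] in
  foldr Num.min (head 0 s) (behead s).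

(* the alcove A *)
Definition alcove : set vec :=
  [set xi | forall a, pos a -> 0 < dotp xi a < 2 * pi].

(* monomial symmetric function m_l *)
Definition mfun (l : vec) (xi : vec) : R[i] :=
  ((count (fun w => l *m w == l) Ws)%:R)^-1 *
  \sum_(w <- Ws) expi (dotp l (xi *m w)).

Definition delta (xi : vec) : R[i] :=
  \prod_(a <- rs | R0p a)
     (expi (dotp a xi / 2%:R) - expi (- (dotp a xi / 2%:R))).

Variable chat : vec -> R[i] -> R[i].

Definition Chat (xi : vec) : R[i] :=
  \prod_(a <- rs | R1p a) chat a (expi (- dotp a xi)).

Definition Deltahat (xi : vec) : R[i] := (Chat xi * Chat (- xi))^-1.

Definition sqrtDeltahat (xi : vec) : R[i] := sqrtC (Deltahat xi).

Definition volA : R := RintN alcove (fun _ => 1).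

(* (f, g)_{Deltahat} *)
Definition ipD (f g : vec -> R[i]) : R[i] :=
  ((size Ws)%:R * volA)^-1%:C *
  CintN alcove (fun xi => f xi * (g xi)^* * Deltahat xi * (delta xi * (delta xi)^*)).

(* norm of hat H = L^2(A, d xi) with the normalisation (|W| Vol A)^{-1} *)
Definition hnorm (f : vec -> R[i]) : R :=
  Num.sqrt (((size Ws)%:R * volA)^-1 * RintN alcove (fun xi => cabs (f xi) ^+ 2)).

(* hypotheses on the functions hat c_{|a|}, a in R_1^+ *)
Definition chat_hyp : Prop :=
  (forall a b, R1p a -> R1p b ->
     (exists w, inW rs w /\ b = a *m w) -> chat a = chat b) /\
  (forall a, R1p a ->
     [/\ chat a 0 = 1,
         (forall x : R, chat a x%:C \is Num.real) &
         exists varrho : R, 1 < varrho /\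
           exists c : nat -> R[i],
             cvgn (series (fun n => cabs (c n) * varrho ^+ n)) /\
             forall z : R[i], cabs z <= varrho ->
               ccvg_to (series (fun n => c n * z ^+ n)) (chat a z) /\
               chat a z != 0]).

(* a partial order on P^+ (ord l m means l >= m) refining the dominance
   order, with finite lower sets *)
Definition admissible_order (ord : vec -> vec -> Prop) : Prop :=
  [/\ (forall l, dominant l -> ord l l),
      (forall l m, dominant l -> dominant m -> ord l m -> ord m l -> l = m),
      (forall l m p, dominant l -> dominant m -> dominant p ->
          ord l m -> ord m p -> ord l p),
      (forall l m, dominant l -> dominant m -> dom_ge l m -> ord l m) &
      (forall l, dominant l -> exists s : seq vec,
          forall m, dominant m -> ord l m -> m \in s)].

(* P is the Gram--Schmidt family: P_l = sum_{m <= l} a_{lm} m_m with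
   a_{ll} > 0, and the P_l (l in P^+) orthonormal for (.,.)_Deltahat *)
Definition gram_schmidt_family (ord : vec -> vec -> Prop)
    (P : vec -> vec -> R[i]) : Prop :=
  (forall l, dominant l -> exists (s : seq vec) (c : vec -> R[i]),
      [/\ uniq s, {in s, forall m, dominant m /\ ord l m}, l \in s,
          0 < c l & forall xi, P l xi = \sum_(m <- s) c m * mfun m xi]) /\
  (forall l m, dominant l -> dominant m ->
      ipD (P l) (P m) = if l == m then 1 else 0).

Definition Psi (P : vec -> vec -> R[i]) (l : vec) (xi : vec) : R[i] :=
  sqrtDeltahat xi * delta xi * P l xi.

Definition Psi_inf (l : vec) (xi : vec) : R[i] :=
  sqrtDeltahat xi *
  \sum_(w <- Ws) (\det w)%:C * Chat (xi *m w) * expi (dotp (rho + l) (xi *m w)).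

End RootData.

(* Main.v *)
(* Let [U] and [V] be obtained from [Psi_inf] by replacing [Chat], respectively
   [1/Chat], by the product of the Taylor polynomials of degree [K] of its factors;
   both are within O(q^K) of [Psi_inf], uniformly in [xi].  When [K] is at most a
   small multiple of [m(l)], every exponent occurring in [U] and [V] stays strictly
   dominant, so orthogonality of characters and the triangularity of the
   Gram--Schmidt process give exactly
     (Psi, V) = a,   (U, Psi) = 1/a,   (U, V) = 1,   (Psi, Psi) = 1
   with [a] the leading coefficient of [P l].  Hence
   Re (Psi - U, Psi - V) = 2 - a - 1/a <= 0 and |Psi - Psi_inf| = O(q^K).
   The orthogonality relations come from the translation invariance of Lebesgue
   measure under the coroot lattice, as the images of the alcove under the affine
   Weyl group cover space with constant multiplicity. *)
Require Import Defs.
From HB Require Import structures.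
From mathcomp Require Import all_boot all_order all_algebra.
From mathcomp Require Import all_classical all_reals all_analysis.
From mathcomp Require Import complex measurable_realfun.
From mathcomp Require Import zify ring lra.
Import Order.TTheory GRing.Theory Num.Theory.
Import numFieldNormedType.Exports.
Set Implicit Arguments.
Unset Strict Implicit.
Unset Printing Implicit Defensive.
Local Open Scope classical_set_scope.
Local Open Scope ring_scope.

(** * Root systems and dominance *)

(** The factor [Chat x / |Chat x|] in the asymptotic sum also equals [|Chat x| / Chat (- x)], since
    [Chat (- x)] is the conjugate of [Chat x], and [|Chat|] is invariant under the Weyl group.
    Truncating the first form gives [U], the second [V], and this asymmetry decides which weight
    survives in each pairing. In (Psi, V) and (U, V) the factors [|Chat|] cancel and trigonometric
    polynomials remain, whose constant terms are read off from their exponents. In (U, Psi) the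
    weight [Deltahat] remains, and there the orthogonality of [P l] to everything strictly lower
    takes over. A direct estimate of [P l] would require control of all its coefficients; the
    biorthogonal form involves the leading one alone. The price is that [1/Chat] must be
    approximated as well, which uses the absence of zeros on a disc larger than the unit disc. The
    Weyl group enters through its generating reflections and the regular vector [h], so facts about
    chambers are derived from extremal choices in a finite orbit or in the root set. *)

Section Dotp.
Variables (R : realType) (N : nat).
Implicit Types (u v w : 'rV[R]_N) (g : 'M[R]_N).

Lemma dotpC u v : dotp u v = dotp v u.
Proof. by apply: eq_bigr => k _; rewrite mulrC. Qed.

Lemma dotpDl u v w : dotp (u + v) w = dotp u w + dotp v w.
Proof. by rewrite -big_split; apply: eq_bigr => k _; rewrite mxE mulrDl. Qed.

Lemma dotpZl a u v : dotp (a *: u) v = a * dotp u v.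
Proof. by rewrite mulr_sumr; apply: eq_bigr => k _; rewrite mxE mulrA. Qed.

Lemma dotpDr u v w : dotp u (v + w) = dotp u v + dotp u w.
Proof. by rewrite dotpC dotpDl !(dotpC _ u). Qed.

Lemma dotpZr a u v : dotp u (a *: v) = a * dotp u v.
Proof. by rewrite dotpC dotpZl dotpC. Qed.

Lemma dotpNl u v : dotp (- u) v = - dotp u v.
Proof. by rewrite -scaleN1r dotpZl mulN1r. Qed.

Lemma dotpNr u v : dotp u (- v) = - dotp u v.
Proof. by rewrite dotpC dotpNl dotpC. Qed.

Lemma dotpBl u v w : dotp (u - v) w = dotp u w - dotp v w.
Proof. by rewrite dotpDl dotpNl. Qed.

Lemma dotpBr u v w : dotp u (v - w) = dotp u v - dotp u w.
Proof. by rewrite dotpDr dotpNr. Qed.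

Lemma dotp0l u : dotp 0 u = 0.
Proof. by rewrite -(scale0r 0) dotpZl mul0r. Qed.

Lemma dotp0r u : dotp u 0 = 0.
Proof. by rewrite dotpC dotp0l. Qed.

Lemma dotp_suml I (r : seq I) (P : pred I) (F : I -> 'rV[R]_N) u :
  dotp (\sum_(i <- r | P i) F i) u = \sum_(i <- r | P i) dotp (F i) u.
Proof. by elim/big_rec2: _ => [|i x y _ <-]; rewrite ?dotp0l ?dotpDl. Qed.

Lemma dotp_sumr I (r : seq I) (P : pred I) (F : I -> 'rV[R]_N) u :
  dotp u (\sum_(i <- r | P i) F i) = \sum_(i <- r | P i) dotp u (F i).
Proof. by rewrite dotpC dotp_suml; apply: eq_bigr => i _; rewrite dotpC. Qed.

Lemma dotp_ge0 u : 0 <= dotp u u.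
Proof. by apply: sumr_ge0 => k _; rewrite -expr2 sqr_ge0. Qed.

Lemma dotp_eq0 u : (dotp u u == 0) = (u == 0).
Proof.
apply/eqP/eqP => [h|->]; last by rewrite dotp0l.
apply/rowP => k; rewrite mxE; apply/eqP; rewrite -sqrf_eq0 expr2; apply/eqP.
by apply: (psumr_eq0P _ h) => // i _; rewrite -expr2 sqr_ge0.
Qed.

Lemma dotp_gt0 u : (0 < dotp u u) = (u != 0).
Proof. by rewrite lt_def dotp_ge0 dotp_eq0 andbT. Qed.

Lemma dotp_mulmxl u v g : dotp (u *m g) v = dotp u (v *m g^T).
Proof.
have E x y : dotp x y = (x *m y^T) 0 0.
  by rewrite mxE; apply: eq_bigr => k _; rewrite mxE.
by rewrite !E trmx_mul trmxK mulmxA.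
Qed.

Lemma dotp_mulmxr u v g : dotp u (v *m g) = dotp (u *m g^T) v.
Proof. by rewrite dotpC dotp_mulmxl dotpC. Qed.

Lemma dotp_inj u v : (forall w, dotp w u = dotp w v) -> u = v.
Proof.
move=> h; apply/eqP; rewrite -subr_eq0 -dotp_eq0 dotpBr.
by rewrite h subrr.
Qed.

End Dotp.

Section Reflections.
Variables (R : realType) (N : nat).
Implicit Types (u v a : 'rV[R]_N) (w : 'M[R]_N).

Lemma reflE v a : v *m refl a = v - pairing v a *: a.
Proof.
rewrite mulmxBr mulmx1 -scalemxAr mulmxA; congr (_ - _).
have -> : v *m a^T = (dotp v a)%:M.
  apply/matrixP => i j; rewrite !mxE !ord1 eqxx mulr1n.
  by apply: eq_bigr => k _; rewrite mxE.
by rewrite mul_scalar_mx scalerA /pairing; congr (_ *: _); ring.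
Qed.

Lemma eq_mulmx (A B : 'M[R]_N) : (forall v : 'rV_N, v *m A = v *m B) -> A = B.
Proof. by move=> h; apply/row_matrixP => i; rewrite !rowE. Qed.

Lemma trmx_refl a : (refl a)^T = refl a.
Proof. by rewrite linearB linearZ /= trmx_mul trmxK trmx1. Qed.

Lemma pairingDl u v a : pairing (u + v) a = pairing u a + pairing v a.
Proof. by rewrite /pairing dotpDl mulrDr mulrDl. Qed.

Lemma pairingZl c v a : pairing (c *: v) a = c * pairing v a.
Proof. by rewrite /pairing dotpZl; ring. Qed.

Lemma pairingNl v a : pairing (- v) a = - pairing v a.
Proof. by rewrite -scaleN1r pairingZl mulN1r. Qed.

Lemma pairingBl u v a : pairing (u - v) a = pairing u a - pairing v a.
Proof. by rewrite pairingDl pairingNl. Qed.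

Lemma pairing_self a : a != 0 -> pairing a a = 2.
Proof. by rewrite -dotp_eq0 => a0; rewrite /pairing mulfK. Qed.

Lemma refl_self a : a != 0 -> a *m refl a = - a.
Proof.
by move=> a0; rewrite reflE pairing_self // scaler_nat mulr2n opprD addrA subrr add0r.
Qed.

Lemma refl_invol a : a != 0 -> refl a *m refl a = 1%:M.
Proof.
move=> a0; apply: eq_mulmx => v; rewrite mulmx1 mulmxA [v *m _]reflE mulmxBl.
by rewrite -scalemxAl refl_self // reflE scalerN opprK subrK.
Qed.

(** Sylvester's identity: the two products of the same pair of block matrices have equal
    determinants, one being [1 - 2], from the 1 by 1 corner, and the other that of the
    reflection. *)
Lemma det_refl a : a != 0 -> \det (refl a) = -1.
Proof.
move=> a0; have aa0 : dotp a a != 0 by rewrite dotp_eq0.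
pose c := 2 / dotp a a.
have e1 : block_mx 1%:M (a) (c *: a^T) 1%:M *m block_mx 1%:M 0 (- (c *: a^T)) 1%:M
   = block_mx (1%:M - c *: (a *m a^T)) a 0 1%:M :> 'M[R]_(1 + N).
  rewrite mulmx_block !mul1mx !mulmx1 !mulmx0 !add0r mulmxN scalemxAr.
  by rewrite subrr.
have e2 : block_mx 1%:M 0 (- (c *: a^T)) 1%:M *m block_mx 1%:M a (c *: a^T) 1%:M
   = block_mx 1%:M a 0 (refl a) :> 'M[R]_(1 + N).
  rewrite mulmx_block !mul1mx !mulmx1 !mul0mx !addr0 addNr mulNmx -scalemxAl.
  by rewrite addrC.
have d1 := congr1 determinant e1; have d2 := congr1 determinant e2.
move: d1 d2; rewrite !det_mulmx !det_lblock !det_ublock !det1 !mul1r !mulr1.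
move=> -> <-; rewrite det_mx11 !mxE /=.
have -> : \sum_j a 0 j * a^T j 0 = dotp a a by apply: eq_bigr => k _; rewrite mxE.
by rewrite /c divfK //; ring.
Qed.

End Reflections.

Lemma avoid_seq (R : realFieldType) (s : seq R) : exists t, t \notin s.
Proof.
exists (1 + \sum_(x <- s) `|x|); apply/negP => h.
have : `|1 + \sum_(x <- s) `|x| | <= \sum_(x <- s) `|x|.
  rewrite [leRHS](perm_big _ (perm_to_rem h)) big_cons lerDl.
  by apply: sumr_ge0 => *.
have S0 : 0 <= \sum_(x <- s) `|x| by apply: sumr_ge0 => *.
by rewrite ger0_norm ?addr_ge0 // gerDr ler10.
Qed.

(** Finitely many hyperplanes do not cover the space: on the line through the previous solution in
    the direction [v], each condition excludes at most one value of the parameter. *)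
Lemma generic_vector (R : realType) N (vs : seq 'rV[R]_N) :
  {in vs, forall v, v != 0} -> exists x, {in vs, forall v, dotp x v != 0}.
Proof.
elim: vs => [|v vs IH] vs0; first by exists 0.
have [|x xvs] := IH; first by move=> u uvs; apply: vs0; rewrite inE uvs orbT.
have [t tP] := avoid_seq (- (dotp x v / dotp v v) :: [seq - (dotp x u / dotp v u) | u <- vs]).
exists (x + t *: v) => u; rewrite inE dotpDl dotpZl => /predU1P[->|uvs].
  apply: contra tP => /eqP h; rewrite inE; apply/orP; left.
  have vv : dotp v v != 0 by rewrite dotp_eq0 vs0 // mem_head.
  by apply/eqP/(mulIf vv); rewrite mulNr divfK //; lra.
have [vu|vu] := eqVneq (dotp v u) 0; first by rewrite vu mulr0 addr0 xvs.
apply: contra tP => /eqP h; rewrite inE; apply/orP; right.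
by apply/mapP; exists u => //; apply/(mulIf vu); rewrite mulNr divfK //; lra.
Qed.

Lemma seq_argmin (R : realFieldType) (T : eqType) (s : seq T) (f : T -> R) x0 :
  x0 \in s -> exists2 x, x \in s & {in s, forall y, f x <= f y}.
Proof.
elim: s x0 => // a s IH x0 _; case: s IH => [|b s] IH.
  by exists a; rewrite ?mem_head // => y; rewrite inE => /eqP->.
have [|x xs xm] := IH b; first exact: mem_head.
have [ax|xa] := leP (f a) (f x).
  exists a; first exact: mem_head.
  by move=> y; rewrite inE => /predU1P[->//|ys]; apply: le_trans ax (xm _ ys).
exists x; first by rewrite inE xs orbT.
by move=> y; rewrite inE => /predU1P[->|]; [exact: ltW | exact: xm].
Qed.

Section Roots.
Context (R : realType) (N : nat) (rs : seq 'rV[R]_N) (h : 'rV[R]_N).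
Context (Hrs : is_root_system rs).
Implicit Types (a b u v x y : 'rV[R]_N) (w : 'M[R]_N).
Notation W := (inW rs).
Notation pos := (pos rs h).

Let rs_uniq : uniq rs. Proof. by case: Hrs. Qed.

Lemma root_neq0 a : a \in rs -> a != 0.
Proof. by case: Hrs => _ h0 _ _ _ ars; apply: contraNneq h0 => <-. Qed.

Lemma refl_root a b : a \in rs -> b \in rs -> b *m refl a \in rs.
Proof. by case: Hrs => _ _ _ H _; apply: H. Qed.

Lemma opp_root a : a \in rs -> - a \in rs.
Proof. by move=> ars; rewrite -(refl_self (root_neq0 ars)) refl_root. Qed.

Lemma opp_rootE a : (- a \in rs) = (a \in rs).
Proof. by apply/idP/idP => /opp_root; rewrite ?opprK. Qed.

Lemma inW_refl a : a \in rs -> W (refl a).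
Proof. by move=> ars; rewrite -[refl a]mul1mx; apply: inWS => //; apply: inW1. Qed.

Lemma inW_mul w1 w2 : W w1 -> W w2 -> W (w1 *m w2).
Proof.
move=> h1; elim=> [|w a _ IH ars]; first by rewrite mulmx1.
by rewrite mulmxA; apply: inWS.
Qed.

Lemma inW_tr w : W w -> W w^T.
Proof.
elim=> [|v a _ IH ars]; first by rewrite trmx1; apply: inW1.
by rewrite trmx_mul trmx_refl; apply: inW_mul => //; exact: inW_refl.
Qed.

Lemma inW_mulT w : W w -> w *m w^T = 1%:M.
Proof.
elim=> [|v a _ IH ars]; first by rewrite trmx1 mulmx1.
rewrite trmx_mul trmx_refl mulmxA -(mulmxA v) refl_invol ?root_neq0 //.
by rewrite mulmx1.
Qed.

Lemma inW_Tmul w : W w -> w^T *m w = 1%:M.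
Proof. by move=> /inW_tr/inW_mulT; rewrite trmxK. Qed.

Lemma inW_root w a : W w -> a \in rs -> a *m w \in rs.
Proof.
move=> Ww; elim: Ww a => [|v b _ IH brs] a ars; first by rewrite mulmx1.
by rewrite mulmxA refl_root ?IH.
Qed.

Lemma inW_dotp w u v : W w -> dotp (u *m w) (v *m w) = dotp u v.
Proof. by move=> Ww; rewrite dotp_mulmxl -mulmxA inW_mulT // mulmx1. Qed.

Lemma inW_pairing w u v : W w -> pairing (u *m w) (v *m w) = pairing u v.
Proof. by move=> Ww; rewrite /pairing !inW_dotp. Qed.

Lemma inW_inj w u v : W w -> u *m w = v *m w -> u = v.
Proof.
by move=> Ww /(congr1 (mulmx^~ w^T)); rewrite -!mulmxA inW_mulT // !mulmx1.
Qed.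

Lemma det_sqr w : W w -> (\det w) ^+ 2 = 1.
Proof.
by move=> /inW_mulT /(congr1 determinant); rewrite det_mulmx det_tr det1.
Qed.

Lemma pos_root a : pos a -> a \in rs. Proof. by case/andP. Qed.

Lemma pos_gt0 a : pos a -> 0 < dotp h a. Proof. by case/andP. Qed.

Context (Hh : {in rs, forall a, dotp h a != 0}).

Lemma posN a : a \in rs -> pos (- a) = ~~ pos a.
Proof.
move=> ars; rewrite /Defs.pos opp_rootE ars dotpNr oppr_gt0 /=.
by rewrite -leNgt le_eqVlt (negPf (Hh ars)).
Qed.

(** Applied to [c *: a \notin rs] with [c = 2] and [c = 1/2], which cut out R_0 and R_1, so that
    products over both sets are reindexed by one lemma. *)
Definition Wstable (S : pred 'rV[R]_N) :=
  (forall a, S (- a) = S a) /\ (forall w a, W w -> S (a *m w) = S a).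

Lemma rs_stable c : Wstable (fun a => c *: a \notin rs).
Proof.
split=> [a|w a Ww]; first by rewrite scalerN opp_rootE.
congr (~~ _); rewrite scalemxAl; apply/idP/idP => [|/inW_root]; last exact.
move=> /(inW_root (inW_tr Ww)).
by rewrite -mulmxA inW_mulT // mulmx1.
Qed.

(* [W] permutes the lines spanned by the roots of a stable set, so a product
   over positive roots of an even function is invariant. *)
Lemma even_reindex (T : Type) (idx : T) (op : Monoid.com_law idx) S
    (G : 'rV[R]_N -> T) w : W w -> Wstable S ->
  {in rs, forall a, G (- a) = G a} ->
  \big[op/idx]_(a <- rs | pos a && S a) G (a *m w) =
  \big[op/idx]_(a <- rs | pos a && S a) G a.
Proof.
move=> Ww [SN SW] Geven.
pose f a := if pos (a *m w) then a *m w else - (a *m w).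
pose s := [seq a <- rs | pos a && S a].
have sP a : a \in s -> [/\ a \in rs, pos a & S a].
  by rewrite mem_filter => /andP[/andP[]].
have fs a : a \in s -> f a \in s.
  move=> /sP[ars pa Sa]; rewrite mem_filter /f.
  have awrs := inW_root Ww ars.
  case: ifP => [pw|pw]; first by rewrite pw SW // Sa awrs.
  by rewrite posN // pw SN SW // Sa opp_rootE.
have us : uniq s by rewrite filter_uniq.
have finj : {in s &, injective f}.
  have key a b : a \in s -> b \in s -> a *m w = - (b *m w) -> a = b.
    move=> /sP[ars pa _] /sP[brs pb _]; rewrite -mulNmx => /(inW_inj Ww) ab.
    by move: pa; rewrite ab posN // pb.
  move=> a b as_ bs; rewrite /f; case: ifP => _; case: ifP => _.
  - exact: inW_inj.
  - exact: key.
  - by move=> /esym e; apply/esym/key.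
  - by move=> /oppr_inj; exact: inW_inj.
have sp : perm_eq (map f s) s.
  apply: uniq_perm => //; first by rewrite map_inj_in_uniq.
  by apply: (uniq_min_size _ _ _).2; rewrite ?map_inj_in_uniq ?size_map //;
    move=> _ /mapP[a /fs + ->].
rewrite -[LHS]big_filter -[RHS]big_filter -/s -[RHS](perm_big _ sp) big_map.
apply: eq_big_seq => a /sP[ars _ _]; rewrite /f; case: ifP => // _.
by rewrite Geven // inW_root.
Qed.

End Roots.

(** * Root lines and the sign of products over positive roots *)

Section RootSigns.
Context (R : realType) (N : nat) (rs : seq 'rV[R]_N) (h : 'rV[R]_N).
Context (Hrs : is_root_system rs) (Hh : {in rs, forall a, dotp h a != 0}).
Implicit Types (a b u v x y : 'rV[R]_N) (w : 'M[R]_N).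
Notation W := (inW rs).
Notation pos := (pos rs h).
Notation R0p := (R0p rs h).

Lemma root_pairing_int a b : a \in rs -> b \in rs -> pairing b a \is a Num.int.
Proof. by case: Hrs => _ _ _ _ H ars brs; apply: H. Qed.

(** The pairings [2 c] and [2 / c] are positive integers with product 4, so [2 c] is 1, 2 or 4. *)
Lemma root_multiple a c : a \in rs -> c *: a \in rs -> 0 < c ->
  [\/ c = 1, c = 2 | c = 2^-1].
Proof.
move=> ars cars c0; have a0 := root_neq0 Hrs ars.
have aa : dotp a a != 0 by rewrite dotp_eq0.
have := root_pairing_int ars cars; rewrite pairingZl pairing_self // => /intrP[m mE].
have := root_pairing_int cars ars.
have -> : pairing a (c *: a) = 2 / c.
  by rewrite /pairing dotpZr dotpZl dotpZr; field; rewrite aa gt_eqF.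
move=> /intrP[n nE].
have mn : (m * n = 4)%R.
  by apply: (@intr_inj R); rewrite intrM -mE -nE; field; rewrite gt_eqF.
have m0 : 0 < m by rewrite -(ltr0z R) -mE mulr_gt0.
have n0 : 0 < n by rewrite -(ltr0z R) -nE divr_gt0.
case: m m0 mE mn => // -[|[|[|[|[|m]]]]] // _ mE mn.
- by apply: Or33; move: mE; rewrite /intmul /=; lra.
- by apply: Or31; move: mE; rewrite /intmul /=; lra.
- by exfalso; case: n n0 nE mn => // k _ _; lia.
- by apply: Or32; move: mE; rewrite /intmul /=; lra.
- by exfalso; case: n n0 nE mn => // -[|k] // _ _; nia.
Qed.

(** Positive roots on one line have ratio 1/2, 1 or 2, so there are at most two of them and R_0
    retains exactly the longer one. *)
Lemma R0p_line b : b \in rs -> exists2 a0, R0p a0 &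
  (exists c, a0 = c *: b) /\ forall a c, R0p a -> a = c *: b -> a = a0.
Proof.
move=> brs.
have n4 : ~ [\/ (2%:R * 2%:R : R) = 1, 2%:R * 2%:R = 2 :> R | 2%:R * 2%:R = 2^-1 :> R] by case=> e; have : (1 : R) < 0 by [lra]; rewrite ltr10.
have [b' [b'pos [cb cbE]]] : exists b', pos b' /\ exists c, b' = c *: b.
  case: (boolP (pos b)) => [pb|npb]; first by exists b; split=> //; exists 1; rewrite scale1r.
  by exists (- b); rewrite posN //; split=> //; exists (-1); rewrite scaleN1r.
have [a0 [a0R [c0 c0E]]] : exists a0, R0p a0 /\ exists c, a0 = c *: b'.
  case: (boolP (2%:R *: b' \in rs)) => [b2|nb2]; last first.
    by exists b'; rewrite /Defs.R0p b'pos; split=> //; exists 1; rewrite scale1r.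
  exists (2%:R *: b'); split; last by exists 2%:R.
  rewrite /Defs.R0p /Defs.pos b2 dotpZr mulr_gt0 ?ltr0n ?(pos_gt0 b'pos) //=.
  rewrite scalerA; apply/negP => b4.
  by apply: n4; apply: root_multiple (pos_root b'pos) b4 _; rewrite mulr_gt0 ?ltr0n.
exists a0 => //; split; first by exists (c0 * cb); rewrite c0E cbE scalerA.
move=> a c aR aE.
have pa : pos a by case/andP: aR.
have pa0 : pos a0 by case/andP: a0R.
have b0 := root_neq0 Hrs brs.
have cc : c0 * cb != 0.
  apply: contraTneq (pos_gt0 pa0) => z; rewrite c0E cbE scalerA z scale0r dotp0r.
  by rewrite ltxx.
have aE' : a = (c / (c0 * cb)) *: a0.
  by rewrite aE c0E cbE !scalerA -(mulrA _ c0) divfK.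
set d := c / _ in aE'.
have d0 : 0 < d.
  by have := pos_gt0 pa; rewrite aE' dotpZr (pmulr_lgt0 _ (pos_gt0 pa0)).
have := root_multiple (pos_root pa0); move/(_ d); rewrite -aE'.
case/(_ (pos_root pa) d0) => dE; first by rewrite aE' dE scale1r.
- by case/andP: a0R => _; rewrite -[2%:R]dE -aE' (pos_root pa).
- case/andP: aR => _; rewrite aE' dE scalerA divff ?scale1r ?(pos_root pa0) //.
Qed.

(* A generic point on the mirror of [b] separates every other root line by
   sign, and its signs are unchanged by the reflection in [b]. *)
Lemma mirror_generic b : b \in rs -> exists2 x, dotp x b = 0 &
  forall a, a \in rs -> dotp x a = 0 -> exists c, a = c *: b.
Proof.
move=> brs; have b0 := root_neq0 Hrs brs.
have bb : dotp b b != 0 by rewrite dotp_eq0.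
pose pr a := a - (dotp a b / dotp b b) *: b.
have [|x xP] := @generic_vector R N [seq pr a | a <- rs & pr a != 0].
  by move=> v /mapP[a]; rewrite mem_filter => /andP[? _ ->].
pose y := x - (dotp x b / dotp b b) *: b.
exists y; first by rewrite dotpBl dotpZl divfK // subrr.
move=> a ars ya; have [/eqP|pr0] := eqVneq (pr a) 0.
  by rewrite subr_eq0 => /eqP ->; exists (dotp a b / dotp b b).
have : dotp x (pr a) != 0.
  by apply: xP; apply/mapP; exists a => //; rewrite mem_filter pr0.
case/eqP; rewrite -ya /pr /y dotpBl dotpBr dotpZl dotpZr (dotpC b a).
by field.
Qed.

(** By induction on a word for [w], one reflection at a time. Multiplying [g] by an odd sign makes
    it even, so the product changes only by the product of the signs [sh (a *m refl b)]. Comparing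
    [sh] with the signs seen from a generic point of the mirror of [b] shows that the root on the
    line of [b] alone contributes a factor -1. *)
Lemma odd_prod (K : comRingType) (sgn : {rmorphism R -> K}) (g : 'rV[R]_N -> K) w :
  W w -> {in rs, forall a, g (- a) = - g a} ->
  \prod_(a <- rs | R0p a) g (a *m w) = sgn (\det w) * \prod_(a <- rs | R0p a) g a.
Proof.
move=> Ww; elim: Ww g => [|v b Wv IH brs] g godd.
  rewrite det1 (rmorph1 sgn) mul1r; apply: eq_bigr => a _; by rewrite mulmx1.
have b0 := root_neq0 Hrs brs.
transitivity (sgn (\det v) * \prod_(a <- rs | R0p a) g (a *m refl b)).
  rewrite -(IH (fun a => g (a *m refl b))).
    by apply: eq_bigr => a _; rewrite mulmxA.
  by move=> a ars; rewrite mulNmx godd // refl_root.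
rewrite det_mulmx det_refl // (rmorphM sgn) (rmorphN1 sgn) -mulrA; congr (_ * _).
have [x xb xP] := mirror_generic brs.
pose sh a : K := if pos a then 1 else -1.
(* On the line of [b], where the generic mirror point gives no sign, [s0] falls back on [sh]; it
   thus stays odd with square 1. *)
pose s0 a : K := if 0 < dotp x a then 1 else if dotp x a < 0 then -1 else sh a.
have shN a : a \in rs -> sh (- a) = - sh a.
  by move=> ars; rewrite /sh posN //; case: (pos a) => //=; rewrite opprK.
have shsh a : sh a * sh a = 1 by rewrite /sh; case: ifP; rewrite ?mulrNN mul1r.
have s0N a : a \in rs -> s0 (- a) = - s0 a.
  move=> ars; rewrite /s0 dotpNr oppr_gt0 oppr_lt0 shN //.
  by case: ltrgtP => //; rewrite opprK.
have s0s0 a : s0 a * s0 a = 1.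
  by rewrite /s0; case: ifP; rewrite ?mul1r //; case: ifP; rewrite ?mulrNN ?mul1r.
have inv (F : 'rV[R]_N -> K) : {in rs, forall a, F (- a) = F a} ->
    \prod_(a <- rs | R0p a) F (a *m refl b) = \prod_(a <- rs | R0p a) F a.
  move=> Fe.
  exact: (even_reindex Hrs Hh ( *%R : Monoid.com_law (1 : K)) (inW_refl brs) (rs_stable Hrs 2%:R) Fe).
have R0rs a : R0p a -> a \in rs by case/andP => /pos_root.
have sh1 a : R0p a -> sh a = 1 by case/andP => pa _; rewrite /sh pa.
transitivity (\prod_(a <- rs | R0p a) (sh (a *m refl b)) *
              \prod_(a <- rs | R0p a) (sh (a *m refl b) * g (a *m refl b))).
  by rewrite -big_split; apply: eq_bigr => a _; rewrite /= mulrA shsh mul1r.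
rewrite (inv (fun a => sh a * g a)); last first.
  by move=> a ars; rewrite shN // godd // mulrNN.
congr (_ * _); last by apply: eq_bigr => a /sh1 ->; rewrite mul1r.
transitivity (\prod_(a <- rs | R0p a) (s0 (a *m refl b)) *
              \prod_(a <- rs | R0p a) (s0 (a *m refl b) * sh (a *m refl b))).
  by rewrite -big_split; apply: eq_bigr => a _; rewrite /= mulrA s0s0 mul1r.
rewrite (inv (fun a => s0 a * sh a)); last first.
  by move=> a ars; rewrite shN // s0N // mulrNN.
rewrite -big_split /=.
have [a0 a0R [[c a0E] a0U]] := R0p_line brs.
rewrite -big_filter (bigD1_seq a0) ?mem_filter ?a0R ?R0rs ?filter_uniq //=; last by case: Hrs.
rewrite [X in _ * X]big1_seq ?mulr1 => [|a]; last first.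
  rewrite mem_filter => /and3P[aa0 aR _].
  have xa : dotp x a != 0.
    by apply: contra aa0 => /eqP/(xP _ (R0rs _ aR))[d /(a0U _ _ aR)->].
  have : s0 (a *m refl b) = s0 a.
    rewrite /s0 reflE dotpBr dotpZr xb mulr0 subr0.
    by case: ltrgtP xa => // ->; rewrite eqxx.
  by move=> ->; rewrite sh1 // mulr1 s0s0.
have ab : a0 *m refl b = - a0 by rewrite a0E -scalemxAl refl_self // scalerN.
have xa0 : dotp x a0 = 0 by rewrite a0E dotpZr xb mulr0.
by rewrite ab s0N ?R0rs // /s0 xa0 ltxx sh1 // mulr1 mulr1.
Qed.

End RootSigns.

(** * The cone of positive roots, integral weights and [rho] *)

Section Dominance.
Context (R : realType) (N : nat) (rs : seq 'rV[R]_N) (h : 'rV[R]_N).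
Context (Hrs : is_root_system rs) (Hh : {in rs, forall a, dotp h a != 0}).
Implicit Types (a b u v x y : 'rV[R]_N) (w : 'M[R]_N).
Notation W := (inW rs).
Notation pos := (pos rs h).
Notation R0p := (R0p rs h).
Notation weight := (weight rs).
Notation dominant := (dominant rs h).
Notation rho := (rho rs h).

(** Written so that [posspan (l - m)] is convertible to [dom_ge l m]. *)
Definition posspan y := exists k : nat -> nat,
  y = \sum_(j < size rs | pos rs`_j) (k j)%:R *: rs`_j.

Lemma posspan0 : posspan 0.
Proof. by exists (fun _ => 0); rewrite big1 // => j _; rewrite scale0r. Qed.

Lemma posspanD x y : posspan x -> posspan y -> posspan (x + y).
Proof.
move=> [k ->] [l ->]; exists (fun j => k j + l j)%N.
by rewrite -big_split; apply: eq_bigr => j _; rewrite natrD scalerDl.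
Qed.

Lemma posspan_root a : pos a -> posspan a.
Proof.
move=> pa; have ars := pos_root pa.
have ia : (index a rs < size rs)%N by rewrite index_mem.
exists (fun j => (j == index a rs)%N : nat).
rewrite (bigD1 (Ordinal ia)) /= ?nth_index // eqxx scale1r big1 ?addr0 // => j.
case/andP=> _ ja; rewrite (_ : (j == index a rs :> nat) = false) ?scale0r //.
by apply: contraNF ja => /eqP e; apply/eqP/val_inj.
Qed.

Lemma posspan_sum (I : eqType) (s : seq I) (P : pred I) (F : I -> 'rV[R]_N) :
  (forall i, i \in s -> P i -> posspan (F i)) -> posspan (\sum_(i <- s | P i) F i).
Proof.
move=> H; rewrite big_seq_cond; apply: big_ind => [||i /andP[]]; last exact: H.
- exact: posspan0.
- exact: posspanD.
Qed.

Lemma posspanMn y n : posspan y -> posspan (n%:R *: y).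
Proof.
move=> Hy; elim: n => [|n IH]; first by rewrite scale0r; exact: posspan0.
by rewrite mulrS scalerDl scale1r; exact: posspanD.
Qed.

Lemma posspan_ge0 y : posspan y -> 0 <= dotp h y.
Proof.
move=> [k ->]; rewrite dotp_sumr; apply: sumr_ge0 => j pj.
by rewrite dotpZr mulr_ge0 ?ler0n // ltW // (pos_gt0 pj).
Qed.

Lemma posspan_eq0 y : posspan y -> dotp h y = 0 -> y = 0.
Proof.
move=> [k ->]; rewrite dotp_sumr => E0; apply: big1 => j pj.
have t0 (i : 'I_(size rs)) : pos rs`_i -> 0 <= dotp h ((k i)%:R *: rs`_i).
  by move=> pi; rewrite dotpZr mulr_ge0 ?ler0n // ltW // (pos_gt0 pi).
have /eqP := psumr_eq0P t0 E0 pj; rewrite dotpZr mulf_eq0 => /orP[/eqP ->|].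
  by rewrite scale0r.
by rewrite gt_eqF // (pos_gt0 pj).
Qed.

Lemma weightP y : reflect {in rs, forall a, pairing y a \is a Num.int} (weight y).
Proof. exact: allP. Qed.

Lemma weightD x y : weight x -> weight y -> weight (x + y).
Proof.
by move=> /weightP hx /weightP hy; apply/weightP => a ars; rewrite pairingDl rpredD ?hx ?hy.
Qed.

Lemma weightN x : weight x -> weight (- x).
Proof. by move=> /weightP hx; apply/weightP => a ars; rewrite pairingNl rpredN hx. Qed.

Lemma weightB x y : weight x -> weight y -> weight (x - y).
Proof. by move=> hx hy; apply: weightD => //; exact: weightN. Qed.

Lemma weight0 : weight 0.
Proof. by apply/weightP => a _; rewrite -(scale0r 0) pairingZl mul0r rpred0. Qed.

Lemma weightZint (m : int) x : weight x -> weight (m%:~R *: x).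
Proof.
by move=> /weightP hx; apply/weightP => a ars; rewrite pairingZl rpredM ?hx ?intr_int.
Qed.

Lemma weight_root a : a \in rs -> weight a.
Proof. by move=> ars; apply/weightP => b brs; exact: (root_pairing_int Hrs brs ars). Qed.

Lemma weight_sum I (s : seq I) (P : pred I) (F : I -> 'rV[R]_N) :
  (forall i, P i -> weight (F i)) -> weight (\sum_(i <- s | P i) F i).
Proof. by move=> H; apply: (big_ind (fun x => weight x)) => //; [exact: weight0 | exact: weightD]. Qed.

Lemma weight_posspan y : posspan y -> weight y.
Proof.
move=> [k ->]; apply: weight_sum => j pj; rewrite -[(k j)%:R]/(((k j)%:Z)%:~R).
by apply: weightZint; apply: weight_root; apply: pos_root pj.
Qed.

Lemma pairing_mulmxl x a w : W w -> pairing (x *m w) a = pairing x (a *m w^T).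
Proof.
by move=> Ww; rewrite -[RHS](inW_pairing Hrs _ _ Ww) -mulmxA (inW_Tmul Hrs Ww) mulmx1.
Qed.

Lemma weight_mul x w : W w -> weight x -> weight (x *m w).
Proof.
move=> Ww /weightP hx; apply/weightP => a ars; rewrite pairing_mulmxl //.
by apply/hx/(inW_root Hrs) => //; exact: inW_tr.
Qed.

Lemma dominantP y : reflect (weight y /\ forall a, pos a -> 0 <= pairing y a) (dominant y).
Proof.
apply: (iffP andP) => -[wy H]; split=> //.
  by move=> a pa; have := allP H a (pos_root pa); rewrite pa.
by apply/allP => a ars; apply/implyP; exact: H.
Qed.

Lemma pairing_gt0 y a : a != 0 -> (0 < pairing y a) = (0 < dotp y a).
Proof.
by move=> a0; rewrite /pairing pmulr_lgt0 ?invr_gt0 ?dotp_gt0 // pmulr_rgt0.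
Qed.

Lemma pairing_ge0 y a : a != 0 -> (0 <= pairing y a) = (0 <= dotp y a).
Proof.
by move=> a0; rewrite /pairing pmulr_lge0 ?invr_gt0 ?dotp_gt0 // pmulr_rge0.
Qed.

Lemma R0p_pos a : R0p a -> pos a. Proof. by case/andP. Qed.

Lemma R0p_cover a : pos a -> R0p a \/ R0p (2%:R *: a).
Proof.
move=> pa; case: (boolP (2%:R *: a \in rs)) => [a2|na2]; last by left; rewrite /Defs.R0p pa.
right; have [a0 a0R [_ U]] := R0p_line Hrs Hh (pos_root pa).
rewrite /Defs.R0p /Defs.pos a2 dotpZr mulr_gt0 ?ltr0n ?(pos_gt0 pa) //=.
rewrite scalerA; apply/negP => b4.
have n4 : ~ [\/ (2%:R * 2%:R : R) = 1, 2%:R * 2%:R = 2 :> R | 2%:R * 2%:R = 2^-1 :> R].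
  by case=> e; have : (1 : R) < 0 by [lra]; rewrite ltr10.
by apply: n4; apply: root_multiple Hrs _ _ (pos_root pa) b4 _; rewrite mulr_gt0 ?ltr0n.
Qed.

(** Twice [rho] is the sum of the positive representatives of the R_0 lines, which may be reindexed
    by [a *m w]. Subtracting the sum of the [a *m w] themselves leaves the roots made negative, each
    counted twice. *)
Lemma rho_sub w : W w ->
  rho - rho *m w = \sum_(a <- rs | R0p a && ~~ pos (a *m w)) - (a *m w).
Proof.
move=> Ww; pose f a := if pos a then a else - a.
have fe : {in rs, forall a, f (- a) = f a}.
  by move=> a ars; rewrite /f posN //; case: (pos a) => //=; rewrite opprK.
have E := even_reindex Hrs Hh +%R Ww (rs_stable Hrs 2%:R) fe.
have E1 : \sum_(a <- rs | R0p a) a = \sum_(a <- rs | R0p a) f (a *m w).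
  apply: etrans (esym E); apply: eq_bigr => a /R0p_pos pa; by rewrite /f pa.
rewrite /Defs.rho -scalemxAl mulmx_suml E1 -scalerBr -sumrB.
rewrite [X in _ *: X](_ : _ = 2%:R *: \sum_(a <- rs | R0p a && ~~ pos (a *m w)) - (a *m w)).
  by rewrite scalerA mulVf ?scale1r // pnatr_eq0.
rewrite [in RHS]big_mkcondr scaler_sumr /=; apply: eq_bigr => a _; rewrite /f.
case: (pos (a *m w)) => /=; first by rewrite subrr scaler0.
by rewrite scaler_nat mulr2n.
Qed.

Lemma rho_sub_posspan w : W w -> posspan (rho - rho *m w).
Proof.
move=> Ww; rewrite rho_sub //; apply: posspan_sum => a ars /andP[_ npa].
by apply: posspan_root; rewrite posN // inW_root.
Qed.

End Dominance.

(** * Wall roots and integral points of the open chamber *)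

Section Chambers.
Context (R : realType) (N : nat) (rs : seq 'rV[R]_N) (h : 'rV[R]_N).
Context (Hrs : is_root_system rs) (Hh : {in rs, forall a, dotp h a != 0}).
Implicit Types (a b u v x y : 'rV[R]_N) (w : 'M[R]_N).
Notation pos := (pos rs h).
Notation R0p := (R0p rs h).
Notation weight := (weight rs).
Notation dominant := (dominant rs h).
Notation rho := (rho rs h).

(* Replaces the choice of a simple root: minimising [<y,a>/<h,a>], then a
   generic second ratio, over the positive roots gives a root whose reflection
   permutes the other positive roots, and pairs to 1 with [rho]. *)
Lemma ratio_minimal_root y a0 : R0p a0 -> exists a, [/\ R0p a, pairing rho a = 1 &
  dotp y a / dotp h a <= dotp y a0 / dotp h a0].
Proof.
move=> a0R; pose s := [seq a <- rs | R0p a].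
have sP a : (a \in s) = R0p a.
  rewrite mem_filter andb_idr // => /R0p_pos; exact: pos_root.
have h0 a : R0p a -> 0 < dotp h a by move=> /R0p_pos/pos_gt0.
pose d a b := dotp h b *: a - dotp h a *: b.
have [|k kP] := @generic_vector R N [seq v <- allpairs d s s | v != 0].
  by move=> v; rewrite mem_filter => /andP[].
pose r x a := dotp x a / dotp h a.
have rE x a : R0p a -> dotp x a = r x a * dotp h a.
  by move=> /h0 ha; rewrite /r divfK // gt_eqF.
have [m ms mP] := seq_argmin (r y) (etrans (sP _) a0R).
have : m \in [seq a <- s | r y a == r y m] by rewrite mem_filter eqxx.
case/(seq_argmin (r k)) => a; rewrite mem_filter => /andP[/eqP ram].
rewrite sP => aR aP; exists a; split=> //; last by rewrite -/(r y a) ram; apply: mP; rewrite sP.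
have pa := R0p_pos aR; have ars := pos_root pa; have a_n0 := root_neq0 Hrs ars.
(* If [refl a] makes [b] negative, then [c = - (b *m refl a)] lies in R_0^+ and a multiple of [a] is
   [b + c]. The ratios of [a] are then weighted means of those of [b] and [c], so minimality forces
   equality, and the generic vector [k] makes [b] proportional to [a]. *)
have key b : R0p b -> ~~ pos (b *m refl a) -> b = a.
  move=> bR npb; have brs := pos_root (R0p_pos bR).
  pose c := - (b *m refl a); pose n := pairing b a.
  have cE : n *: a = b + c by rewrite /c reflE -/n opprB addrC subrK.
  have cR : R0p c.
    rewrite /Defs.R0p /c posN ?refl_root // npb /=.
    have [/= SN SW] := rs_stable Hrs 2%:R.
    by rewrite SN (SW _ _ (inW_refl ars)); case/andP: bR.
  have dE x : n * dotp x a = dotp x b + dotp x c by rewrite -dotpZr cE dotpDr.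
  have E x t : r x a = t -> t <= r x b -> t <= r x c -> r x b = t /\ r x c = t.
    move=> at_ tb tc; have := dE x; have := dE h.
    rewrite (rE x a aR) (rE x b bR) (rE x c cR) at_ => e1 e2.
    have hb := h0 _ bR; have hc := h0 _ cR.
    have e3 : (r x b - t) * dotp h b + (r x c - t) * dotp h c = 0.
      rewrite mulrCA e1 in e2; rewrite !mulrBl; lra.
    have p1 : 0 <= (r x b - t) * dotp h b by rewrite mulr_ge0 ?subr_ge0 // ltW.
    have p2 : 0 <= (r x c - t) * dotp h c by rewrite mulr_ge0 ?subr_ge0 // ltW.
    have /eqP := e3; rewrite paddr_eq0 // !mulf_eq0 !subr_eq0 (gt_eqF hb) (gt_eqF hc) !orbF.
    by move=> /andP[/eqP -> /eqP ->].
  have [rb rc] : r y b = r y m /\ r y c = r y m.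
    by apply: E => //; apply: mP; rewrite sP.
  have [kb _] : r k b = r k a /\ r k c = r k a.
    by apply: E => //; apply: aP; rewrite mem_filter sP ?rb ?rc eqxx.
  have /eqP : dotp k (d b a) = 0.
    rewrite /d dotpBr !dotpZr (rE k b) // (rE k a) // kb; ring.
  have [d0 _|dn0] := eqVneq (d b a) 0; last first.
    suff /negPf -> : dotp k (d b a) != 0 by []; apply: kP; rewrite mem_filter dn0 /=.
    by apply: allpairs_f; rewrite sP.
  have [a1 _ [_ U]] := R0p_line Hrs Hh ars.
  rewrite (U a 1 aR) ?scale1r //; apply: (U b (dotp h b / dotp h a)) => //.
  move/eqP: d0; rewrite subr_eq0 => /eqP/(congr1 ( *:%R (dotp h a)^-1)).
  by rewrite !scalerA mulVf ?scale1r ?gt_eqF ?h0 // mulrC.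
have := rho_sub Hrs Hh (inW_refl ars).
rewrite reflE opprB addrC subrK.
rewrite -big_filter (_ : [seq _ <- _ | _] = [:: a]).
  rewrite big_seq1 refl_self // opprK => /(congr1 (fun v => pairing v a)).
  by rewrite pairingZl pairing_self // => e; lra.
have us : uniq rs by case: Hrs.
apply: perm_small_eq; rewrite ?size_seq1 //; apply: uniq_perm; rewrite ?filter_uniq // => b.
rewrite mem_filter inE; apply/idP/eqP => [/andP[/andP[bR nb] _]|->]; first exact: key.
by rewrite aR refl_self // posN // pa.
Qed.

(** At a root [b] of minimal ratio [dotp y b / dotp h b], [rho] pairs to 1, so integrality improves
    [pairing y b > -1] to [pairing y b >= 0]; a nonnegative smallest ratio settles all other roots
    of R_0^+. *)
Lemma dominant_of_regular y : weight y ->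
  (forall a, pos a -> 0 < dotp (y + rho) a) -> dominant y.
Proof.
move=> wy reg; apply/dominantP; split=> // a pa; have ars := pos_root pa.
rewrite pairing_ge0 ?(root_neq0 Hrs ars) //.
wlog aR : a pa ars / R0p a.
  move=> H; have [aR|aR] := R0p_cover Hrs Hh pa; first exact: H.
  have pa2 := R0p_pos aR; have := H _ pa2 (pos_root pa2) aR.
  by rewrite dotpZr pmulr_rge0 ?ltr0n.
have [b [bR rb br]] := ratio_minimal_root y aR.
have pb := R0p_pos bR; have brs := pos_root pb; have b0 := root_neq0 Hrs brs.
suff yb : 0 <= dotp y b.
  have hb := pos_gt0 pb; have ha := pos_gt0 pa.
  rewrite -(pmulr_lge0 _ (_ : 0 < (dotp h a)^-1)) ?invr_gt0 //.
  by apply: le_trans br; rewrite divr_ge0 // ltW.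
rewrite -pairing_ge0 //.
have : 0 < pairing y b + 1.
  by rewrite -rb -pairingDl pairing_gt0 // reg.
have /weightP/(_ b brs)/intrP[m ->] := wy.
by rewrite -[1]/(1%:~R) -intrD ltr0z ler0z ltzD1.
Qed.

(** Round the root coefficients of [n *: h] down to integers: each product with a root changes by at
    most [B], whereas [n * dotp h a] exceeds [B] for every positive root once [n] is large. *)
Lemma exists_strict_weight : exists2 p, weight p & forall a, pos a -> 0 < dotp p a.
Proof.
have [_ _ span _ _] := Hrs; have [c hE] := span h.
pose B := \sum_(a <- rs) \sum_(k < size rs) `|dotp rs`_k a|.
pose e := (\sum_(a <- rs | pos a) (dotp h a)^-1).
have [n nP] : exists n : nat, B * e + 1 < n%:R.
  exists (Num.bound `|B * e + 1|).
  exact: le_lt_trans (ler_norm _) (archi_boundP (normr_ge0 _)).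
have n0 : 0 < (n%:R : R).
  apply: le_lt_trans nP; rewrite addr_ge0 // mulr_ge0 //.
    by apply: sumr_ge0 => *; apply: sumr_ge0.
  by apply: sumr_ge0 => a pa; rewrite invr_ge0 ltW // (pos_gt0 pa).
pose p := \sum_(k < size rs) (Num.floor (n%:R * c k))%:~R *: rs`_k.
exists p.
  apply: weight_sum => k _; apply: weightZint; apply: weight_root => //.
  exact: mem_nth.
move=> a pa; have ars := pos_root pa.
have ha := pos_gt0 pa.
have : dotp (n%:R *: h - p) a <= B.
  rewrite hE scaler_sumr -sumrB dotp_suml.
  apply: (@le_trans _ _ (\sum_(k < size rs) `|dotp rs`_k a|)); last first.
    rewrite /B (big_rem a) //= lerDl; apply: sumr_ge0 => *; exact: sumr_ge0.
  apply: ler_sum => k _; rewrite scalerA -scalerBl dotpZl.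
  apply: le_trans (ler_norm _) _; rewrite normrM ler_piMl //.
  have /andP[f1 f2] := floor_itv (n%:R * c k).
  rewrite ger0_norm ?subr_ge0 // lerBlDl; apply: ltW; by rewrite intrD in f2.
have : B < n%:R * dotp h a.
  rewrite -ltr_pdivrMr //; apply: le_lt_trans nP; rewrite -[leLHS]addr0 lerD //.
  apply: ler_wpM2l; first by apply: sumr_ge0 => *; apply: sumr_ge0.
  rewrite /e (big_rem a) //= pa lerDl; apply: sumr_ge0 => b pb.
  by rewrite invr_ge0 ltW // (pos_gt0 pb).
rewrite dotpBl dotpZl; lra.
Qed.

End Chambers.

(** * Weyl orbits of weights *)

Section WeylOrbits.
Context (R : realType) (N : nat) (rs : seq 'rV[R]_N) (h : 'rV[R]_N).
Context (Ws : seq 'M[R]_N).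
Context (Hrs : is_root_system rs) (Hh : {in rs, forall a, dotp h a != 0}).
Context (HW : forall w, w \in Ws <-> inW rs w).
Implicit Types (a b u v x y : 'rV[R]_N) (w : 'M[R]_N).
Notation W := (inW rs).
Notation pos := (pos rs h).
Notation R0p := (R0p rs h).
Notation weight := (weight rs).
Notation dominant := (dominant rs h).
Notation rho := (rho rs h).
Notation posspan := (posspan rs h).

Lemma orbit_argmax x (P : 'M[R]_N -> Prop) : P 1%:M -> exists w, [/\ W w, P w &
  forall w1, W w1 -> P w1 -> dotp h (x *m w1) <= dotp h (x *m w)].
Proof.
move=> P1; pose s := [seq w <- Ws | `[< P w >]].
have sP w : (w \in s) <-> (W w /\ P w).
  by rewrite mem_filter -HW; split=> [/andP[/asboolP]|[-> /asboolP ->]].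
have /(seq_argmin (fun w => - dotp h (x *m w)))[w /sP[Ww Pw] wm] : 1%:M \in s.
  by apply/sP; split=> //; exact: inW1.
by exists w; split=> // v Wv Pv; rewrite -lerN2 wm //; apply/sP.
Qed.

(** Among the orbit points lying above [x], take one with the largest product with [h]. A negative
    pairing with a positive root would let the reflection in that root move it further up. *)
Lemma dominant_above x : weight x -> exists w,
  [/\ W w, dominant (x *m w) & posspan (x *m w - x)].
Proof.
move=> wx; have [|w [Ww Pw wm]] := @orbit_argmax x (fun w => posspan (x *m w - x)).
  by rewrite mulmx1 subrr; exact: posspan0.
exists w; split=> //; apply/dominantP; split; first exact: weight_mul.
move=> a pa; have ars := pos_root pa; rewrite leNgt; apply/negP => n0.
have /weightP/(_ a ars)/intrP[m mE] := weight_mul Hrs Ww wx.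
have e : x *m (w *m refl a) = x *m w + `|m|%N%:R *: a.
  rewrite mulmxA reflE mE; congr (_ + _); rewrite -scaleNr; congr (_ *: _).
  have : m < 0 by rewrite -(ltrz0 R) -mE.
  by case: m {mE} => // k _; rewrite NegzE mulrNz opprK.
have := wm (w *m refl a) (inWS Ww ars); rewrite e => /(_ _).
have Hp : posspan (x *m w + `|m|%:R *: a - x).
  by rewrite addrAC; apply: posspanD => //; apply: posspanMn; exact: posspan_root.
move/(_ Hp); rewrite dotpDr dotpZr gerDl leNgt mulr_gt0 ?(pos_gt0 pa) //.
by rewrite ltr0n absz_gt0; apply: contraTneq n0 => m0; rewrite mE m0 ltxx.
Qed.

Lemma regular_orbit x : {in rs, forall a, dotp x a != 0} ->
  exists2 w, W w & forall a, pos a -> 0 < dotp (x *m w) a.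
Proof.
move=> xr; have [//|w [Ww _ wm]] := @orbit_argmax x (fun=> True).
exists w => // a pa; have ars := pos_root pa.
have a0 := root_neq0 Hrs ars.
have n0 : dotp (x *m w) a != 0.
  rewrite dotp_mulmxl; apply/xr/(inW_root Hrs) => //; exact: inW_tr.
rewrite lt_def n0 /= leNgt; apply/negP => l0.
have := wm (w *m refl a) (inWS Ww ars) I.
rewrite mulmxA reflE dotpBr dotpZr lerBlDr lerDl leNgt.
by rewrite pmulr_llt0 ?(pos_gt0 pa) // -oppr_gt0 -pairingNl pairing_gt0 // dotpNl oppr_gt0 l0.
Qed.

(** The exponents that occur when the product [delta] is multiplied out. *)
Definition dexp y := exists e : 'rV[R]_N -> bool,
  y = 2^-1 *: \sum_(a <- rs | R0p a) (-1) ^+ e a *: a.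

Lemma dexp_mul y w : W w -> dexp y -> dexp (y *m w).
Proof.
move=> Ww [e ->].
exists (fun a => if pos (a *m w^T) then e (a *m w^T) else ~~ e (- (a *m w^T))).
rewrite -scalemxAl mulmx_suml; congr (_ *: _).
pose G b := if pos (b *m w^T) then (-1) ^+ e (b *m w^T) *: b
            else (-1) ^+ e (- (b *m w^T)) *: - b.
have Ge : {in rs, forall a, G (- a) = G a}.
  move=> a ars; have awr := inW_root Hrs (inW_tr Ww) ars.
  by rewrite /G mulNmx posN //; case: (pos (a *m w^T)) => //=; rewrite !opprK.
have := even_reindex Hrs Hh +%R Ww (rs_stable Hrs 2%:R) Ge; rewrite /= => E.
apply: etrans (etrans _ E) _.
  apply: eq_bigr => a /R0p_pos pa.
  by rewrite /G -mulmxA (inW_mulT Hrs Ww) mulmx1 pa scalemxAl.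
apply: eq_bigr => a _; rewrite /G; case: ifP => // _.
by case: (e _) => /=; rewrite ?expr0 ?expr1 ?scaleN1r ?scale1r ?opprK.
Qed.

Lemma dexp_posspan y : dexp y -> posspan (rho - y).
Proof.
move=> [e ->]; rewrite /Defs.rho -scalerBr -sumrB scaler_sumr.
apply: posspan_sum => a _ /R0p_pos pa; case: (e a) => /=.
  rewrite expr1 scaleN1r opprK -mulr2n -[a *+ 2]scaler_nat scalerA mulVf ?pnatr_eq0 //.
  by rewrite scale1r; exact: posspan_root.
by rewrite expr0 scale1r subrr scaler0; exact: posspan0.
Qed.

Context (Hu : forall x w, dominant x -> W w -> dominant (x *m w) -> x *m w = x).

(** The dominant weight above [x *m w] is in the orbit of [x], hence equals [x] by [Hu]. That an
    orbit holds at most one dominant weight is assumed in this section and supplied later by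
    [dominant_uniq]. *)
Lemma dominant_max x w : dominant x -> W w -> posspan (x - x *m w).
Proof.
move=> dx Ww; have [wx _] := dominantP _ _ _ dx.
have [v [Wv dv pv]] := dominant_above (weight_mul Hrs Ww wx).
rewrite -mulmxA in dv pv.
by rewrite (Hu dx (inW_mul Ww Wv) dv) in pv.
Qed.

(** Such a [w] preserves dominance, hence fixes every dominant weight by [Hu]. Each root is a
    difference of two dominant weights, and the roots span. *)
Lemma pos_fix_id w : W w -> (forall a, pos a -> pos (a *m w)) -> w = 1%:M.
Proof.
move=> Ww pw; have [p wp pp] := exists_strict_weight h Hrs.
have pwT a : pos a -> pos (a *m w^T).
  move=> pa; have ars := pos_root pa.
  have awr := inW_root Hrs (inW_tr Ww) ars.
  apply/negPn/negP; rewrite -posN // => /pw; rewrite mulNmx -mulmxA (inW_Tmul Hrs Ww).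
  by rewrite mulmx1 posN // pa.
have dw x : dominant x -> x *m w = x.
  move=> dx; apply: Hu => //; have [wx xp] := dominantP _ _ _ dx.
  apply/dominantP; split; first exact: weight_mul.
  by move=> a pa; rewrite (pairing_mulmxl Hrs) //; apply/xp/pwT.
have dp : dominant p.
  apply/dominantP; split=> // a pa; rewrite pairing_ge0 ?ltW ?pp //.
  exact: root_neq0 Hrs _ (pos_root pa).
have rw b : b \in rs -> b *m w = b.
  (* By integrality the strict weight [p] pairs to at least 1 with every positive root, so this [k]
     makes [b + k p] dominant. *)
  move=> brs; pose k := Num.bound (\sum_(a <- rs | pos a) `|pairing b a|).
  have kp a : pos a -> `|pairing b a| <= k%:R * pairing p a.
    move=> pa; have ars := pos_root pa.
    have p1 : 1 <= pairing p a.
      have /weightP/(_ a ars)/intrP[m mE] := wp.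
      have : 0 < pairing p a by rewrite pairing_gt0 ?pp // (root_neq0 Hrs ars).
      by rewrite mE ltr0z gtz0_ge1 -(ler_int R).
    apply: (@le_trans _ _ k%:R); last by rewrite ler_peMr.
    apply: ltW; apply: le_lt_trans (archi_boundP _); last by apply: sumr_ge0.
    by rewrite (big_rem a) //= pa lerDl; apply: sumr_ge0.
  have dbk : dominant (b + k%:R *: p).
    apply/dominantP; split.
      by apply: weightD; [exact: weight_root | exact: (weightZint k%:Z wp)].
    move=> a pa; rewrite pairingDl pairingZl -lerBlDl sub0r.
    by apply: le_trans (kp _ pa); rewrite -normrN ler_norm.
  have := dw _ dbk; rewrite mulmxDl -scalemxAl (dw _ dp).
  by move/addIr.
apply: eq_mulmx => v; have [_ _ span _ _] := Hrs; have [c ->] := span v.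
rewrite mulmx1 mulmx_suml; apply: eq_bigr => k _.
by rewrite -scalemxAl rw // mem_nth.
Qed.

End WeylOrbits.

Lemma foldr_min_le (R : realDomainType) (x0 : R) s x :
  x \in x0 :: s -> foldr Num.min x0 s <= x.
Proof.
elim: s x => [|y s IH] x /=; first by rewrite inE => /eqP ->.
rewrite !inE ge_min => /or3P[/eqP -> |/eqP ->|xs]; rewrite ?lexx //.
  by rewrite IH ?orbT // mem_head.
by rewrite IH ?orbT // inE xs orbT.
Qed.

Lemma mlam_le (R : realType) N (rs : seq 'rV[R]_N) h l a :
  pos rs h a -> mlam rs h l <= pairing l a.
Proof.
move=> pa; rewrite /mlam.
have : pairing l a \in [seq pairing l a | a <- rs & pos rs h a].
  by apply: map_f; rewrite mem_filter pa (pos_root pa).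
by case: [seq _ | _ <- _ & _] => // x s; exact: foldr_min_le.
Qed.

(** * Lebesgue measure and the alcove *)

Section LebRn.
Context (R : realType).
Local Open Scope ereal_scope.
Notation Om n := (sfm_T (lebRn R n)).
Notation mu n := (sfm_mu (lebRn R n)).
Notation vec := (@lebRn_vec R _).

Fixpoint unvec (n : nat) : 'rV[R]_n.+1 -> Om n :=
  match n return 'rV[R]_n.+1 -> Om n with
  | 0 => fun v => v ord0 ord0
  | n'.+1 => fun v => (v ord0 ord0, unvec (\row_j v ord0 (lift ord0 j)))
  end.

Lemma unvecK n (v : 'rV[R]_n.+1) : vec (unvec v) = v.
Proof.
apply/rowP => i; rewrite mxE; elim: n v i => [|n IH] v i /=.
  by rewrite (ord1 i).
by case: unliftP => [j ->|-> //]; rewrite IH mxE.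
Qed.

Lemma measurable_coord n (i : 'I_n.+1) :
  measurable_fun setT (fun x : Om n => lebRn_coord x i).
Proof.
elim: n i => [|n IH] i /=; first exact: measurable_id.
case: unliftP => [j _|_]; last exact: measurable_fst.
refine (@measurableT_comp _ _ _ _ _ _ _ _ _ (IH j) (@measurable_snd _ _ _ _)).
Qed.

Lemma measurable_unvec d (T : measurableType d) n (f : T -> 'rV[R]_n.+1) :
  (forall i, measurable_fun setT (fun x => f x ord0 i)) ->
  measurable_fun setT (fun x => unvec (f x)).
Proof.
elim: n f => [|n IH] f mf /=; first exact: mf.
apply: measurable_fun_pair; first exact: mf.
apply: IH => i.
under eq_fun do rewrite mxE.
exact: mf.
Qed.

Definition measF n (F : 'rV[R]_n.+1 -> \bar R) :=
  measurable_fun setT (fun x : Om n => F (vec x)).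

(** Measurability of a function of row vectors means measurability after [lebRn_vec]; factoring [f]
    through the right inverse [unvec] reduces the claim to the coordinates of [f]. *)
Lemma measF_comp d (T : measurableType d) n (F : 'rV[R]_n.+1 -> \bar R)
    (f : T -> 'rV[R]_n.+1) :
  (forall i, measurable_fun setT (fun x => f x ord0 i)) ->
  measF F -> measurable_fun setT (fun x => F (f x)).
Proof.
move=> mf mF; have := measurableT_comp mF (measurable_unvec mf).
by apply: eq_measurable_fun => x _ /=; rewrite unvecK.
Qed.

Definition IR n (F : 'rV[R]_n.+1 -> \bar R) := \int[mu n]_x F (vec x).

Lemma lebesgue_measure_shift (c : R) (A : set R) : measurable A ->
  pushforward lebesgue_measure ((fun x => x + c)%R : _ -> measurableTypeR R) A
  = lebesgue_measure A.
Proof.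
have mc : measurable_fun setT ((fun x => x + c)%R : measurableTypeR R -> measurableTypeR R).
  exact: measurable_funD.
move=> mA; apply/esym.
pose phi : measurableTypeR R -> measurableTypeR R := (fun x => x + c)%R.
pose mphi := isMeasurableFun.Build _ _ _ _ phi mc.
pose phiM : {mfun _ >-> _} := HB.pack phi mphi.
rewrite (@lebesgue_measure_unique R (pushforward lebesgue_measure phiM)) //= => _ [[a b]] _ <-.
rewrite /pushforward/=.
have -> : phi @^-1` [set` `]a, b]] = [set` `](a - c)%R, (b - c)%R]].
  by apply/seteqP; split => x /=; rewrite !in_itv/= /phi ltrBlDr lerBrDr.
rewrite !lebesgue_measure_itv/= !lte_fin ltrD2r; case: ifP => // _.
by rewrite -!EFinB; congr (_%:E); ring.
Qed.

Lemma integral_shiftR (c : R) (f : R -> \bar R) :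
  measurable_fun setT f -> (forall x, 0 <= f x) ->
  \int[lebesgue_measure]_x f (x + c)%R = \int[lebesgue_measure]_x f x.
Proof.
move=> mf f0.
have mc : measurable_fun setT ((fun x => x + c)%R : measurableTypeR R -> measurableTypeR R).
  exact: measurable_funD.
rewrite -[LHS](@ge0_integral_pushforward _ _ _ _ _ _ mc lebesgue_measure setT f) //.
apply: eq_measure_integral => //= A mA _; exact: lebesgue_measure_shift.
Qed.

End LebRn.

(** * Lebesgue measure under translations and isometries *)

Section Invariance.
Context (R : realType).
Local Open Scope ereal_scope.
Notation Om n := (sfm_T (lebRn R n)).
Notation mu n := (sfm_mu (lebRn R n)).
Notation vec := (@lebRn_vec R _).

Definition consv n (x : R) (v : 'rV[R]_n.+1) : 'rV[R]_n.+2 :=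
  \row_i (if unlift ord0 i is Some j then v ord0 j else x).

Lemma vec_pair n (x : R) (y : Om n) : @lebRn_vec R n.+1 (x, y) = consv x (vec y).
Proof. by apply/rowP => i; rewrite !mxE /=; case: unliftP => // j; rewrite mxE. Qed.

Lemma consvD n x (v : 'rV[R]_n.+1) (t : 'rV[R]_n.+2) :
  (consv x v + t = consv (x + t ord0 ord0) (v + \row_j t ord0 (lift ord0 j)))%R.
Proof.
by apply/rowP => i; rewrite !mxE; case: unliftP => [j ->|->]; rewrite ?mxE.
Qed.

Lemma measurable_vec n (i : 'I_n.+1) :
  measurable_fun setT (fun x : Om n => vec x ord0 i).
Proof. by under eq_fun do rewrite mxE; exact: measurable_coord. Qed.

Lemma measF_shift n (F : 'rV[R]_n.+1 -> \bar R) t :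
  measF F -> @measF R n (fun v => F (v + t)%R).
Proof.
apply: measF_comp => i; under eq_fun do rewrite mxE.
by apply: measurable_funD => //; exact: measurable_vec.
Qed.

Lemma measurable_mulmx d (T : measurableType d) n (f : T -> 'rV[R]_n.+1)
    (g : 'M[R]_n.+1) i :
  (forall i, measurable_fun setT (fun x => f x ord0 i)) ->
  measurable_fun setT (fun x => (f x *m g)%R ord0 i).
Proof.
move=> mf; under eq_fun do rewrite mxE.
by apply: measurable_sum => k; apply: measurable_funM.
Qed.

Lemma measF_mulmx n (F : 'rV[R]_n.+1 -> \bar R) g :
  measF F -> @measF R n (fun v => F (v *m g)%R).
Proof. by apply: measF_comp => i; apply: measurable_mulmx => j; exact: measurable_vec. Qed.

Lemma IR_ge0 n (F : 'rV[R]_n.+1 -> \bar R) : (forall v, 0 <= F v) -> 0 <= IR F.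
Proof. by move=> F0; apply: integral_ge0. Qed.

Lemma eq_IR n (F G : 'rV[R]_n.+1 -> \bar R) : F =1 G -> IR F = IR G.
Proof. by move=> FG; apply: eq_integral. Qed.

Lemma measF_cons n (F : 'rV[R]_n.+2 -> \bar R) x :
  measF F -> @measF R n (fun v => F (consv x v)).
Proof.
apply: measF_comp => i; under eq_fun do rewrite mxE.
case: unliftP => [j _|_]; [exact: measurable_vec|exact: measurable_cst].
Qed.

Lemma IR_cons n (F : 'rV[R]_n.+2 -> \bar R) : measF F -> (forall v, 0 <= F v) ->
  IR F = \int[lebesgue_measure]_x @IR R n (fun v => F (consv x v)).
Proof.
move=> mF F0; rewrite /IR.
apply: etrans (@fubini_tonelli1 _ _ _ _ _ lebesgue_measure (mu n) _ mF (fun z => F0 _)) _.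
by apply: eq_integral => x _; apply: eq_integral => y _; rewrite vec_pair.
Qed.

Lemma measurable_IR_cons n (F : 'rV[R]_n.+2 -> \bar R) :
  measF F -> (forall v, 0 <= F v) ->
  measurable_fun setT (fun x => @IR R n (fun v => F (consv x v))).
Proof.
move=> mF F0.
have := @measurable_fun_fubini_tonelli_F _ _ _ _ _ (mu n) _ mF (fun z => F0 _).
apply: eq_measurable_fun => x _; apply: eq_integral => y _.
by rewrite vec_pair.
Qed.

Lemma IR_shift n (F : 'rV[R]_n.+1 -> \bar R) t : measF F -> (forall v, 0 <= F v) ->
  @IR R n (fun v => F (v + t)%R) = IR F.
Proof.
elim: n F t => [|n IH] F t mF F0.
  have mF' : measurable_fun setT (fun x : R => F (\row_i x)).
    by apply: eq_measurable_fun mF => x _; congr F.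
  rewrite /IR -[RHS](@integral_shiftR R (t ord0 ord0) (fun x => F (\row_i x))) //.
    by apply: eq_integral => x _; congr F; apply/rowP => i; rewrite !mxE ord1.
rewrite (IR_cons (measF_shift t mF)) // (IR_cons mF F0).
rewrite -[RHS](@integral_shiftR R (t ord0 ord0)).
- apply: eq_integral => x _.
  under eq_IR do rewrite consvD.
  rewrite (IH (fun v => F (consv (x + t ord0 ord0)%R v))) //.
  exact: measF_cons.
- exact: measurable_IR_cons.
- by move=> x; exact: IR_ge0.
Qed.

Lemma IR_swap n (f : 'rV[R]_n.+1 -> 'rV[R]_n.+1 -> \bar R) :
  measurable_fun setT (fun z : Om n * Om n => f (vec z.1) (vec z.2)) ->
  (forall x y, 0 <= f x y) ->
  @IR R n (fun x => IR (f x)) = @IR R n (fun y => IR (f^~ y)).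
Proof.
move=> mf f0; exact: (@fubini_tonelli _ _ _ _ _ (mu n) (mu n) _ mf (fun z => f0 _ _)).
Qed.

Lemma IR_Zl n (F : 'rV[R]_n.+1 -> \bar R) k : measF F -> (forall v, 0 <= F v) ->
  0 <= k -> @IR R n (fun v => k * F v) = k * IR F.
Proof. by move=> mF F0 k0; apply: ge0_integralZl. Qed.

(* Convolution trick: translation invariance alone forces the image measure
   under [g] to be a multiple of Lebesgue measure, and the [g]-invariant test
   function [G] shows that the multiple is 1. *)
Lemma IR_orth n (F G : 'rV[R]_n.+1 -> \bar R) (g : 'M[R]_n.+1) :
  (g^T *m g = 1%:M)%R ->
  measF F -> (forall v, 0 <= F v) -> measF G -> (forall v, 0 <= G v) ->
  (forall v, G (- (v *m g))%R = G v) -> 0 < IR G -> IR G < +oo ->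
  @IR R n (fun v => F (v *m g)%R) = IR F.
Proof.
move=> gg mF F0 mG G0 Ginv IG0 IGoo.
have IGfin : IR G \is a fin_num by rewrite ge0_fin_numE // ltW.
suff h : IR G * @IR R n (fun v => F (v *m g)%R) = IR G * IR F.
  by apply/eqP; rewrite eq_le -(lee_pmul2l IGfin IG0) h lexx -(lee_pmul2l IGfin IG0) h lexx.
have mFg : @measF R n (fun v => F (v *m g)%R) by exact: measF_mulmx.
rewrite -IR_Zl //; last exact: ltW.
transitivity (@IR R n (fun x => @IR R n (fun y => F (x *m g)%R * G (y - x *m g)%R))).
  apply: eq_IR => x; rewrite IR_Zl //; last exact: measF_shift.
  by rewrite IR_shift // muleC.
have m1 (i : 'I_n.+1) : measurable_fun setT (fun z : Om n * Om n => vec z.1 ord0 i).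
  exact: (measurableT_comp (measurable_vec i) measurable_fst).
have m2 (i : 'I_n.+1) : measurable_fun setT (fun z : Om n * Om n => vec z.2 ord0 i).
  exact: (measurableT_comp (measurable_vec i) measurable_snd).
have m1g (i : 'I_n.+1) : measurable_fun setT (fun z : Om n * Om n => (vec z.1 *m g)%R ord0 i).
  by apply: measurable_mulmx.
rewrite IR_swap; last 2 first.
- apply: emeasurable_funM; first exact: measF_comp.
  apply: measF_comp => // i; under eq_fun do rewrite mxE [X in (_ + X)%R]mxE.
  exact: measurable_funB.
- by move=> x y; exact: mule_ge0.
(* Translate [x] by [y *m g^T]: then [x *m g] turns into [x *m g + y], so [y] shifts [F], while [G]
   sees only [- (x *m g)], where its value is [G x] by invariance. *)
transitivity (@IR R n (fun y => @IR R n (fun x => F (x *m g + y)%R * G (- (x *m g))%R))).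
  apply: eq_IR => y; rewrite -[LHS](@IR_shift _ _ (y *m g^T)%R).
  - apply: eq_IR => x; rewrite mulmxDl -mulmxA gg mulmx1.
    by congr (_ * G _); rewrite opprD addrCA subrr addr0.
  - apply: emeasurable_funM; first exact: mFg.
    apply: measF_comp => // i; under eq_fun do rewrite mxE [X in (_ + X)%R]mxE.
    apply: measurable_funB => //; apply: measurable_mulmx => j; exact: measurable_vec.
  - by move=> v; exact: mule_ge0.
rewrite -IR_swap; last 2 first.
- apply: emeasurable_funM.
    apply: measF_comp => // i; under eq_fun do rewrite mxE.
    exact: measurable_funD.
  apply: measF_comp => // i; under eq_fun do rewrite mxE.
  exact: measurableT_comp.
- by move=> x y; exact: mule_ge0.
rewrite [RHS]muleC -IR_Zl //; last exact: IR_ge0.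
apply: eq_IR => x; under eq_IR do rewrite Ginv muleC addrC.
rewrite IR_Zl //; last exact: measF_shift.
by rewrite IR_shift // muleC.
Qed.

Lemma measurable_bool_EFin d (T : measurableType d) (b : T -> bool) :
  measurable_fun setT b -> measurable_fun setT (fun x => ((b x)%:R : R)%:E).
Proof.
move=> mb; have := @measurable_fun_ifT _ _ _ _ (cst 1%E) (cst 0%E : T -> \bar R) b mb
  (measurable_cst _) (measurable_cst _).
by apply: eq_measurable_fun => x _; case: (b x).
Qed.

Lemma measurable_dotp n (a : 'rV[R]_n.+1) :
  measurable_fun setT (fun x : Om n => dotp (vec x) a).
Proof.
apply: measurable_sum => k; apply: measurable_funM => //; exact: measurable_vec.
Qed.

(* The measures of the hyperplanes parallel to a given one are all equal, and
   they integrate to 0 over the transverse coordinate. *)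
Lemma IR_hyperplane n (a : 'rV[R]_n.+1) (c : R) : a != 0%R ->
  @IR R n (fun v => ((dotp v a == c)%R%:R)%:E) = 0.
Proof.
move=> a0; have aa0 : dotp a a != 0%R by rewrite dotp_eq0.
pose H (c : R) := fun v : 'rV[R]_n.+1 => ((dotp v a == c)%R%:R)%:E : \bar R.
have H0 d v : 0 <= H d v by rewrite /H lee_fin ler0n.
have mH2 : measurable_fun setT (fun z : R * Om n => H z.1 (vec z.2)).
  apply: measurable_bool_EFin; apply: measurable_fun_eqr; last exact: measurable_fst.
  exact: (measurableT_comp (measurable_dotp a) measurable_snd).
have mH d : measF (H d).
  exact: (measurableT_comp mH2 (pair1_measurable d)).
have Hs d : IR (H d) = IR (H c).
  rewrite -[LHS](IR_shift ((d - c) / dotp a a *: a)%R (mH d)) //.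
  apply: eq_IR => v; rewrite /H; congr ((nat_of_bool _)%:R%:E).
  rewrite dotpDl dotpZl divfK // -(subr_eq0 _ c) -(subr_eq0 _ d); congr (_ == _).
  by ring.
have key : \int[lebesgue_measure]_d IR (H d) = 0.
  rewrite [LHS](@fubini_tonelli _ _ _ _ _ lebesgue_measure (mu n) _ mH2 (fun z => H0 _ _)).
  apply: integral0_eq => x _ /=.
  rewrite -[RHS](@lebesgue_measure_set1 R (dotp (vec x) a)) -[in RHS](setIT [set _]).
  rewrite -integral_indic //; apply: eq_integral => y _.
  rewrite /H indicE; congr (_%:R%:E); congr nat_of_bool.
  by apply/eqP/idP => [->|/set_mem ->//]; exact: mem_set.
rewrite -[LHS]/(IR (H c)).
have : \int[lebesgue_measure]_d IR (H c) = 0.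
  by rewrite -[RHS]key; apply: eq_integral => d _; rewrite Hs.
have leboo : lebesgue_measure [set: R] = +oo :> \bar R.
  by have := @lebesgue_measure_itv R `]-oo, +oo[; rewrite set_itvNyy.
move: (IR (H c)) (IR_ge0 (H0 c)) => k.
rewrite integral_cst //; set l := (X in _ * X); have -> : l = +oo by exact: leboo.
by rewrite le_eqVlt => /predU1P[<-//|h]; rewrite gt0_muley.
Qed.

Lemma measF_cube m (r : R) :
  @measF R m (fun v => ([forall i, (-r <= v ord0 i <= r)%R]%:R)%:E).
Proof.
apply: measurable_bool_EFin.
have : measurable_fun setT (fun x : Om m => \big[andb/true]_i (-r <= vec x ord0 i <= r)%R).
  elim: (index_enum _) => [|i s IH].
    by apply: eq_measurable_fun (measurable_cst true) => x _; rewrite big_nil.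
  have h : measurable_fun setT (fun x : Om m => (-r <= vec x ord0 i <= r)%R).
    by apply: measurable_and; apply: measurable_fun_ler => //; exact: measurable_vec.
  by apply: eq_measurable_fun (measurable_and h IH) => x _; rewrite big_cons.
by apply: eq_measurable_fun => x _; rewrite big_andE.
Qed.

(** Provides the finite upper bound on the ball that serves as test function in [IR_Weyl]. *)
Lemma IR_cube n (r : R) : (0 <= r)%R ->
  @IR R n (fun v => ([forall i, (-r <= v ord0 i <= r)%R]%:R)%:E) < +oo.
Proof.
move=> r0; pose Q n (v : 'rV[R]_n.+1) := [forall i, (-r <= v ord0 i <= r)%R].
have mQ m : measF (fun v => ((Q m v)%:R)%:E) by exact: measF_cube.
have Q0 m (v : 'rV[R]_m.+1) : 0 <= ((Q m v)%:R)%:E :> \bar R by rewrite lee_fin ler0n.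
pose q (x : R) := (-r <= x <= r)%R.
have Iq : \int[lebesgue_measure]_x ((q x)%:R)%:E < +oo :> \bar R.
  have -> : (fun x => ((q x)%:R)%:E) = (fun x => (\1_`[(-r)%R, r] x)%:E) :> (R -> \bar R).
    apply/funext => x; rewrite indicE; congr (_%:R%:E); congr nat_of_bool.
    by apply/idP/idP; rewrite ?inE/= in_itv.
  rewrite integral_indic // setIT.
  have := @lebesgue_measure_itv R `[(-r)%R, r]; rewrite /= => ->; case: ifP => // _.
  by rewrite -EFinB ltry.
have mq : measurable_fun setT (fun x : R => ((q x)%:R)%:E : \bar R).
  by apply: measurable_bool_EFin; apply: measurable_and; apply: measurable_fun_ler.
elim: n => [|n IH].
  rewrite /IR (_ : (fun x => _) = (fun x : R => ((q x)%:R)%:E)) //.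
  apply/funext => x; congr (_%:R%:E); congr nat_of_bool.
  apply/forallP/idP => [/(_ ord0)|qx i]; by rewrite mxE.
rewrite (IR_cons (mQ _)) //.
under eq_integral => x _.
  rewrite (_ : IR _ = (@IR R n (fun v => ((Q n v)%:R)%:E)) * ((q x)%:R)%:E); last first.
    rewrite muleC -IR_Zl ?lee_fin //; apply: eq_IR => v.
    rewrite -EFinM -natrM mulnb; congr (_%:R%:E); congr nat_of_bool.
    apply/forallP/andP => [h|[h1 /forallP h2] i]; rewrite ?mxE.
      split; first by have := h ord0; rewrite mxE unlift_none.
      by apply/forallP => i; have := h (lift ord0 i); rewrite mxE liftK.
    by case: unliftP.
  over.
rewrite ge0_integralZl //; last exact: IR_ge0.
by apply: lte_mul_pinfty => //; [exact: IR_ge0 | rewrite ge0_fin_numE //; exact: IR_ge0].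
Qed.

End Invariance.

(** * The coroot lattice, affine mirrors and the alcove *)

Section Alcove.
Context (R : realType) (N : nat) (rs : seq 'rV[R]_N) (h : 'rV[R]_N).
Context (Ws : seq 'M[R]_N).
Context (Hrs : is_root_system rs) (Hh : {in rs, forall a, dotp h a != 0}).
Context (HW : forall w, w \in Ws <-> inW rs w).
Implicit Types (a b u v x y t : 'rV[R]_N) (w : 'M[R]_N).
Notation W := (inW rs).
Notation pos := (pos rs h).
Notation weight := (weight rs).
Notation pi2 := (2 * pi : R).
Notation q x := (dotp x x).

Definition coroot a := (2 / dotp a a) *: a.

Lemma dotp_coroot v a : dotp v (coroot a) = pairing v a.
Proof. by rewrite /coroot dotpZr /pairing; ring. Qed.

(** The coroot lattice scaled by [2 pi], so that its elements are periods of every character with a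
    weight as exponent. Negatives are reached because [- a] is a root. *)
Inductive coroot_lattice : 'rV[R]_N -> Prop :=
  | lattice0 : coroot_lattice 0
  | latticeS t a : coroot_lattice t -> a \in rs ->
      coroot_lattice (t + pi2 *: coroot a).
Notation L := coroot_lattice.

Lemma latticeD s t : L s -> L t -> L (s + t).
Proof.
move=> Ls; elim=> [|v a _ IH ars]; first by rewrite addr0.
by rewrite addrA; apply: latticeS.
Qed.

Lemma lattice_coroot a : a \in rs -> L (pi2 *: coroot a).
Proof. by move=> ars; rewrite -[X in L X]add0r; apply: latticeS => //; exact: lattice0. Qed.

Lemma latticeN t : L t -> L (- t).
Proof.
elim=> [|v a _ IH ars]; first by rewrite oppr0; exact: lattice0.
rewrite opprD; apply: latticeD => //.
have -> : - (pi2 *: coroot a) = pi2 *: coroot (- a).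
  by rewrite /coroot dotpNl dotpNr opprK !scalerN.
by apply: lattice_coroot; rewrite opp_root.
Qed.

Lemma coroot_mul a w : W w -> coroot a *m w = coroot (a *m w).
Proof. by move=> Ww; rewrite /coroot (inW_dotp Hrs) // !scalemxAl. Qed.

Lemma lattice_mul t w : W w -> L t -> L (t *m w).
Proof.
move=> Ww; elim=> [|v a _ IH ars]; first by rewrite mul0mx; exact: lattice0.
rewrite mulmxDl; apply: latticeD => //.
rewrite -scalemxAl coroot_mul //.
by apply: lattice_coroot; apply: inW_root.
Qed.

Lemma lattice_dotp t x : L t -> weight x -> exists m : int, dotp x t = pi2 * m%:~R.
Proof.
move=> + wx; elim=> [|v a _ [m IH] ars]; first by exists 0; rewrite dotp0r mulr0.
have /weightP/(_ a ars)/intrP[k kE] := wx.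
by exists (m + k); rewrite dotpDr IH dotpZr dotp_coroot kE intrD; ring.
Qed.

Lemma span_inj x y : {in rs, forall a, dotp x a = dotp y a} -> x = y.
Proof.
move=> xy; apply: dotp_inj => v; have [_ _ span _ _] := Hrs; have [c ->] := span v.
rewrite !dotp_suml; apply: eq_bigr => k _.
by rewrite !dotpZl !(dotpC _`_k) xy // mem_nth.
Qed.

Lemma dotp_le_2 x y : q (x + y) <= 2 * q x + 2 * q y.
Proof.
have := dotp_ge0 (x - y).
by rewrite !(dotpBl, dotpBr, dotpDl, dotpDr) (dotpC y x); lra.
Qed.

(** A lattice point is determined by its products with the roots. These are integer multiples of
    [2 pi], bounded on the ball, so finitely many tables of values remain. *)
Lemma lattice_finite B : exists s : seq 'rV[R]_N,
  uniq s /\ forall t, t \in s <-> (L t /\ q t <= B).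
Proof.
pose n := size rs.
have [K KP] : exists K : nat, forall t a, a \in rs -> q t <= B -> `|dotp t a| <= pi2 * K%:R.
  pose E := B + \sum_(a <- rs) q a.
  exists (Num.bound `|E|) => t a ars tB.
  have EK : E <= (Num.bound `|E|)%:R.
    exact/ltW/(le_lt_trans (ler_norm _) (archi_boundP (normr_ge0 _))).
  have Ea : q t + q a <= E.
    rewrite lerD // (big_rem a) //= lerDl; apply: sumr_ge0 => *; exact: dotp_ge0.
  have p1 : 1 <= pi2 by have := pi_ge2 R; lra.
  have E0 : 0 <= E by apply: le_trans Ea; rewrite addr_ge0 // dotp_ge0.
  apply: (@le_trans _ _ E); last first.
    by apply: le_trans EK _; rewrite ler_peMl.
  apply: le_trans Ea; rewrite ler_norml.
  have := dotp_ge0 (t - a); have := dotp_ge0 (t + a).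
  rewrite !(dotpBl, dotpBr, dotpDl, dotpDr) (dotpC a t).
  by have := dotp_ge0 t; have := dotp_ge0 a; move=> *; apply/andP; split; lra.
pose cand (f : {ffun 'I_n -> 'I_(2 * K).+1}) : set 'rV[R]_N :=
  [set t | L t /\ forall i : 'I_n, dotp t rs`_i = pi2 * ((f i)%:R - K%:R)].
(* A table realised by no lattice point yields the default 0, which is harmless because the list is
   filtered afterwards. The shift by [K] in [cand] encodes integers between [-K] and [K]. *)
pose s0 := [seq xget 0 (cand f) | f : {ffun 'I_n -> 'I_(2 * K).+1}].
pose s := undup [seq t <- s0 | `[< L t >] && (q t <= B)].
exists s; split; first exact: undup_uniq.
move=> t; rewrite mem_undup mem_filter; split=> [/andP[/andP[/asboolP Lt ->]] //|[Lt tB]].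
rewrite tB; have /asboolP -> := Lt; rewrite /=.
have [f fP] : exists f, cand f t.
  have ex (i : 'I_n) : exists k : 'I_(2 * K).+1, dotp t rs`_i = pi2 * (k%:R - K%:R).
    have irs : rs`_i \in rs by rewrite mem_nth.
    have [m mE] := lattice_dotp Lt (weight_root Hrs irs).
    have := KP t _ irs tB; rewrite dotpC mE normrM gtr0_norm; last first.
      by have := pi_gt0 R; lra.
    rewrite ler_pM2l; last by have := pi_gt0 R; lra.
    rewrite ler_norml => mK.
    have /andP[m1 m2] : (- K%:Z <= m <= K%:Z)%R.
      by rewrite -!(ler_int R) rmorphN /=.
    have kl : (absz (m + K%:Z)%R < (2 * K).+1)%N by lia.
    exists (Ordinal kl) => /=; congr (_ * _).
    have -> : (absz (m + K%:Z)%R)%:R = (m + K%:Z)%:~R :> R.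
      by rewrite -[_%:R]/((Posz _)%:~R) gez0_abs //; lia.
    by rewrite intrD addrK.
  have [g gP] := choice ex.
  by exists (finfun g); split=> // i; rewrite ffunE.
have -> : t = xget 0 (cand f).
  have [Lx xP] := xgetPex 0 (ex_intro _ t fP).
  apply: span_inj => a ars; have ia : (index a rs < n)%N by rewrite index_mem.
  have := xP (Ordinal ia); have := fP.2 (Ordinal ia).
  by rewrite /= nth_index // => -> ->.
by apply/mapP; exists f => //; rewrite mem_enum.
Qed.

Definition in_alcove x := all (fun a => pos a ==> (0 < dotp x a < pi2)) rs.

Lemma in_alcoveP x : reflect (forall a, pos a -> 0 < dotp x a < pi2) (in_alcove x).
Proof.
apply: (iffP allP) => [H a pa|H a ars]; last by apply/implyP; exact: H.
by have := H a (pos_root pa); rewrite pa.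
Qed.

Lemma alcoveE x : alcove rs h x <-> in_alcove x.
Proof. by split=> [H|/in_alcoveP//]; apply/in_alcoveP. Qed.

Definition regular x := forall a (m : int), a \in rs -> dotp x a != pi2 * m%:~R.

Lemma in_alcove_bounds x a : in_alcove x -> a \in rs -> `|dotp x a| < pi2.
Proof.
move=> /in_alcoveP xA ars; case: (boolP (pos a)) => [/xA /andP[a0 a1]|].
  by rewrite gtr0_norm.
rewrite -posN // => /xA; rewrite dotpNr => /andP[a0 a1].
by rewrite ltr0_norm // -oppr_gt0.
Qed.

(** No affine mirror separates the two points; unlike membership in the alcove, this relation is
    carried along by lattice translations and by the Weyl group. *)
Definition same_side x y := forall a (m : int), a \in rs ->
  (dotp x a < pi2 * m%:~R) = (dotp y a < pi2 * m%:~R) /\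
  (pi2 * m%:~R < dotp x a) = (pi2 * m%:~R < dotp y a).

Lemma same_side_alcove x y : in_alcove x -> in_alcove y -> same_side x y.
Proof.
have p0 : 0 < pi2 by have := pi_gt0 R; lra.
have key d (m : int) : 0 < d < pi2 -> (d < pi2 * m%:~R) = (0 < m) /\
    (pi2 * m%:~R < d) = (m <= 0).
  move=> /andP[d0 d1]; have [m0|m0] := ltP 0 m.
    have m1 : pi2 <= pi2 * m%:~R.
      by rewrite ler_peMr ?(ltW p0) // -[1]/(1%:~R) ler_int -gtz0_ge1.
    by rewrite (lt_le_trans d1 m1) ltNge (ltW (lt_le_trans d1 m1)).
  have m1 : pi2 * m%:~R <= 0 by rewrite pmulr_rle0 // lerz0.
  by rewrite (le_lt_trans m1 d0) ltNge (ltW (le_lt_trans m1 d0)).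
move=> xA yA a m ars; case: (boolP (pos a)) => [pa|].
  have [e1 e2] := key _ m (in_alcoveP _ xA _ pa).
  by have [e3 e4] := key _ m (in_alcoveP _ yA _ pa); rewrite e1 e2 e3 e4.
rewrite -posN // => pa.
have [e1 e2] := key _ (- m) (in_alcoveP _ xA _ pa).
have [e3 e4] := key _ (- m) (in_alcoveP _ yA _ pa).
rewrite !dotpNr rmorphN mulrN !ltrN2 in e1 e2 e3 e4.
by rewrite e1 e2 e3 e4.
Qed.

Lemma same_side_in x y : same_side x y -> in_alcove x = in_alcove y.
Proof.
move=> xy; apply: eq_in_all => a ars.
have [_ e0] := xy a 0 ars; have [e1 _] := xy a 1 ars.
by rewrite mulr0 mulr1 in e0 e1; rewrite e0 e1.
Qed.

Lemma same_side_shift x y t : L t -> same_side x y -> same_side (x + t) (y + t).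
Proof.
move=> Lt xy a m ars.
have [k kE] := lattice_dotp Lt (weight_root Hrs ars).
have e1 d : (d + pi2 * k%:~R < pi2 * m%:~R) = (d < pi2 * (m - k)%:~R).
  by rewrite intrB mulrBr ltrBrDr.
have e2 d : (pi2 * m%:~R < d + pi2 * k%:~R) = (pi2 * (m - k)%:~R < d).
  by rewrite intrB mulrBr ltrBlDr.
by rewrite !dotpDl (dotpC t) kE !e1 !e2; exact: xy.
Qed.

Lemma same_side_mul x y w : W w -> same_side x y -> same_side (x *m w) (y *m w).
Proof.
move=> Ww xy a m ars; rewrite !dotp_mulmxl; apply: xy.
by apply: (inW_root Hrs) => //; exact: inW_tr.
Qed.

(* A point of the affine Weyl orbit of [x] closest to a point [y] of the alcove
   lies on the same side of every mirror as [y]. *)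
Lemma regular_to_alcove x y : regular x -> in_alcove y ->
  exists t w, [/\ L t, W w & in_alcove ((x + t) *m w)].
Proof.
move=> xr yA; pose m0 := q (x - y).
(* Two applications of [dotp_le_2] show that a translation bringing [x] within squared distance [m0]
   of [y] has squared length at most this bound. The trivial choice already achieves [m0], so a
   minimum over the finite list is global. *)
have [s [_ sP]] := lattice_finite (2 * (2 * m0 + 2 * q y) + 2 * q x).
pose f (z : 'rV[R]_N * 'M[R]_N) := q ((x + z.1) *m z.2 - y).
have qle0 : 0 <= 2 * (2 * m0 + 2 * q y) + 2 * q x.
  by have := dotp_ge0 (x - y); have := dotp_ge0 x; have := dotp_ge0 y; rewrite /m0; lra.
have z0 : (0, 1%:M) \in allpairs pair s Ws.
  apply: allpairs_f; first by apply/sP; rewrite dotp0l; split=> //; exact: lattice0.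
  by apply/HW; exact: inW1.
have [[t w] /allpairsP[[t' w'] [/= ts ws [et ew]]] tw] := seq_argmin f z0.
subst t' w'; have [Lt _] := (sP t).1 ts; have Ww := (HW w).1 ws.
have qW v w1 : W w1 -> q (v *m w1) = q v by move=> Ww1; rewrite (inW_dotp Hrs).
have glob t1 w1 : L t1 -> W w1 -> f (t, w) <= f (t1, w1).
  move=> Lt1 Ww1; have [|] := leP (f (t1, w1)) m0; last first.
    move=> /ltW; apply: le_trans; apply: le_trans (tw _ z0) _.
    by rewrite /f /= addr0 mulmx1.
  move=> fm; apply: tw; apply: allpairs_f; last by apply/HW.
  apply/sP; split=> //.
  have h1 := dotp_le_2 ((x + t1) *m w1 - y) y; rewrite subrK qW // in h1.
  have h2 := dotp_le_2 (x + t1) (- x).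
  rewrite dotpNl dotpNr opprK [x + t1]addrC addrK [t1 + x]addrC in h2.
  by rewrite /f /= in fm; lra.
exists t, w; split=> //; apply/in_alcoveP => a pa; have ars := pos_root pa.
set z := (x + t) *m w.
have zr k : dotp z a != pi2 * k%:~R.
  rewrite /z dotp_mulmxl dotpDl.
  have ars' : a *m w^T \in rs by apply: (inW_root Hrs) => //; exact: inW_tr.
  have [j jE] := lattice_dotp Lt (weight_root Hrs ars').
  have e1 d : (d + pi2 * j%:~R == pi2 * k%:~R) = (d == pi2 * (k - j)%:~R).
    by rewrite intrB mulrBr -subr_eq opprK.
  by rewrite (dotpC t) jE e1; exact: xr.
have aa : 0 < q a by rewrite dotp_gt0 (root_neq0 Hrs ars).
(* Reflecting [z] in the mirror of [a] at level [2 pi k] changes the squared distance to [y] by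
   [4 / q a] times this product, so minimality makes it nonnegative. The levels 0 and 1 bound the
   alcove. *)
have side (k : nat) : 0 < (dotp z a - pi2 * k%:R) * (dotp y a - pi2 * k%:R).
  pose d := dotp z a - pi2 * k%:R.
  have dn0 : d != 0 by rewrite subr_eq0; exact: (zr k).
  have yn0 : dotp y a - pi2 * k%:R != 0.
    rewrite subr_eq0; have /in_alcoveP/(_ a pa)/andP[y0 y1] := yA.
    have p0 : 0 < pi2 by exact: lt_trans y1.
    case: k {d dn0} => [|k]; first by rewrite mulr0 gt_eqF.
    rewrite lt_eqF //; apply: lt_le_trans y1 _.
    by rewrite ler_peMr ?(ltW p0) // ler1n.
  rewrite lt_def mulf_neq0 //=.
  pose t1 := t + (pi2 * k%:R) *: coroot (a *m (w *m refl a)^T).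
  have Ww1 : W (w *m refl a) by apply: inWS.
  have ars1 : a *m (w *m refl a)^T \in rs.
    by apply: (inW_root Hrs) => //; exact: inW_tr.
  have Lt1 : L t1.
    apply: latticeD => //; rewrite mulrC -scalerA.
    elim: k {d dn0 yn0 t1} => [|k IH]; first by rewrite scale0r; exact: lattice0.
    rewrite mulrS scalerDl scale1r; apply: latticeD => //; exact: lattice_coroot.
  have := glob t1 _ Lt1 Ww1; rewrite /f /= -/z.
  have -> : (x + t1) *m (w *m refl a) = z - d *: coroot a.
    rewrite /t1 addrA mulmxDl mulmxA -/z reflE -scalemxAl.
    have -> : coroot (a *m (w *m refl a)^T) *m (w *m refl a) = coroot a.
      by rewrite coroot_mul // -mulmxA (inW_Tmul Hrs Ww1) mulmx1.
    rewrite /d scalerBl opprB addrA addrAC; congr (_ + _); congr (_ - _).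
    by rewrite /coroot scalerA; congr (_ *: _); rewrite /pairing; ring.
  have -> : z - d *: coroot a - y = (z - y) - d *: coroot a by rewrite addrAC.
  have cc : q (coroot a) = 4 / q a.
    by rewrite dotp_coroot /coroot pairingZl pairing_self ?(root_neq0 Hrs ars) //; field; rewrite gt_eqF.
  have zc : dotp (z - y) (coroot a) = 2 * (dotp z a - dotp y a) / q a.
    by rewrite dotp_coroot /pairing dotpBl.
  have -> : q (z - y - d *: coroot a)
     = q (z - y) - 2 * d * dotp (z - y) (coroot a) + d ^+ 2 * q (coroot a).
    move: (coroot a) => c.
    by rewrite [LHS]dotpBl !(dotpBr _ (z - y)) !dotpZl !dotpZr (dotpC c); ring.
  rewrite zc cc -/d -addrA lerDl => H; have : 0 <= d * (4 / q a) * (dotp y a - pi2 * k%:R).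
    by apply: le_trans H _; rewrite le_eqVlt; apply/orP; left; apply/eqP; rewrite /d; ring.
  rewrite mulrAC pmulr_lge0 //; exact: divr_gt0.
have /in_alcoveP/(_ a pa)/andP[y0 y1] := yA.
have := side 0%N; rewrite mulr0 !subr0 pmulr_lgt0 // => ->.
have := side 1%N; rewrite mulr1 nmulr_lgt0 ?subr_lt0 //.
Qed.

End Alcove.

(** * Covering multiplicity of the images of the alcove *)

Section Covering.
Context (R : realType) (N : nat) (rs : seq 'rV[R]_N) (h : 'rV[R]_N).
Context (Ws : seq 'M[R]_N).
Context (Hrs : is_root_system rs) (Hh : {in rs, forall a, dotp h a != 0}).
Context (HWu : uniq Ws) (HW : forall w, w \in Ws <-> inW rs w).
Implicit Types (a b u v x y t : 'rV[R]_N) (w : 'M[R]_N).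
Notation W := (inW rs).
Notation L := (coroot_lattice rs).
Notation q x := (dotp x x).
Notation inA := (in_alcove rs h).

Lemma big_Ws_perm (T : Type) (idx : T) (op : Monoid.com_law idx) (F : 'M[R]_N -> T)
    (f : 'M[R]_N -> 'M[R]_N) : (forall w, W w -> W (f w)) -> {in Ws &, injective f} ->
  \big[op/idx]_(w <- Ws) F (f w) = \big[op/idx]_(w <- Ws) F w.
Proof.
move=> fW finj; rewrite -(big_map f xpredT) /=; apply: perm_big; apply: uniq_perm => //.
  by rewrite map_inj_in_uniq.
by apply: (uniq_min_size _ _ _).2; rewrite ?map_inj_in_uniq ?size_map //;
  move=> _ /mapP[w /HW ws ->]; apply/HW/fW.
Qed.

Lemma big_Ws_mull (T : Type) (idx : T) (op : Monoid.com_law idx) F w0 : W w0 ->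
  \big[op/idx]_(w <- Ws) F (w0 *m w) = \big[op/idx]_(w <- Ws) F w.
Proof.
move=> W0; apply: (@big_Ws_perm T idx op F (mulmx w0)) => [w|w1 w2 _ _]; first exact: inW_mul.
by move/(congr1 (mulmx w0^T)); rewrite !mulmxA (inW_Tmul Hrs W0) !mul1mx.
Qed.

Lemma big_Ws_mulr (T : Type) (idx : T) (op : Monoid.com_law idx) F w0 : W w0 ->
  \big[op/idx]_(w <- Ws) F (w *m w0) = \big[op/idx]_(w <- Ws) F w.
Proof.
move=> W0; apply: (@big_Ws_perm T idx op F (mulmx^~ w0)) => [w Ww|w1 w2 _ _].
  exact: inW_mul.
by move/(congr1 (mulmx^~ w0^T)); rewrite -!mulmxA (inW_mulT Hrs W0) !mulmx1.
Qed.

Lemma big_Ws_tr (T : Type) (idx : T) (op : Monoid.com_law idx) F :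
  \big[op/idx]_(w <- Ws) F w^T = \big[op/idx]_(w <- Ws) F w.
Proof.
apply: (@big_Ws_perm T idx op F (fun w => w^T)) => [w|w1 w2 _ _]; first exact: inW_tr.
exact: trmx_inj.
Qed.

Definition weyl_count v : R := \sum_(w <- Ws) (inA (v *m w))%:R.

Lemma weyl_count_ge0 v : 0 <= weyl_count v.
Proof. by apply: sumr_ge0 => *; rewrite ler0n. Qed.

Definition cover_count (s : seq 'rV[R]_N) v := \sum_(t <- s) weyl_count (v + t).

Lemma sum_natr_bool (I : eqType) (s : seq I) (b : pred I) :
  \sum_(i <- s) (b i)%:R = (count b s)%:R :> R.
Proof. by rewrite -sumn_count sumnE big_map natr_sum. Qed.

(* The alcoves of the affine Weyl group are permuted simply transitively up to
   the finite stabiliser of one of them, whence a constant covering multiplicity. *)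
Lemma cover_count_const (r B : R) s v y : uniq s ->
  (forall t, t \in s <-> L t /\ q t <= B) ->
  (forall x, inA x -> q x <= r) -> inA y -> regular rs v ->
  2 * r + 2 * q v <= B -> 4 * r <= B -> cover_count s v = cover_count s y.
Proof.
move=> us sP Ar yA vr vB rB.
have [t0 [w0 [Lt0 W0 x0A]]] := regular_to_alcove Hrs HW vr yA.
have qW z w : W w -> q (z *m w) = q z by move=> Ww; rewrite (inW_dotp Hrs).
rewrite /cover_count /weyl_count exchange_big /= [RHS]exchange_big /=.
rewrite -(big_Ws_mull _ _ W0); apply: eq_big_seq => w /HW Ww.
(* The affine map taking [v] into the alcove matches the translates of [v] counted with [w0 *m w] to
   those of [y] counted with [w]. *)
pose phi t := (t - t0) *m w0.
have key t : L t -> inA ((v + t) *m (w0 *m w)) = inA ((y + phi t) *m w).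
  move=> Lt; have -> : (v + t) *m (w0 *m w) = ((v + t0) *m w0 + phi t) *m w.
    by rewrite /phi -mulmxDl [t - t0]addrC addrA addrK mulmxA.
  apply: same_side_in; apply: (same_side_mul Hrs Ww).
  apply: (same_side_shift Hrs); last exact: (same_side_alcove Hrs Hh).
  by apply: (lattice_mul Hrs) => //; apply: latticeD => //; exact: latticeN.
rewrite !sum_natr_bool; congr _%:R; rewrite -!size_filter -(size_map phi); apply: perm_size.
apply: uniq_perm; rewrite ?filter_uniq //.
  rewrite map_inj_uniq ?filter_uniq // => t1 t2 /(inW_inj Hrs W0).
  exact: addIr.
(* The bijection preserves the lattice but not the ball; the two size conditions on [B] guarantee
   that every translate counted on either side lies in [s]. *)
move=> t; rewrite mem_filter; apply/mapP/andP.
  move=> [t1]; rewrite mem_filter => /andP[] + /sP[Lt1 t1B] ->; rewrite key // => b1.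
  have L1 : L (phi t1).
    by apply: (lattice_mul Hrs) => //; apply: latticeD => //; exact: latticeN.
  split=> //; apply/sP; split=> //.
  have h1 := dotp_le_2 (y + phi t1) (- y); rewrite addrC addKr dotpNl dotpNr opprK in h1.
  have h2 := Ar _ b1; rewrite qW // in h2; have h3 := Ar _ yA; lra.
move=> [b1 /sP[Lt tB]]; exists (t *m w0^T + t0).
  have L1 : L (t *m w0^T + t0).
    by apply: latticeD => //; apply: (lattice_mul Hrs) => //; exact: inW_tr.
  have b2 : inA ((v + (t *m w0^T + t0)) *m (w0 *m w)).
    by rewrite key // /phi addrK -(mulmxA t) (inW_Tmul Hrs W0) mulmx1.
  rewrite mem_filter b2; apply/sP; split=> //.
  have h1 := dotp_le_2 (v + (t *m w0^T + t0)) (- v).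
  rewrite [v + _]addrC addrK dotpNl dotpNr opprK [_ + v]addrC in h1.
  have h2 := Ar _ b2; rewrite qW // in h2; last exact: inW_mul.
  lra.
by rewrite /phi addrK -mulmxA (inW_Tmul Hrs W0) mulmx1.
Qed.

Lemma cover_count_ge1 s y : uniq s -> 0 \in s -> inA y -> 1 <= cover_count s y.
Proof.
move=> us s0 yA; rewrite /cover_count (big_rem 0) //= addr0.
rewrite -[leLHS]addr0 lerD //; last by apply: sumr_ge0 => *; exact: weyl_count_ge0.
have W1 : 1%:M \in Ws by apply/HW; exact: inW1.
rewrite /weyl_count (big_rem _ W1) /= mulmx1 yA lerDl; apply: sumr_ge0 => *.
by rewrite ler0n.
Qed.

End Covering.

(** * Integration of periodic functions against the alcove count *)

Section AlcoveIntegral.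
Context (R : realType) (n : nat) (rs : seq 'rV[R]_n.+1) (h : 'rV[R]_n.+1).
Context (Ws : seq 'M[R]_n.+1).
Context (Hrs : is_root_system rs) (Hh : {in rs, forall a, dotp h a != 0}).
Context (HWu : uniq Ws) (HW : forall w, w \in Ws <-> inW rs w).
Local Open Scope ereal_scope.
Implicit Types (a b u v x y t : 'rV[R]_n.+1) (w : 'M[R]_n.+1).
Notation Om := (sfm_T (lebRn R n)).
Notation mu := (sfm_mu (lebRn R n)).
Notation vec := (@lebRn_vec R n).
Notation W := (inW rs).
Notation L := (coroot_lattice rs).
Notation q x := (dotp x x).
Notation inA := (in_alcove rs h).
Notation T := (weyl_count rs h Ws).
Notation IR := (@IR R n).
Notation measF := (@measF R n).

Definition measR (f : 'rV[R]_n.+1 -> R) := measurable_fun setT (fun x : Om => f (vec x)).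

Lemma measR_EFin f : measR f -> measF (fun v => (f v)%:E).
Proof. by move=> mf; apply/measurable_EFinP. Qed.

Lemma measR_shift f t : measR f -> measR (fun v => f (v + t)%R).
Proof.
move=> /measR_EFin/measF_shift => /(_ t) mf; exact/measurable_EFinP.
Qed.

Lemma measR_mulmx f w : measR f -> measR (fun v => f (v *m w)%R).
Proof.
move=> /measR_EFin/measF_mulmx => /(_ w) mf; exact/measurable_EFinP.
Qed.

Lemma measurable_in_alcove : measurable_fun setT (fun x : Om => inA (vec x)).
Proof.
rewrite /in_alcove; elim: {2}rs => [|a s IH] /=; first exact: measurable_cst.
apply: measurable_and => //; case: (pos rs h a) => /=; last exact: measurable_cst.
by apply: measurable_and; apply: measurable_fun_ltr => //; exact: measurable_dotp.
Qed.

Lemma measR_bool (b : 'rV[R]_n.+1 -> bool) :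
  measurable_fun setT (fun x : Om => b (vec x)) -> measR (fun v => (b v)%:R)%R.
Proof. by move=> /measurable_bool_EFin mb; exact/measurable_EFinP. Qed.

Lemma measR_in_alcove : measR (fun v => (inA v)%:R)%R.
Proof. exact: measR_bool measurable_in_alcove. Qed.

Lemma measR_sum I (s : seq I) (F : I -> 'rV[R]_n.+1 -> R) :
  (forall i, measR (F i)) -> measR (fun v => \sum_(i <- s) F i v)%R.
Proof. by move=> mF; apply: measurable_sum. Qed.

Lemma measR_mul f g : measR f -> measR g -> measR (fun v => f v * g v)%R.
Proof. by move=> mf mg; apply: measurable_funM. Qed.

Lemma measR_weyl_count : measR T.
Proof. by apply: measR_sum => w; apply: measR_mulmx measR_in_alcove. Qed.

Lemma negligible_hyperplane a (c : R) : a != 0%R ->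
  mu.-negligible [set x : Om | dotp (vec x) a = c].
Proof.
move=> a0; pose H := [set x : Om | dotp (vec x) a == c].
have mb : measurable_fun setT (fun x : Om => dotp (vec x) a == c).
  by apply: measurable_fun_eqr => //; exact: measurable_dotp.
have mH : measurable H.
  have : measurable (setT `&` (fun x : Om => dotp (vec x) a == c) @^-1` [set true]).
    exact: mb.
  by rewrite setTI.
exists H; split=> //; last by move=> x /= /eqP.
rewrite -(setIT H) -integral_indic // -[RHS](IR_hyperplane c a0).
apply: eq_integral => x _; rewrite indicE; congr (_%:R%:E); congr nat_of_bool.
by apply/idP/idP; rewrite ?inE.
Qed.

(** There are countably many affine mirrors, enumerated here by [pickle] of the position of a root
    and an integer level. *)
Lemma negligible_irregular t : mu.-negligible [set x : Om | ~ regular rs (vec x + t)%R].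
Proof.
pose F (k : nat) : set Om := if @unpickle (nat * int)%type k is Some (i, m)
  then [set x | (i < size rs)%N /\ dotp (vec x) rs`_i = (2 * pi * m%:~R - dotp t rs`_i)%R]
  else set0.
apply: (@negligibleS _ _ _ _ (\bigcup_k F k)); last first.
  apply: negligible_bigcup => k; rewrite /F; case: unpickle => [[i m]|]; last first.
    exact: negligible_set0.
  have [ir|ir] := boolP (i < size rs)%N; last by apply: negligibleS _ (negligible_set0 _) => x [].
  have H := negligible_hyperplane (2 * pi * m%:~R - dotp t rs`_i)%R (root_neq0 Hrs (mem_nth 0%R ir)).
  by apply: (negligibleS _ H) => x [].
move=> x /= /existsNP[a /existsNP[m /not_implyP[ars /negP/negPn/eqP am]]].
exists (pickle (index a rs, m)) => //; rewrite /F pickleK /= index_mem ars nth_index //.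
by split=> //; rewrite -am dotpDl addrK.
Qed.

Lemma IR_ae (F G : 'rV[R]_n.+1 -> \bar R) t : measF F -> measF G ->
  (forall v, 0 <= F v) -> (forall v, 0 <= G v) ->
  (forall v, regular rs (v + t)%R -> F v = G v) -> IR F = IR G.
Proof.
move=> mF mG F0 G0 FG; apply: ge0_ae_eq_integral => //.
apply: negligibleS _ (negligible_irregular t) => x /= H; apply: contra_not H => xr _.
exact: FG.
Qed.

Lemma IR_sum I (s : seq I) (F : I -> 'rV[R]_n.+1 -> \bar R) :
  (forall i, measF (F i)) -> (forall i v, 0 <= F i v) ->
  IR (fun v => \sum_(i <- s) F i v) = \sum_(i <- s) IR (F i).
Proof. by move=> mF F0; apply: ge0_integral_sum => // i x _; apply: F0. Qed.

Context (r : R) (Ar : forall x, inA x -> (q x <= r)%R).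
Context (y : 'rV[R]_n.+1) (yA : inA y).

Lemma weyl_count_bound v : T v != 0%R -> (q v <= r)%R.
Proof.
apply: contraR => vr; apply/eqP; rewrite /weyl_count big_seq big1 // => w /HW Ww.
case: (boolP (inA _)) => // /Ar; rewrite (inW_dotp Hrs) // => vr'.
by rewrite vr' in vr.
Qed.

(** Multiply both integrals by the covering number [c0] and write it as a sum of [weyl_count] over
    lattice translates: on the left at [v - t], on the right at [v + t] with the sign of the
    translates reversed. The terms [F1 u] and [F2 u] then differ by the translation [t - u], since
    [f] has period [u]. *)
Lemma IR_periodic (f : 'rV[R]_n.+1 -> R) t : measR f -> (forall v, 0 <= f v)%R ->
  (forall v s, L s -> f (v + s)%R = f v) ->
  IR (fun v => (T v * f v)%:E) = IR (fun v => (T v * f (v + t))%:E).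
Proof.
move=> mf f0 fL.
(* Where [weyl_count] is nonzero, [v + t] and [v - t] have squared length at most [2 * (r + q t)];
   this radius meets both size conditions of [cover_count_const] there. *)
have [s [us sP]] := lattice_finite Hrs (4 * r + 4 * (r + q t))%R.
have r0 : (0 <= r)%R by apply: le_trans (Ar yA); exact: dotp_ge0.
have qt0 := dotp_ge0 t.
pose c0 := cover_count rs h Ws s y.
have s0 : 0%R \in s.
  by apply/sP; rewrite dotp0l; split; [exact: lattice0 | lra].
have c01 : (1 <= c0)%R by apply: cover_count_ge1.
have c00 : (0 < c0)%R by apply: lt_le_trans c01.
have cc v : regular rs v -> (q v <= 2 * (r + q t))%R -> cover_count rs h Ws s v = c0.
  move=> vr vB; apply: (cover_count_const Hrs Hh HWu HW us sP Ar yA vr); lra.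
have Tpos := @weyl_count_ge0 R n.+1 rs h Ws.
have mT := measR_weyl_count.
have mTs u : measR (fun v => T (v + u)%R) by apply: measR_shift.
have mfs u : measR (fun v => f (v + u)%R) by apply: measR_shift.
pose F1 u v := (T v * f v * T (v + (u - t)))%R.
pose F2 u v := (T v * f (v + t) * T (v + (t - u)))%R.
have mF1 u : measR (F1 u) by apply: measR_mul => //; apply: measR_mul.
have mF2 u : measR (F2 u) by apply: measR_mul => //; apply: measR_mul.
have F1pos u v : (0 <= F1 u v)%R by rewrite !mulr_ge0.
have F2pos u v : (0 <= F2 u v)%R by rewrite !mulr_ge0.
have mTf : measR (fun v => T v * f v)%R by exact: measR_mul.
have mTft : measR (fun v => T v * f (v + t))%R by exact: measR_mul.
have e1 : c0%:E * IR (fun v => (T v * f v)%:E) = IR (fun v => \sum_(u <- s) (F1 u v)%:E).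
  rewrite -IR_Zl; first last.
  - by rewrite lee_fin ltW.
  - by move=> v; rewrite lee_fin mulr_ge0.
  - exact: (measR_EFin mTf).
  apply: (@IR_ae _ _ (- t)%R).
  - by apply: emeasurable_funM => //; exact: (measR_EFin mTf).
  - by apply: emeasurable_sum => u; exact: (measR_EFin (mF1 u)).
  - by move=> v; rewrite -EFinM lee_fin mulr_ge0 ?(ltW c00) // mulr_ge0.
  - by move=> v; apply: sume_ge0 => u _; rewrite lee_fin.
  move=> v vr; rewrite sumEFin -EFinM /F1 -mulr_sumr; congr _%:E.
  have [->|T0] := eqVneq (T v) 0%R; first by rewrite !mul0r mulr0.
  rewrite mulrC; congr (_ * _)%R; rewrite -(cc _ vr).
    by apply: eq_bigr => u _; rewrite addrA addrAC.
  have := weyl_count_bound T0; have := dotp_le_2 v (- t).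
  by rewrite dotpNl dotpNr opprK; lra.
have e2 : c0%:E * IR (fun v => (T v * f (v + t))%:E) = IR (fun v => \sum_(u <- s) (F2 u v)%:E).
  rewrite -IR_Zl; first last.
  - by rewrite lee_fin ltW.
  - by move=> v; rewrite lee_fin mulr_ge0.
  - exact: (measR_EFin mTft).
  apply: (@IR_ae _ _ t).
  - by apply: emeasurable_funM => //; exact: (measR_EFin mTft).
  - by apply: emeasurable_sum => u; exact: (measR_EFin (mF2 u)).
  - by move=> v; rewrite -EFinM lee_fin mulr_ge0 ?(ltW c00) // mulr_ge0.
  - by move=> v; apply: sume_ge0 => u _; rewrite lee_fin.
  move=> v vr; rewrite sumEFin -EFinM /F2 -mulr_sumr; congr _%:E.
  have [->|T0] := eqVneq (T v) 0%R; first by rewrite !mul0r mulr0.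
  rewrite mulrC; congr (_ * _)%R; rewrite -(cc _ vr); last first.
    by have := weyl_count_bound T0; have := dotp_le_2 v t; lra.
  have sN : perm_eq [seq (- u)%R | u <- s] s.
    apply: uniq_perm => //; first by rewrite map_inj_uniq //; exact: oppr_inj.
    move=> u; apply/mapP/idP => [[u' /sP[Lu uB] ->]|/sP[Lu uB]].
      by apply/sP; rewrite dotpNl dotpNr opprK; split=> //; exact: latticeN.
    exists (- u)%R; rewrite ?opprK //; apply/sP.
    by rewrite dotpNl dotpNr opprK; split=> //; exact: latticeN.
  rewrite /cover_count -(perm_big _ sN) big_map.
  by apply: eq_bigr => u _; rewrite addrA.
have e12 : IR (fun v => \sum_(u <- s) (F1 u v)%:E) = IR (fun v => \sum_(u <- s) (F2 u v)%:E).
  rewrite !IR_sum.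
  - apply: eq_big_seq => u /sP[Lu _].
    rewrite -(@IR_shift _ _ _ (t - u)%R (measR_EFin (mF1 u))); last first.
      by move=> v; rewrite lee_fin.
    apply: eq_integral => x _; congr _%:E; rewrite /F1 /F2.
    have fE : f (vec x + (t - u))%R = f (vec x + t)%R.
      by rewrite addrA (fL _ (- u)%R) //; exact: (latticeN Hrs Lu).
    by rewrite -(opprB t u) addrK fE mulrAC [RHS]mulrAC; congr (_ * _)%R; rewrite mulrC.
  - by move=> u; apply/measR_EFin.
  - by move=> u v; rewrite lee_fin.
  - by move=> u; apply/measR_EFin.
  - by move=> u v; rewrite lee_fin.
have E : c0%:E * IR (fun v => (T v * f v)%:E) = c0%:E * IR (fun v => (T v * f (v + t))%:E).
  by rewrite e1 e2.
have c0f : c0%:E \is a fin_num by [].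
have c0p : 0 < c0%:E by rewrite lte_fin.
by apply/eqP; rewrite eq_le -(lee_pmul2l c0f c0p) E lexx -(lee_pmul2l c0f c0p) E lexx.
Qed.

Context (IA0 : 0 < IR (fun v => ((inA v)%:R)%:E)).

Lemma IR_Weyl F w : W w -> measF F -> (forall v, 0 <= F v) ->
  IR (fun v => F (v *m w)%R) = IR F.
Proof.
(* The test function for [IR_orth] is the indicator of a ball around the alcove: its integral is
   positive because the alcove has positive measure, and finite because the ball lies in a cube. *)
move=> Ww mF F0; pose b v := (q v <= r)%R.
have r0 : (0 <= r)%R by apply: le_trans (Ar yA); exact: dotp_ge0.
have mb : measurable_fun setT (fun x : Om => b (vec x)).
  apply: measurable_fun_ler => //.
  apply: measurable_sum => k; apply: measurable_funM; exact: measurable_vec.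
have mG : measF (fun v => ((b v)%:R)%:E) by exact: measurable_bool_EFin.
apply: (IR_orth (G := fun v => ((b v)%:R)%:E) (inW_Tmul Hrs Ww)) => //.
- by move=> v; rewrite /b dotpNl dotpNr opprK (inW_dotp Hrs).
- apply: lt_le_trans IA0 _; apply: ge0_le_integral => //.
  + exact: measR_EFin measR_in_alcove.
  + move=> x _; rewrite lee_fin ler_nat; case: (boolP (inA _)) => // /Ar.
    by rewrite /b => ->.
- apply: le_lt_trans (@IR_cube R n (1 + r)%R _); last by lra.
  apply: ge0_le_integral => //.
  + exact: measF_cube.
  + move=> x _; rewrite lee_fin ler_nat; case: (boolP (b _)) => // bx.
    suff -> : [forall i, (- (1 + r) <= vec x ord0 i <= 1 + r)%R] by [].
    apply/forallP => i; rewrite -ler_norml.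
    have : (vec x ord0 i ^+ 2 <= r)%R.
      apply: le_trans bx; rewrite /dotp (bigD1 i) //= -expr2 lerDl.
      by apply: sumr_ge0 => k _; rewrite -expr2 sqr_ge0.
    rewrite -real_normK ?num_real //; have := normr_ge0 (vec x ord0 i); nra.
Qed.

Lemma IR_alcove_Weyl (g : 'rV[R]_n.+1 -> R) : measR g -> (forall v, 0 <= g v)%R ->
  \sum_(w <- Ws) IR (fun v => ((inA v)%:R * g (v *m w))%:E) = IR (fun v => (T v * g v)%:E).
Proof.
move=> mg g0.
have E : (fun v => (T v * g v)%:E) = fun v => \sum_(w <- Ws) ((inA (v *m w))%:R * g v)%:E.
  by apply/funext => v; rewrite sumEFin -mulr_suml.
rewrite E IR_sum; last 2 first.
- by move=> w; apply/measR_EFin/measR_mul => //; apply: measR_mulmx measR_in_alcove.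
- by move=> w v; rewrite lee_fin mulr_ge0 ?ler0n.
rewrite -[RHS](big_Ws_tr HWu HW); rewrite big_seq [RHS]big_seq.
apply: eq_bigr => w /HW Ww.
rewrite -(IR_Weyl Ww (F := fun v => ((inA (v *m w^T))%:R * g v)%:E)).
- by apply: eq_integral => x _; rewrite -mulmxA (inW_mulT Hrs Ww) mulmx1.
- by apply/measR_EFin/measR_mul => //; apply: measR_mulmx measR_in_alcove.
- by move=> v; rewrite lee_fin mulr_ge0 ?ler0n.
Qed.

End AlcoveIntegral.

(** * Real integrals over the alcove *)

Section RealMean.
Context (R : realType) (n : nat) (rs : seq 'rV[R]_n.+1) (h : 'rV[R]_n.+1).
Context (Ws : seq 'M[R]_n.+1).
Context (Hrs : is_root_system rs) (Hh : {in rs, forall a, dotp h a != 0}).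
Context (HWu : uniq Ws) (HW : forall w, w \in Ws <-> inW rs w).
Implicit Types (a u v x y t : 'rV[R]_n.+1) (w : 'M[R]_n.+1).
Notation Om := (sfm_T (lebRn R n)).
Notation mu := (sfm_mu (lebRn R n)).
Notation vec := (@lebRn_vec R n).
Notation L := (coroot_lattice rs).
Notation inA := (in_alcove rs h).
Notation IR := (@IR R n).
Notation A := (vec @^-1` alcove rs h).

Definition bmeas (f : 'rV[R]_n.+1 -> R) := measR f /\ exists M, forall v, `|f v| <= M.
Definition RI (f : 'rV[R]_n.+1 -> R) := RintN (alcove rs h) f.

Lemma in_alcove_bounded : exists r, forall x, inA x -> dotp x x <= r.
Proof.
have [_ _ span _ _] := Hrs.
have ex (i : 'I_n.+1) : exists b, forall x, inA x -> `|x ord0 i| <= b.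
  have [c cE] := span (delta_mx ord0 i).
  exists (\sum_(k < size rs) `|c k| * (2 * pi)) => x xA.
  have -> : x ord0 i = dotp x (delta_mx ord0 i).
    rewrite /dotp (bigD1 i) //= mxE !eqxx mulr1 big1 ?addr0 // => k ki.
    by rewrite mxE (negPf ki) andbF mulr0.
  rewrite cE dotp_sumr; apply: le_trans (ler_norm_sum _ _ _) _.
  apply: ler_sum => k _; rewrite dotpZr normrM ler_wpM2l // ltW //.
  by apply: (in_alcove_bounds Hrs Hh xA); rewrite mem_nth.
have [b bP] := choice ex.
exists (\sum_i b i ^+ 2) => x xA; apply: ler_sum => i _.
have := bP i _ xA; have := normr_ge0 (x ord0 i); rewrite -expr2 -real_normK ?num_real //.
by move=> *; rewrite lerXn2r // nnegrE (le_trans (normr_ge0 (x ord0 i))).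
Qed.

Lemma alcove_set : A = [set x : Om | inA (vec x)].
Proof. by apply/seteqP; split => x /= /alcoveE. Qed.

Lemma measurable_alcove : measurable A.
Proof.
rewrite alcove_set.
have : measurable (setT `&` (fun x : Om => inA (vec x)) @^-1` [set true]).
  exact: (measurable_in_alcove rs h).
by rewrite setTI.
Qed.

Lemma alcove_measureE : IR (fun v => ((inA v)%:R)%:E) = mu A.
Proof.
rewrite -(setIT A) -integral_indic //; last exact: measurable_alcove.
apply: eq_integral => x _; rewrite indicE alcove_set; congr (_%:R%:E); congr nat_of_bool.
by apply/idP/idP; rewrite ?inE.
Qed.

Context (vol0 : volA rs h != 0).

Lemma volAE : volA rs h = fine (mu A).
Proof. by rewrite /volA /RintN Rintegral_cst ?mul1r //; exact: measurable_alcove. Qed.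

(** [fine] sends an infinite value to 0, so a nonzero [volA] already excludes infinite measure. *)
Lemma alcove_measure_lty : (mu A < +oo)%E.
Proof.
have : fine (mu A) != 0 by rewrite -volAE.
by case: (mu A) => [r|/=|//]; rewrite ?ltry // eqxx.
Qed.

Lemma alcove_measure_gt0 : (0 < mu A)%E.
Proof.
rewrite lt_def measure_ge0 andbT; apply: contra vol0 => /eqP e.
by rewrite volAE e.
Qed.

Lemma volA_gt0 : 0 < volA rs h.
Proof.
by rewrite lt_def vol0 volAE fine_ge0 //; exact: measure_ge0.
Qed.

Lemma in_alcove_ex : exists y, inA y.
Proof.
apply: contrapT => /forallNP H; have := alcove_measure_gt0.
by rewrite (_ : A = set0) ?measure0 ?ltxx // alcove_set; apply/seteqP; split => // x /H.
Qed.

Lemma bmeas_cst c : bmeas (fun=> c).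
Proof. by split; [exact: measurable_cst | exists `|c|]. Qed.

Lemma bmeasD f g : bmeas f -> bmeas g -> bmeas (fun v => f v + g v).
Proof.
move=> [mf [M1 H1]] [mg [M2 H2]]; split; first exact: measurable_funD.
by exists (M1 + M2) => v; apply: le_trans (ler_normD _ _) (lerD (H1 v) (H2 v)).
Qed.

Lemma bmeasM f g : bmeas f -> bmeas g -> bmeas (fun v => f v * g v).
Proof.
move=> [mf [M1 H1]] [mg [M2 H2]]; split; first exact: measurable_funM.
by exists (M1 * M2) => v; rewrite normrM ler_pM.
Qed.

Lemma bmeasN f : bmeas f -> bmeas (fun v => - f v).
Proof.
by move=> /(bmeasM (bmeas_cst (-1))); under eq_fun do rewrite mulN1r.
Qed.

Lemma bmeasB f g : bmeas f -> bmeas g -> bmeas (fun v => f v - g v).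
Proof. by move=> bf bg; apply: bmeasD => //; exact: bmeasN. Qed.

Lemma bmeas_mulmx f w : bmeas f -> bmeas (fun v => f (v *m w)).
Proof. by move=> [mf [M H]]; split; [exact: measR_mulmx | exists M]. Qed.

Lemma bmeas_shift f t : bmeas f -> bmeas (fun v => f (v + t)).
Proof. by move=> [mf [M H]]; split; [exact: measR_shift | exists M]. Qed.

Lemma bmeas_cos y : bmeas (fun v => cos (dotp y v)).
Proof.
split; last by exists 1 => v; rewrite ler_norml cos_geN1 cos_le1.
apply: (@measurableT_comp _ _ _ _ _ _ (@cos R)).
  by apply: continuous_measurable_fun; exact: continuous_cos.
by under eq_fun do rewrite dotpC; exact: measurable_dotp.
Qed.

Lemma bmeas_sin y : bmeas (fun v => sin (dotp y v)).
Proof.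
split; last by exists 1 => v; rewrite ler_norml sin_geN1 sin_le1.
apply: (@measurableT_comp _ _ _ _ _ _ (@sin R)).
  by apply: continuous_measurable_fun; exact: continuous_sin.
by under eq_fun do rewrite dotpC; exact: measurable_dotp.
Qed.

Lemma bmeas_integrable f : bmeas f -> mu.-integrable A (EFin \o (f \o vec)).
Proof.
move=> [mf [M H]]; apply: measurable_bounded_integrable.
- exact: measurable_alcove.
- exact: alcove_measure_lty.
- exact: measurable_funTS.
- by exists M; split; [exact: num_real | move=> x Mx y _; apply: le_trans (ltW Mx); exact: H].
Qed.

Lemma RID f g : bmeas f -> bmeas g -> RI (fun v => f v + g v) = RI f + RI g.
Proof.
move=> bf bg; apply: (RintegralD measurable_alcove); exact: bmeas_integrable.
Qed.

Lemma RIZ c f : bmeas f -> RI (fun v => c * f v) = c * RI f.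
Proof.
move=> bf; apply: (RintegralZl _ measurable_alcove); exact: bmeas_integrable.
Qed.

Lemma RI_le f g : bmeas f -> bmeas g -> (forall v, f v <= g v) -> RI f <= RI g.
Proof.
move=> bf bg fg; apply: (le_Rintegral measurable_alcove) => //; exact: bmeas_integrable.
Qed.

Lemma RI_cst c : RI (fun=> c) = c * volA rs h.
Proof. by rewrite /RI /RintN Rintegral_cst ?volAE //; exact: measurable_alcove. Qed.

Lemma RI_IR f : bmeas f -> (forall v, 0 <= f v) ->
  (RI f)%:E = IR (fun v => ((inA v)%:R * f v)%:E).
Proof.
move=> bf f0; have bi := bmeas_integrable bf.
rewrite /RI /RintN /Rintegral fineK; last first.
  by apply: integrable_fin_num => //; exact: measurable_alcove.
rewrite integral_mkcond; apply: eq_integral => x _.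
rewrite patchE alcove_set; case: (boolP (inA (vec x))) => xA.
  by rewrite mem_set // mul1r.
by rewrite memNset ?mul0r //=; exact/negP.
Qed.

Lemma RI_Weyl f : bmeas f -> (forall v, 0 <= f v) ->
  (\sum_(w <- Ws) RI (fun v => f (v *m w)))%:E =
  IR (fun v => (weyl_count rs h Ws v * f v)%:E).
Proof.
move=> bf f0; have [r Ar] := in_alcove_bounded; have [y yA] := in_alcove_ex.
have IA0 : (0 < IR (fun v => ((inA v)%:R)%:E))%E.
  by rewrite alcove_measureE alcove_measure_gt0.
rewrite -(IR_alcove_Weyl Hrs HWu HW Ar yA IA0 bf.1 f0) -sumEFin.
by apply: eq_bigr => w _; rewrite RI_IR //; exact: bmeas_mulmx.
Qed.

Lemma RI_Weyl_shift f t : bmeas f -> (forall v, 0 <= f v) ->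
  (forall v s, L s -> f (v + s) = f v) ->
  \sum_(w <- Ws) RI (fun v => f (v *m w)) = \sum_(w <- Ws) RI (fun v => f (v *m w + t)).
Proof.
move=> bf f0 fL; have [r Ar] := in_alcove_bounded; have [y yA] := in_alcove_ex.
apply: EFin_inj; rewrite RI_Weyl // (RI_Weyl (f := fun v => f (v + t))) //.
  exact: (IR_periodic Hrs Hh HWu HW Ar yA _ bf.1).
exact: bmeas_shift.
Qed.

(* A translation by half a period of the character changes its sign. *)
Lemma RI_character y (F : R -> R) : weight rs y -> y != 0 ->
  bmeas (fun v => F (dotp y v)) ->
  (forall z : R, `|F z| <= 1) -> (forall z : R, F (z + pi) = - F z) ->
  \sum_(w <- Ws) RI (fun v => F (dotp y (v *m w))) = 0.
Proof.
move=> wy y0 bF F1 Fpi.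
have F2 (x : R) (m : int) : F (x + 2 * pi * m%:~R) = F x.
  have F2p z : F (z + 2 * pi) = F z.
    by rewrite mulr_natl mulr2n addrA !Fpi opprK.
  have F2n z (k : nat) : F (z + 2 * pi * k%:R) = F z.
    elim: k => [|k IH]; first by rewrite mulr0 addr0.
    by rewrite -[k.+1%:R]natr1 mulrDr mulr1 addrA F2p IH.
  case: m => k; first exact: F2n.
  by rewrite NegzE rmorphN mulrN -[LHS](F2n _ k.+1) subrK.
pose f v := 1 + F (dotp y v).
have bf : bmeas f by apply: bmeasD => //; exact: bmeas_cst.
have f0 v : 0 <= f v.
  by have := F1 (dotp y v); rewrite ler_norml => /andP[]; rewrite /f; lra.
have fL v s : L s -> f (v + s) = f v.
  by move=> Ls; rewrite /f dotpDr; have [m ->] := lattice_dotp Ls wy; rewrite F2.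
have := @RI_Weyl_shift f ((pi / dotp y y) *: y) bf f0 fL.
have yy : dotp y y != 0 by rewrite dotp_eq0.
have e1 : \sum_(w <- Ws) RI (fun v => f (v *m w)) =
  \sum_(w <- Ws) RI (fun=> 1) + \sum_(w <- Ws) RI (fun v => F (dotp y (v *m w))).
  rewrite -big_split; apply: eq_bigr => w _ /=; rewrite RID //; first exact: bmeas_cst.
  exact: (bmeas_mulmx w bF).
have e2 : \sum_(w <- Ws) RI (fun v => f (v *m w + (pi / dotp y y) *: y)) =
  \sum_(w <- Ws) RI (fun=> 1) - \sum_(w <- Ws) RI (fun v => F (dotp y (v *m w))).
  rewrite -sumrN -big_split; apply: eq_bigr => w _ /=.
  have -> : (fun v => f (v *m w + (pi / dotp y y) *: y))
          = (fun v => 1 + -1 * F (dotp y (v *m w))).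
    by apply/funext => v; rewrite /f dotpDr dotpZr divfK // Fpi mulN1r.
  rewrite RID ?RIZ ?mulN1r //; first 1 last.
  - exact: bmeas_cst.
  - by apply: bmeasM; [exact: bmeas_cst | exact: (bmeas_mulmx w bF)].
  - exact: (bmeas_mulmx w bF).
rewrite e1 e2; lra.
Qed.

End RealMean.

(** * Means of trigonometric polynomials *)

Section ComplexBasics.
Context (R : realType).
Implicit Types (x y : R) (z t : R[i]).

Lemma ReD z t : complex.Re (z + t) = complex.Re z + complex.Re t.
Proof. by case: z t => [? ?] [? ?]. Qed.
Lemma ImD z t : complex.Im (z + t) = complex.Im z + complex.Im t.
Proof. by case: z t => [? ?] [? ?]. Qed.
Lemma ReN z : complex.Re (- z) = - complex.Re z. Proof. by case: z. Qed.
Lemma ImN z : complex.Im (- z) = - complex.Im z. Proof. by case: z. Qed.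
Lemma ReM z t : complex.Re (z * t) =
  complex.Re z * complex.Re t - complex.Im z * complex.Im t.
Proof. by case: z t => [? ?] [? ?]. Qed.
Lemma ImM z t : complex.Im (z * t) =
  complex.Re z * complex.Im t + complex.Im z * complex.Re t.
Proof. by case: z t => [? ?] [? ?]. Qed.
Lemma ReJ z : complex.Re (conjc z) = complex.Re z. Proof. by case: z. Qed.
Lemma ImJ z : complex.Im (conjc z) = - complex.Im z. Proof. by case: z. Qed.

Lemma eq_cplx z t : complex.Re z = complex.Re t -> complex.Im z = complex.Im t -> z = t.
Proof. by case: z t => [? ?] [? ?] /= -> ->. Qed.

Lemma Re_expi x : complex.Re (expi x) = cos x.
Proof. by rewrite /expi ReD ReM /=; ring. Qed.

Lemma Im_expi x : complex.Im (expi x) = sin x.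
Proof. by rewrite /expi ImD ImM /=; ring. Qed.

Lemma expiD x y : expi (x + y) = expi x * expi y.
Proof.
apply: eq_cplx; first by rewrite ReM !Re_expi !Im_expi cosD.
by rewrite ImM !Re_expi !Im_expi sinD; ring.
Qed.

Lemma expi0 : expi 0 = 1 :> R[i].
Proof. by apply: eq_cplx; rewrite ?Re_expi ?Im_expi ?cos0 ?sin0. Qed.

Lemma expiN x : expi (- x) = conjc (expi x).
Proof. by apply: eq_cplx; rewrite ?ReJ ?ImJ ?Re_expi ?Im_expi ?cosN ?sinN. Qed.

Lemma expiNM x : expi (- x) * expi x = 1.
Proof. by rewrite -expiD addNr expi0. Qed.

Lemma expi_neq0 x : expi x != 0.
Proof. by apply/eqP => e; have := expiNM x; rewrite e mulr0 => /eqP; rewrite eq_sym oner_eq0. Qed.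

Lemma conjcM z t : conjc (z * t) = conjc z * conjc t.
Proof. exact: rmorphM. Qed.

Lemma conjcD z t : conjc (z + t) = conjc z + conjc t.
Proof. exact: rmorphD. Qed.

Lemma conjc_sum I (s : seq I) (P : pred I) (F : I -> R[i]) :
  conjc (\sum_(i <- s | P i) F i) = \sum_(i <- s | P i) conjc (F i).
Proof. exact: rmorph_sum. Qed.

Lemma conjc_prod I (s : seq I) (P : pred I) (F : I -> R[i]) :
  conjc (\prod_(i <- s | P i) F i) = \prod_(i <- s | P i) conjc (F i).
Proof. exact: rmorph_prod. Qed.

Lemma cabs_sqr z : cabs z ^+ 2 = complex.Re (z * conjc z).
Proof.
rewrite /cabs sqr_sqrtr; last by rewrite addr_ge0 ?sqr_ge0.
by rewrite ReM ReJ ImJ; ring.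
Qed.

Lemma cabsE z : (cabs z)%:C%C = `|z|.
Proof. by rewrite normc_def. Qed.

Lemma cabsM z t : cabs (z * t) = cabs z * cabs t.
Proof. by apply: complexI; rewrite rmorphM /= !cabsE normrM. Qed.

Lemma cabsD z t : cabs (z + t) <= cabs z + cabs t.
Proof. by rewrite -lecR rmorphD /= !cabsE ler_normD. Qed.

Lemma cabs_ge0 z : 0 <= cabs z. Proof. exact: sqrtr_ge0. Qed.

Lemma cabsN z : cabs (- z) = cabs z.
Proof. by apply: complexI; rewrite !cabsE normrN. Qed.

Lemma cabs0 : cabs (0 : R[i]) = 0.
Proof. by apply: complexI; rewrite cabsE normr0. Qed.

Lemma cabs1 : cabs (1 : R[i]) = 1.
Proof. by apply: complexI; rewrite cabsE normr1. Qed.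

Lemma cabs_eq0 z : (cabs z == 0) = (z == 0).
Proof. by rewrite -(inj_eq (@complexI R)) /= cabsE normr_eq0. Qed.

Lemma cabs_real x : cabs (x%:C%C) = `|x|.
Proof. by rewrite /cabs /= expr0n addr0 sqrtr_sqr. Qed.

Lemma cabsX z k : cabs (z ^+ k) = cabs z ^+ k.
Proof.
by elim: k => [|k IH]; rewrite ?expr0 ?cabs1 // !exprS cabsM IH.
Qed.

Lemma cabsV z : cabs z^-1 = (cabs z)^-1.
Proof.
have [->|z0] := eqVneq z 0; first by rewrite invr0 cabs0 invr0.
have c0 : cabs z != 0 by rewrite cabs_eq0.
by apply: (mulfI c0); rewrite -cabsM !divff // cabs1.
Qed.

Lemma cabs_sum I (s : seq I) (P : pred I) (F : I -> R[i]) :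
  cabs (\sum_(i <- s | P i) F i) <= \sum_(i <- s | P i) cabs (F i).
Proof.
elim/big_rec2: _ => [|i x y _ xy]; first by rewrite cabs0.
by apply: le_trans (cabsD _ _) _; rewrite lerD2l.
Qed.

Lemma cabsJ z : cabs (conjc z) = cabs z.
Proof. by rewrite /cabs ReJ ImJ sqrrN. Qed.

Lemma cabs_expi x : cabs (expi x) = 1.
Proof. by rewrite /cabs Re_expi Im_expi cos2Dsin2 sqrtr1. Qed.

Lemma le_Re_cabs z : `|complex.Re z| <= cabs z.
Proof.
rewrite -(sqrtr_sqr (complex.Re z)) ler_sqrt ?lerDl ?sqr_ge0 //.
by rewrite addr_ge0 ?sqr_ge0.
Qed.

Lemma le_Im_cabs z : `|complex.Im z| <= cabs z.
Proof.
rewrite -(sqrtr_sqr (complex.Im z)) ler_sqrt ?lerDr ?sqr_ge0 //.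
by rewrite addr_ge0 ?sqr_ge0.
Qed.

Lemma cabs_le z : cabs z <= `|complex.Re z| + `|complex.Im z|.
Proof.
rewrite -(@ger0_norm _ (_ + _)) ?addr_ge0 // -sqrtr_sqr ler_sqrt ?sqr_ge0 //.
rewrite sqrrD !real_normK ?num_real // lerD2r lerDl.
by rewrite mulrn_wge0 // mulr_ge0.
Qed.

End ComplexBasics.

Section ComplexMean.
Context (R : realType) (n : nat) (rs : seq 'rV[R]_n.+1) (h : 'rV[R]_n.+1).
Context (Ws : seq 'M[R]_n.+1).
Context (Hrs : is_root_system rs) (Hh : {in rs, forall a, dotp h a != 0}).
Context (HWu : uniq Ws) (HW : forall w, w \in Ws <-> inW rs w).
Context (vol0 : volA rs h != 0).
Implicit Types (a u v x y t : 'rV[R]_n.+1) (w : 'M[R]_n.+1).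
Implicit Types (f g : 'rV[R]_n.+1 -> R[i]).
Notation RA := (RI rs h).

Definition cbm f := bmeas (fun v => complex.Re (f v)) /\ bmeas (fun v => complex.Im (f v)).

(** Carries the normalisation of [ipD], which is therefore [Lc] of its integrand by conversion. *)
Definition Lc f : R[i] := (((size Ws)%:R * volA rs h)^-1%:C * CintN (alcove rs h) f)%C.

Definition echar y v : R[i] := expi (dotp y v).

Lemma eq_cbm f g : f =1 g -> cbm f -> cbm g.
Proof. by move=> /funext ->. Qed.

Lemma cbm_cst c : cbm (fun=> c).
Proof. by split; exact: bmeas_cst. Qed.

Lemma cbmD f g : cbm f -> cbm g -> cbm (fun v => f v + g v).
Proof.
move=> [f1 f2] [g1 g2]; split; [under eq_fun do rewrite ReD | under eq_fun do rewrite ImD];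
exact: bmeasD.
Qed.

Lemma cbmM f g : cbm f -> cbm g -> cbm (fun v => f v * g v).
Proof.
move=> [f1 f2] [g1 g2]; split.
  by under eq_fun do rewrite ReM; apply: bmeasB; exact: bmeasM.
by under eq_fun do rewrite ImM; apply: bmeasD; exact: bmeasM.
Qed.

Lemma cbmN f : cbm f -> cbm (fun v => - f v).
Proof.
move=> [f1 f2]; split; [under eq_fun do rewrite ReN | under eq_fun do rewrite ImN];
exact: bmeasN.
Qed.

Lemma cbmJ f : cbm f -> cbm (fun v => conjc (f v)).
Proof.
move=> [f1 f2]; split; [under eq_fun do rewrite ReJ | under eq_fun do rewrite ImJ] => //.
exact: bmeasN.
Qed.

Lemma cbm_mulmx f w : cbm f -> cbm (fun v => f (v *m w)).
Proof. by move=> [f1 f2]; split; [exact: (bmeas_mulmx w f1) | exact: (bmeas_mulmx w f2)]. Qed.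

Lemma cbm_sum I (s : seq I) (P : pred I) (F : I -> 'rV[R]_n.+1 -> R[i]) :
  (forall i, P i -> cbm (F i)) -> cbm (fun v => \sum_(i <- s | P i) F i v).
Proof.
move=> mF; elim: s => [|i s IH].
  by apply: eq_cbm (cbm_cst 0) => v; rewrite big_nil.
pose S v := \sum_(i <- s | P i) F i v.
apply: (@eq_cbm (fun v => if P i then F i v + S v else S v)) => [v|].
  by rewrite big_cons.
by case Pi: (P i) => //; apply: cbmD => //; exact: mF.
Qed.

Lemma cbm_prod I (s : seq I) (P : pred I) (F : I -> 'rV[R]_n.+1 -> R[i]) :
  (forall i, P i -> cbm (F i)) -> cbm (fun v => \prod_(i <- s | P i) F i v).
Proof.
move=> mF; elim: s => [|i s IH].
  by apply: eq_cbm (cbm_cst 1) => v; rewrite big_nil.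
pose S v := \prod_(i <- s | P i) F i v.
apply: (@eq_cbm (fun v => if P i then F i v * S v else S v)) => [v|].
  by rewrite big_cons.
by case Pi: (P i) => //; apply: cbmM => //; exact: mF.
Qed.

Lemma cbm_echar y : cbm (echar y).
Proof.
split; [under eq_fun do rewrite Re_expi | under eq_fun do rewrite Im_expi].
  exact: bmeas_cos.
exact: bmeas_sin.
Qed.

Let k : R := ((size Ws)%:R * volA rs h)^-1.

Lemma Re_Lc f : complex.Re (Lc f) = k * RA (fun v => complex.Re (f v)).
Proof. by rewrite /Lc /CintN /RI /k ReM !ReD !ReM /=; ring. Qed.

Lemma Im_Lc f : complex.Im (Lc f) = k * RA (fun v => complex.Im (f v)).
Proof. by rewrite /Lc /CintN /RI /k ImM !ImD !ImM /=; ring. Qed.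

Lemma LcD f g : cbm f -> cbm g -> Lc (fun v => f v + g v) = Lc f + Lc g.
Proof.
move=> [f1 f2] [g1 g2]; apply: eq_cplx.
  rewrite ReD !Re_Lc -mulrDr -RID //; congr (_ * RA _).
  by apply/funext => v; rewrite ReD.
rewrite ImD !Im_Lc -mulrDr -RID //; congr (_ * RA _).
by apply/funext => v; rewrite ImD.
Qed.

Lemma LcZ c f : cbm f -> Lc (fun v => c * f v) = c * Lc f.
Proof.
move=> [f1 f2]; have b (x : R) (F : _ -> R) : bmeas F -> bmeas (fun v => x * F v).
  by apply: bmeasM; exact: bmeas_cst.
apply: eq_cplx.
  rewrite [RHS]ReM !Re_Lc Im_Lc.
  rewrite (_ : (fun v => complex.Re (c * f v)) =
    fun v => complex.Re c * complex.Re (f v) + (- complex.Im c) * complex.Im (f v)); last first.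
    by apply/funext => v; rewrite ReM mulNr.
  by rewrite RID ?RIZ //; [ring | exact: b | exact: b].
rewrite [RHS]ImM !Im_Lc Re_Lc.
rewrite (_ : (fun v => complex.Im (c * f v)) =
  fun v => complex.Re c * complex.Im (f v) + complex.Im c * complex.Re (f v)); last first.
  by apply/funext => v; rewrite ImM.
by rewrite RID ?RIZ //; [ring | exact: b | exact: b].
Qed.

Lemma LcN f : cbm f -> Lc (fun v => - f v) = - Lc f.
Proof.
move=> bf; rewrite -mulN1r -LcZ //; congr Lc; apply/funext => v.
by rewrite mulN1r.
Qed.

Lemma Lc_sum I (s : seq I) (P : pred I) (F : I -> 'rV[R]_n.+1 -> R[i]) :
  (forall i, P i -> cbm (F i)) ->
  Lc (fun v => \sum_(i <- s | P i) F i v) = \sum_(i <- s | P i) Lc (F i).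
Proof.
move=> mF; elim: s => [|i s IH].
  rewrite (_ : (fun v => _) = fun=> 0); last by apply/funext => v; rewrite big_nil.
  by rewrite big_nil -[RHS](mul0r (Lc (fun=> 0))) -LcZ ?mul0r //; exact: cbm_cst.
pose S v := \sum_(i <- s | P i) F i v.
rewrite big_cons (_ : (fun v => _) = fun v => if P i then F i v + S v else S v); last first.
  by apply/funext => v; rewrite big_cons.
case Pi: (P i) => //.
by rewrite LcD ?IH //; [exact: mF | exact: cbm_sum].
Qed.

Lemma sizeWs_gt0 : (0 < size Ws)%N.
Proof.
have : 1%:M \in Ws by apply/HW; exact: inW1.
by case: (Ws).
Qed.

Lemma Lc_scale_gt0 : 0 < k.
Proof. by rewrite invr_gt0 mulr_gt0 ?volA_gt0 // ltr0n sizeWs_gt0. Qed.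

Lemma Re_Lc_le f g : cbm f -> cbm g ->
  (forall v, complex.Re (f v) <= complex.Re (g v)) ->
  complex.Re (Lc f) <= complex.Re (Lc g).
Proof.
move=> [f1 _] [g1 _] fg; rewrite !Re_Lc ler_wpM2l ?(ltW Lc_scale_gt0) //.
exact: RI_le.
Qed.

Lemma Re_Lc_cst (c : R) : complex.Re (Lc (fun=> (c%:C)%C)) = (size Ws)%:R^-1 * c.
Proof.
rewrite Re_Lc RI_cst // -[complex.Re _]/c /k; field.
by rewrite vol0 pnatr_eq0 -lt0n sizeWs_gt0.
Qed.

(** On trigonometric polynomials whose exponents are weights this extracts the constant term, by
    [Mc_echar]. *)
Definition Mc f : R[i] := \sum_(w <- Ws) Lc (fun v => f (v *m w)).

Lemma McZ c f : cbm f -> Mc (fun v => c * f v) = c * Mc f.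
Proof.
move=> bf; rewrite mulr_sumr; apply: eq_bigr => w _ /=.
by rewrite LcZ //; exact: cbm_mulmx.
Qed.

Lemma Mc_sum I (s : seq I) (P : pred I) (F : I -> 'rV[R]_n.+1 -> R[i]) :
  (forall i, P i -> cbm (F i)) ->
  Mc (fun v => \sum_(i <- s | P i) F i v) = \sum_(i <- s | P i) Mc (F i).
Proof.
move=> mF; rewrite exchange_big; apply: eq_bigr => w _ /=.
by rewrite Lc_sum // => i Pi; apply: cbm_mulmx; exact: mF.
Qed.

Lemma Mc_echar y : weight rs y -> Mc (echar y) = (y == 0)%:R.
Proof.
move=> wy; have [->|y0] := eqVneq y 0.
  have S0 : (size Ws)%:R != 0 :> R by rewrite pnatr_eq0 -lt0n sizeWs_gt0.
  rewrite /Mc (eq_bigr (fun=> ((size Ws)%:R^-1%:C)%C)); last first.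
    move=> w _; rewrite (_ : (fun v => _) = fun=> (1%:C)%C); last first.
      by apply/funext => v; rewrite /echar dotp0l expi0.
    apply: eq_cplx; first by rewrite Re_Lc_cst mulr1.
    by rewrite Im_Lc RI_cst // mul0r mulr0.
  rewrite big_const_seq count_predT iter_addr_0 -[LHS]mulr_natr -(rmorph_nat (real_complex R) (size Ws)).
  by rewrite -rmorphM /= mulVf.
have S (F : R -> R) : bmeas (fun v => F (dotp y v)) ->
    (forall z : R, `|F z| <= 1) -> (forall z : R, F (z + pi) = - F z) ->
    \sum_(w <- Ws) k * RA (fun v => F (dotp y (v *m w))) = 0.
  by move=> *; rewrite -mulr_sumr (RI_character Hrs Hh HWu HW vol0 wy y0) // mulr0.
have ReS I (s : seq I) (G : I -> R[i]) :
    complex.Re (\sum_(i <- s) G i) = \sum_(i <- s) complex.Re (G i).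
  by elim: s => [|i s IH]; rewrite ?big_nil // !big_cons ReD IH.
have ImS I (s : seq I) (G : I -> R[i]) :
    complex.Im (\sum_(i <- s) G i) = \sum_(i <- s) complex.Im (G i).
  by elim: s => [|i s IH]; rewrite ?big_nil // !big_cons ImD IH.
apply: eq_cplx; rewrite /= ?ReS ?ImS.
  rewrite -[RHS](S (@cos R)); first last.
  - by move=> z; rewrite cosDpi.
  - by move=> z; rewrite ler_norml cos_geN1 cos_le1.
  - exact: bmeas_cos.
  apply: eq_bigr => w _; rewrite Re_Lc; congr (_ * RA _).
  by apply/funext => v; rewrite Re_expi.
rewrite -[RHS](S (@sin R)); first last.
- by move=> z; rewrite sinDpi.
- by move=> z; rewrite ler_norml sin_geN1 sin_le1.
- exact: bmeas_sin.
apply: eq_bigr => w _; rewrite Im_Lc; congr (_ * RA _).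
by apply/funext => v; rewrite Im_expi.
Qed.

End ComplexMean.

(** * Zero-free power series *)

Section PowerSeriesBasics.
Context (R : realType).

Lemma cabs_dist (z w : R[i]) : `|cabs z - cabs w| <= cabs (z - w).
Proof.
have h1 := cabsD (z - w) w; have h2 := cabsD (w - z) z.
rewrite !subrK in h1 h2; rewrite -[w - z]opprB cabsN in h2.
by rewrite ler_norml; apply/andP; split; lra.
Qed.

Implicit Types (c : nat -> R[i]) (z w : R[i]) (r s S : R).

Lemma ccvg_toP (u : nat -> R[i]) l : ccvg_to u l ->
  forall e, 0 < e -> forall k, exists2 m, (k <= m)%N & cabs (l - u m) <= e.
Proof.
move=> [ur ui] e e0 k.
have e2 : 0 < e / 2 by rewrite divr_gt0.
have /cvgrPdist_le/(_ _ e2) [n1 _ N1] := ur.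
have /cvgrPdist_le/(_ _ e2) [n2 _ N2] := ui.
exists (maxn k (maxn n1 n2)); first exact: leq_maxl.
apply: le_trans (cabs_le _) _; rewrite ReD ReN ImD ImN.
have h1 := N1 (maxn k (maxn n1 n2)); have h2 := N2 (maxn k (maxn n1 n2)).
rewrite /= in h1 h2.
have {}h1 := h1 (leq_trans (leq_maxl _ _) (leq_maxr _ _)).
have {}h2 := h2 (leq_trans (leq_maxr _ _) (leq_maxr _ _)).
lra.
Qed.

Definition psum c K z : R[i] := \sum_(k < K) c k * z ^+ k.

Lemma seriesE c K z : series (fun n => c n * z ^+ n) K = psum c K z.
Proof. by rewrite /psum /series /= big_mkord. Qed.

Lemma cabs_psum_sub c K m z r s S : (K <= m)%N -> cabs z <= r -> 0 < r -> r <= s ->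
  (forall j, \sum_(k < j) cabs (c k) * s ^+ k <= S) ->
  cabs (psum c m z - psum c K z) <= S * (r / s) ^+ K.
Proof.
move=> Km zr r0 rs HS.
have s0 : 0 < s by apply: lt_le_trans rs.
have rs1 : r / s <= 1 by rewrite ler_pdivrMr // mul1r.
have rs0 : 0 <= r / s by rewrite divr_ge0 ?ltW.
have -> : psum c m z - psum c K z = \sum_(K <= k < m) c k * z ^+ k.
  rewrite /psum -!(big_mkord xpredT (fun k => c k * z ^+ k)).
  by rewrite [X in X - _](big_cat_nat (n := K)) //= [X in X - _]addrC addrK.
apply: le_trans (cabs_sum _ _ _) _.
apply: (@le_trans _ _ ((\sum_(K <= k < m) cabs (c k) * s ^+ k) * (r / s) ^+ K)).
  rewrite mulr_suml; apply: ler_sum_nat => k /andP[Kk _].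
  rewrite cabsM cabsX -mulrA ler_wpM2l ?cabs_ge0 //.
  apply: (@le_trans _ _ (r ^+ k)); first by rewrite lerXn2r ?nnegrE ?cabs_ge0 // ltW.
  have -> : r ^+ k = s ^+ k * (r / s) ^+ k by rewrite -exprMn mulrCA divff ?mulr1 // gt_eqF.
  by rewrite ler_wpM2l ?exprn_ge0 ?(ltW s0) // ler_wiXn2l.
rewrite ler_wpM2r ?exprn_ge0 //; apply: le_trans (HS m).
rewrite -(big_mkord xpredT (fun k => cabs (c k) * s ^+ k)) [leRHS](big_cat_nat (n := K)) //= lerDr.
by apply: sumr_ge0 => k _; rewrite mulr_ge0 ?cabs_ge0 // exprn_ge0 // ltW.
Qed.

Lemma psum_lipschitz c K r : 0 <= r -> exists2 B, 0 <= B &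
  forall z w, cabs z <= r -> cabs w <= r ->
  cabs (psum c K z - psum c K w) <= B * cabs (z - w).
Proof.
move=> r0.
have X k : exists2 B, 0 <= B & forall z w, cabs z <= r -> cabs w <= r ->
    cabs (z ^+ k - w ^+ k) <= B * cabs (z - w).
  elim: k => [|k [B B0 IH]].
    by exists 0 => // z w _ _; rewrite !expr0 subrr cabs0 mul0r.
  exists (r * B + r ^+ k); first by rewrite addr_ge0 ?mulr_ge0 ?exprn_ge0.
  move=> z w zr wr; rewrite !exprS.
  have -> : z * z ^+ k - w * w ^+ k = z * (z ^+ k - w ^+ k) + (z - w) * w ^+ k by ring.
  apply: le_trans (cabsD _ _) _; rewrite !cabsM mulrDl lerD //.
    by rewrite -mulrA ler_pM ?cabs_ge0 ?IH.
  by rewrite mulrC ler_wpM2r ?cabs_ge0 // cabsX lerXn2r // nnegrE cabs_ge0.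
elim: K => [|K [B B0 IH]].
  by exists 0 => // z w _ _; rewrite /psum !big_ord0 subrr cabs0 mul0r.
have [B' B'0 IH'] := X K.
exists (B + cabs (c K) * B'); first by rewrite addr_ge0 ?mulr_ge0 ?cabs_ge0.
move=> z w zr wr; rewrite /psum !big_ord_recr /= -/(psum c K z) -/(psum c K w).
have -> : psum c K z + c K * z ^+ K - (psum c K w + c K * w ^+ K) =
  (psum c K z - psum c K w) + c K * (z ^+ K - w ^+ K) by ring.
apply: le_trans (cabsD _ _) _; rewrite mulrDl lerD ?IH // cabsM -mulrA.
by rewrite ler_wpM2l ?cabs_ge0 ?IH'.
Qed.

End PowerSeriesBasics.

Section AnalyticFunction.
Context (R : realType) (f : R[i] -> R[i]) (c : nat -> R[i]) (s S : R).
Context (s1 : 1 < s) (HS : forall j, \sum_(k < j) cabs (c k) * s ^+ k <= S).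
Context (Hf : forall z, cabs z <= s -> ccvg_to (series (fun n => c n * z ^+ n)) (f z)).
Implicit Types (z w : R[i]) (r : R).

Let s0 : 0 < s. Proof. exact: lt_trans s1. Qed.

Lemma S_ge0 : 0 <= S.
Proof. by have := HS 0; rewrite big_ord0. Qed.

Lemma psum_tail K z r : cabs z <= r -> 0 < r -> r <= s ->
  cabs (f z - psum c K z) <= S * (r / s) ^+ K.
Proof.
move=> zr r0 rs; apply/ler_addgt0Pr => e e0.
have [m Km Hm] := ccvg_toP (Hf (le_trans zr rs)) e0 K.
rewrite seriesE in Hm.
have -> : f z - psum c K z = (psum c m z - psum c K z) + (f z - psum c m z) by ring.
apply: le_trans (cabsD _ _) _; rewrite lerD //.
exact: (cabs_psum_sub Km zr r0 rs HS).
Qed.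

(** Partial sums are Lipschitz and approximate [f] uniformly. The argument is a pair of reals so
    that [analytic_min] can use compactness of the disc in the plane. *)
Lemma analytic_continuous r (p : R * R) : 0 < r -> r < s -> p.1 ^+ 2 + p.2 ^+ 2 <= r ^+ 2 ->
  {for p, continuous (fun p : R * R => cabs (f (Complex p.1 p.2)))}.
Proof.
(* The larger radius leaves room for a neighbourhood of a boundary point while the tails still decay
   geometrically on it. *)
move=> r0 rs pr; pose r' := (r + s) / 2.
have rr' : r < r' by rewrite /r'; lra.
have r's : r' < s by rewrite /r'; lra.
have r'0 : 0 < r' by lra.
have cle (x y t : R) : 0 <= t -> x ^+ 2 + y ^+ 2 <= t ^+ 2 -> cabs (Complex x y) <= t.
  move=> t0 xy; rewrite /cabs /= -(ger0_norm t0) -sqrtr_sqr ler_sqrt //.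
  exact: sqr_ge0.
have q1 : `|r' / s| < 1.
  have r's0 : 0 <= r' / s by apply: divr_ge0; exact: ltW.
  by rewrite (ger0_norm r's0) ltr_pdivrMr // mul1r.
apply/cvgrPdist_le => e e0.
have [K _ HK] : \forall K \near \oo, S * (r' / s) ^+ K <= e / 4.
  have : (fun K => S * (r' / s) ^+ K) @ \oo --> S * 0.
    by apply: cvgMr; exact: cvg_expr.
  rewrite mulr0 => /cvgrPdist_le/(_ (e / 4)); rewrite divr_gt0 // => /(_ isT).
  apply: filterS => K; rewrite sub0r normrN; exact: le_trans (ler_norm _).
have {}HK := HK K (leqnn K).
have [B B0 HB] := psum_lipschitz c K (ltW r'0).
pose d := Num.min ((r' - r) / 4) (e / (4 * (B + 1))).
have d0 : 0 < d.
  by rewrite lt_min !divr_gt0 ?subr_gt0 ?mulr_gt0 ?ltr_wpDl.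
have : nbhs p [set q : R * R | `|p.1 - q.1| < d /\ `|p.2 - q.2| < d].
  exists (ball p.1 d, ball p.2 d); first by split; exact: nbhsx_ballx.
  by move=> q [].
apply: filterS => q [q1d q2d].
have pc : cabs (Complex p.1 p.2) <= r by apply: cle => //; exact: ltW.
have dd : cabs (Complex p.1 p.2 - Complex q.1 q.2) <= 2 * d.
  apply: le_trans (cabs_le _) _; rewrite /=; lra.
have d1 : d <= (r' - r) / 4 by rewrite /d ge_min lexx.
have d2 : d <= e / (4 * (B + 1)) by rewrite /d ge_min lexx orbT.
have qc : cabs (Complex q.1 q.2) <= r'.
  have -> : Complex q.1 q.2 = Complex p.1 p.2 - (Complex p.1 p.2 - Complex q.1 q.2) by ring.
  by apply: le_trans (cabsD _ _) _; rewrite cabsN; lra.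
have pc' : cabs (Complex p.1 p.2) <= r' by lra.
set z := Complex p.1 p.2 in pc pc' dd *; set w := Complex q.1 q.2 in qc dd *.
have t1 := psum_tail K pc' r'0 (ltW r's); have t2 := psum_tail K qc r'0 (ltW r's).
have t3 := HB _ _ pc' qc.
have B1 : B * (2 * d) <= e / 2.
  have -> : e / 2 = 2 * (e / 4) by field.
  rewrite mulrCA ler_wpM2l //; apply: (@le_trans _ _ ((B + 1) * (e / (4 * (B + 1))))).
    by rewrite ler_pM ?(ltW d0) ?lerDl.
  by rewrite [leLHS](_ : _ = e / 4) //; field; rewrite gt_eqF ?ltr_wpDl.
have t4 : cabs (f z - f w) <= e.
  have -> : f z - f w = (f z - psum c K z) + ((psum c K z - psum c K w) - (f w - psum c K w)).
    by move: (f z) (f w) (psum c K z) (psum c K w) => *; ring.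
  have -> : e = e / 4 + (e / 2 + e / 4) by field.
  apply: le_trans (cabsD _ _) (lerD (le_trans t1 HK) _).
  apply: le_trans (cabsD _ _) (lerD _ _); last by rewrite cabsN; exact: le_trans t2 HK.
  by apply: le_trans t3 (le_trans _ B1); rewrite ler_wpM2l.
exact: le_trans (cabs_dist _ _) t4.
Qed.

Context (f0 : forall z, cabs z <= s -> f z != 0).

Lemma analytic_min r : 0 < r -> r < s ->
  exists2 m, 0 < m & forall z, cabs z <= r -> m <= cabs (f z).
Proof.
move=> r0 rs.
pose A := [set p : R * R | p.1 ^+ 2 + p.2 ^+ 2 <= r ^+ 2].
have A0 : A !=set0 by exists (0, 0); rewrite /A /= expr0n addr0 sqr_ge0.
have cA : compact A.
  apply: (@subclosed_compact _ _ (`[-r, r] `*` `[-r, r])); last first.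
  - move=> p; rewrite /A /= => H; rewrite !in_itv /= -!ler_norml.
    have k1 : p.1 ^+ 2 <= r ^+ 2 by have := sqr_ge0 p.2; lra.
    have k2 : p.2 ^+ 2 <= r ^+ 2 by have := sqr_ge0 p.1; lra.
    have sq x : x ^+ 2 <= r ^+ 2 -> `|x| <= r.
      by move=> xx; rewrite -(ger0_norm (ltW r0)) -!sqrtr_sqr ler_wsqrtr.
    by split; exact: sq.
  - by apply: compact_setX; exact: segment_compact.
  pose g (p : R * R) := p.1 ^+ 2 + p.2 ^+ 2.
  have cg : continuous g.
    move=> p; apply: cvgD; apply: (@cvg_comp _ _ _ _ (fun x : R => x ^+ 2)).
    - exact: cvg_fst.
    - exact: exprn_continuous.
    - exact: cvg_snd.
    - exact: exprn_continuous.
  have -> : A = g @^-1` [set x | x <= r ^+ 2] by [].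
  by apply: (continuous_closedP _).1 cg _ _; exact: closed_le.
have cf : {within A, continuous (fun p : R * R => cabs (f (Complex p.1 p.2)))}.
  apply: continuous_in_subspaceT => p; rewrite inE => pA.
  exact: analytic_continuous r0 rs pA.
have [p pA pm] := compact_EVT_min A0 cA cf.
have AE x y : A (x, y) <-> cabs (Complex x y) <= r.
  rewrite /A /= /cabs /= -{2}(ger0_norm (ltW r0)) -sqrtr_sqr ler_sqrt //.
  exact: sqr_ge0.
exists (cabs (f (Complex p.1 p.2))).
  rewrite lt_def cabs_ge0 andbT cabs_eq0 f0 //.
  apply: le_trans (ltW rs); apply/AE; rewrite inE in pA; exact: pA.
move=> [x y] zr; apply: (pm (x, y)); rewrite inE; exact/AE.
Qed.

(** Once the lower coefficients are real, the imaginary part of the partial sum at a real [x] is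
    [Im (c k) * x ^+ k], and it is bounded by a tail of order [x ^+ k.+1]. Dividing by [x ^+ k] and
    taking [x] small makes it vanish. *)
Lemma real_coefs : (forall x : R, complex.Im (f x%:C%C) = 0) ->
  forall k, complex.Im (c k) = 0.
Proof.
move=> fr k; elim/ltn_ind: k => k IH.
have Imp x : complex.Im (psum c k.+1 x%:C%C) = complex.Im (c k) * x ^+ k.
  have e1 j : complex.Im (c j * (x%:C)%C ^+ j) = complex.Im (c j) * x ^+ j.
    by rewrite -rmorphXn /= ImM /=; ring.
  rewrite /psum big_ord_recr /= ImD e1.
  rewrite (_ : complex.Im _ = 0) ?add0r //.
  elim/big_rec: _ => // j z _ zz; rewrite ImD e1 IH // zz; ring.
apply/eqP; rewrite -normr_eq0 eq_le normr_ge0 andbT.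
apply/ler_addgt0Pr => e e0; rewrite add0r.
pose x := Num.min s (e * s ^+ k.+1 / (S + 1)).
have S0 := S_ge0.
have x0 : 0 < x by rewrite lt_min s0 divr_gt0 ?mulr_gt0 ?exprn_gt0 // ltr_wpDl.
have xs : x <= s by rewrite ge_min lexx.
have := psum_tail k.+1 (_ : cabs (x%:C)%C <= x) x0 xs.
rewrite cabs_real (ger0_norm (ltW x0)) => /(_ (lexx _)) H.
have := le_trans (le_Im_cabs _) H; rewrite ImD fr ImN Imp add0r normrN normrM.
rewrite normrX (ger0_norm (ltW x0)) => H1.
have : `|complex.Im (c k)| <= S * x / s ^+ k.+1.
  rewrite -(@ler_pM2r _ (x ^+ k)) ?exprn_gt0 //; apply: le_trans H1 _.
  by rewrite expr_div_n [X in _ * (X / _)]exprS le_eqVlt; apply/orP; left; apply/eqP; ring.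
move=> H2; apply: le_trans H2 _.
have x2 : x <= e * s ^+ k.+1 / (S + 1) by rewrite ge_min lexx orbT.
rewrite ler_pdivrMr ?exprn_gt0 //.
apply: (@le_trans _ _ ((S + 1) * (e * s ^+ k.+1 / (S + 1)))).
  by rewrite ler_pM ?lerDl // ltW.
by rewrite mulrC divfK // gt_eqF // ltr_wpDl.
Qed.

Lemma analytic_conj : (forall k, complex.Im (c k) = 0) ->
  forall z, cabs z <= s -> f (conjc z) = conjc (f z).
Proof.
move=> cr z zs; have zs' : cabs (conjc z) <= s by rewrite cabsJ.
have [r1 i1] := Hf zs; have [r2 i2] := Hf zs'.
have E n : series (fun n => c n * conjc z ^+ n) n = conjc (series (fun n => c n * z ^+ n) n).
  rewrite /series /= conjc_sum; apply: eq_bigr => k _.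
  rewrite conjcM rmorphXn /=; congr (_ * _).
  by apply: eq_cplx; rewrite ?ReJ ?ImJ // cr oppr0.
have e2 : (fun n => complex.Im (series (fun n => c n * conjc z ^+ n) n)) =
          (fun n => - complex.Im (series (fun n => c n * z ^+ n) n)).
  by apply/funext => n; rewrite E ImJ.
have e1 : (fun n => complex.Re (series (fun n => c n * conjc z ^+ n) n)) =
          (fun n => complex.Re (series (fun n => c n * z ^+ n) n)).
  by apply/funext => n; rewrite E ReJ.
rewrite e1 in r2; rewrite e2 in i2; apply: eq_cplx; rewrite ?ReJ ?ImJ.
  exact: cvg_unique r2 r1.
exact: cvg_unique i2 (cvgN i1).
Qed.

End AnalyticFunction.

(** * The formal inverse of a power series *)

Section FormalInverse.
Context (K : comNzRingType) (c : nat -> K).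

(** Course-of-values recursion: the list of all earlier coefficients is kept so that the next one
    can be computed from them. *)
Fixpoint inv_seq (n : nat) : seq K := if n is m.+1 then
  rcons (inv_seq m) ((m == 0)%:R - \sum_(i < m) (inv_seq m)`_i * c (m - i)) else [::].

Definition inv_coef (n : nat) : K := (inv_seq n.+1)`_n.

Lemma size_inv_seq n : size (inv_seq n) = n.
Proof. by elim: n => //= n IH; rewrite size_rcons IH. Qed.

Lemma nth_inv_seq n k : (k < n)%N -> (inv_seq n)`_k = inv_coef k.
Proof.
elim: n => // n IH; rewrite ltnS leq_eqVlt => /predU1P[-> //|kn].
by rewrite /= nth_rcons size_inv_seq kn IH.
Qed.

Context (c0 : c 0 = 1).

Lemma inv_coefE n : \sum_(i < n.+1) inv_coef i * c (n - i) = (n == 0)%:R.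
Proof.
rewrite big_ord_recr /= subnn c0 mulr1 {2}/inv_coef /= nth_rcons size_inv_seq ltnn eqxx.
rewrite addrC -addrA -sumrN -big_split /= big1 ?addr0 // => i _.
by rewrite nth_inv_seq // addNr.
Qed.

Lemma inv_coef_uniq (e : nat -> K) m :
  (forall n, (n <= m)%N -> \sum_(i < n.+1) e i * c (n - i) = (n == 0)%:R) ->
  forall n, (n <= m)%N -> e n = inv_coef n.
Proof.
move=> eP; elim/ltn_ind => n IH nm.
have := eP n nm; rewrite -(inv_coefE n) !big_ord_recr /= subnn c0 !mulr1.
rewrite (eq_bigr (fun i : 'I_n => inv_coef i * c (n - i))); first by move/addrI.
by move=> i _; rewrite IH // (leq_trans (ltnW (ltn_ord i))).
Qed.

End FormalInverse.

(** * Cauchy's estimate and inverses of polynomials without zeros *)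

Section CauchyBound.
Context (R : realType).
Implicit Types (p : {poly R[i]}) (z : R[i]).

Lemma cos_eq1 (x : R) : `|x| < 2 * pi -> cos x = 1 -> x = 0.
Proof.
wlog x0 : x / 0 <= x.
  move=> H xp cx; have [x0|/ltW x0] := leP 0 x; first exact: H.
  by apply/eqP; rewrite -oppr_eq0; apply/eqP; apply: H; rewrite ?oppr_ge0 ?normrN ?cosN.
rewrite ger0_norm // => xp cx.
have : cos (x / 2 + x / 2) = 1 by rewrite -splitr.
rewrite cosD -!expr2 => e.
have s0 : sin (x / 2) ^+ 2 = 0 by have := cos2Dsin2 (x / 2); lra.
apply/eqP; rewrite eq_le x0 andbT leNgt; apply/negP => xgt.
have : 0 < sin (x / 2) by apply: sin_gt0_pi; lra.
by move/eqP: s0; rewrite sqrf_eq0 => /eqP ->; rewrite ltxx.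
Qed.

Lemma expi_natM (x : R) k : expi (k%:R * x) = expi x ^+ k.
Proof.
elim: k => [|k IH]; first by rewrite mul0r expi0 expr0.
by rewrite exprS -IH -expiD -natr1 mulrDl mul1r addrC.
Qed.

Lemma expi_2pi : expi (2 * pi) = 1 :> R[i].
Proof.
have e : 2 * pi = pi *+ 2 :> R by rewrite mulr_natl.
by apply: eq_cplx; rewrite ?Re_expi ?Im_expi e ?cos2pi ?sin2pi.
Qed.

Lemma roots_unity_sum (M k l : nat) : (k < M)%N -> (l < M)%N ->
  let om := expi (2 * pi / M%:R) : R[i] in
  \sum_(j < M) (om ^+ k * om ^- l) ^+ j = if k == l then M%:R else 0.
Proof.
move=> kM lM om; have M0 : (M%:R : R) != 0 by rewrite pnatr_eq0 -lt0n (leq_ltn_trans _ kM).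
have Mgt : 0 < (M%:R : R) by rewrite ltr0n (leq_ltn_trans _ kM).
case: eqP => [->|kl].
  rewrite (eq_bigr (fun=> 1)) ?sumr_const ?card_ord // => j _.
  by rewrite divff ?expr1n // expf_neq0 // expi_neq0.
set x := om ^+ k * _.
have omE j : om ^+ j = expi (j%:R * (2 * pi / M%:R)) by rewrite expi_natM.
have xE : x = expi ((k%:R - l%:R) * (2 * pi / M%:R)).
  rewrite mulrBl expiD -omE expiN; congr (_ * _).
  have on0 : om ^+ l != 0 by rewrite expf_neq0 ?expi_neq0.
  by apply: (mulfI on0); rewrite divff // -expiN omE mulrC expiNM.
have x1 : x != 1.
  apply/eqP => e; have := congr1 (@complex.Re R) e.
  rewrite xE Re_expi /= => /cos_eq1 H; have {}H : (k%:R - l%:R) * (2 * pi / M%:R) = 0 :> R.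
    apply: H; rewrite normrM [X in _ * X]ger0_norm; last first.
      by rewrite divr_ge0 ?ler0n // mulr_ge0 // pi_ge0.
    rewrite mulrCA [X in _ < X](_ : _ = 2 * pi * 1); last by rewrite mulr1.
    rewrite ltr_pM2l; last by rewrite mulr_gt0 // pi_gt0.
    rewrite ltr_pdivrMr // mul1r ltr_norml; apply/andP; split.
      have : (l%:R : R) < M%:R by rewrite ltr_nat.
      by have := ler0n R k; lra.
    have : (k%:R : R) < M%:R by rewrite ltr_nat.
    by have := ler0n R l; lra.
  move/eqP: H; rewrite mulf_eq0 subr_eq0 eqr_nat; case/orP => [/eqP //|].
  by rewrite mulf_eq0 invr_eq0 (negPf M0) orbF mulf_eq0 pnatr_eq0 /= gt_eqF // pi_gt0.
have xM : x ^+ M = 1.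
  have omM : om ^+ M = 1 by rewrite omE mulrC divfK // expi_2pi.
  by rewrite /x exprMn exprVn -!exprM !(mulnC _ M) !exprM omM !expr1n invr1 mulr1.
have := subrX1 x M; rewrite xM subrr => /esym/eqP.
by rewrite mulf_eq0 subr_eq0 (negPf x1) /= => /eqP.
Qed.

(* Cauchy's estimate for polynomials, by averaging over roots of unity. *)
Lemma cauchy_poly p (r B : R) n : 0 < r ->
  (forall z, cabs z <= r -> cabs p.[z] <= B) -> cabs p`_n * r ^+ n <= B.
Proof.
move=> r0 HB; have B0 : 0 <= B.
  by apply: le_trans (cabs_ge0 _) (HB 0 _); rewrite cabs0 ltW.
have [pn|pn] := ltnP n (size p); last by rewrite nth_default // cabs0 mul0r.
pose M := size p; pose om := expi (2 * pi / M%:R) : R[i].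
have M0 : (0 < M)%N by apply: leq_ltn_trans pn.
have E : \sum_(j < M) p.[(r%:C)%C * om ^+ j] * (om ^- n) ^+ j = M%:R * (p`_n * (r%:C)%C ^+ n).
  under eq_bigr do rewrite horner_coef mulr_suml.
  rewrite exchange_big /=.
  rewrite (eq_bigr (fun k : 'I_M => p`_k * (r%:C)%C ^+ k * (if k == n :> nat then M%:R else 0))).
    rewrite (bigD1 (Ordinal pn)) //= eqxx big1 ?addr0; first by rewrite mulrC.
    by move=> k; rewrite -val_eqE /= => /negPf ->; rewrite mulr0.
  move=> k _; rewrite -(roots_unity_sum (ltn_ord k) pn) mulr_sumr.
  have alg (a x y u : R[i]) (i l : nat) :
      a * (x * u ^+ i) ^+ l * y ^+ i = a * x ^+ l * (u ^+ l * y) ^+ i.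
    by rewrite !exprMn -!exprM mulnC !mulrA.
  by apply: eq_bigr => j _; exact: alg.
have cM : 0 < (M%:R : R) by rewrite ltr0n.
rewrite -(ler_pM2l cM).
have -> : M%:R * (cabs p`_n * r ^+ n) = cabs (M%:R * (p`_n * (r%:C)%C ^+ n)).
  rewrite !cabsM cabsX cabs_real (ger0_norm (ltW r0)); congr (_ * _).
  by rewrite -(rmorph_nat (real_complex R)) /= cabs_real ger0_norm ?ler0n.
rewrite -E; apply: le_trans (cabs_sum _ _ _) _.
rewrite -[M in M%:R * B]card_ord mulr_natl -sumr_const.
have com : cabs om = 1 by exact: cabs_expi.
apply: ler_sum => j _; rewrite cabsM cabsX cabsV cabsX com !expr1n invr1 expr1n mulr1.
by apply: HB; rewrite cabsM cabsX com expr1n mulr1 cabs_real (ger0_norm (ltW r0)).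
Qed.

(** Bounds what is left of the numerator in [inv_poly_approx] after each geometric series is cut at
    [L]; the product tends to 1 as [L] grows. *)
Lemma prod_geometric_le2 (s : seq R) : {in s, forall b, 0 <= b < 1} ->
  forall n : nat, exists2 L, (n <= L)%N & \prod_(b <- s) (1 + b ^+ L.+1) <= 2.
Proof.
move=> Hs n.
have cv : (fun L => \prod_(b <- s) (1 + b ^+ L.+1)) @ \oo --> (1 : R).
  elim: s Hs => [|b s IH] Hs.
    rewrite (_ : (fun L => _) = fun=> 1); first exact: cvg_cst.
    by apply/funext => L; rewrite big_nil.
  have /andP[b0 b1] := Hs b (mem_head _ _).
  have h1 : (fun L => b ^+ L.+1) @ \oo --> (0 : R).
    have := @cvg_expr R b; rewrite ger0_norm // => /(_ b1) H.
    by rewrite -(cvg_shiftS (fun L => b ^+ L)) in H.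
  have h0 : (fun _ : nat => 1 : R) @ \oo --> (1 : R) by exact: cvg_cst.
  have h2 : (fun L => 1 + b ^+ L.+1) @ \oo --> (1 + 0 : R) by exact: cvgD.
  have h3 : (fun L => (1 + b ^+ L.+1) * \prod_(j <- s) (1 + j ^+ L.+1)) @ \oo --> ((1 + 0) * 1 : R).
    by apply: cvgM => //; apply: IH => x xs; apply: Hs; rewrite inE xs orbT.
  rewrite addr0 mulr1 in h3.
  rewrite (_ : (fun L => _) = (fun L => (1 + b ^+ L.+1) * \prod_(j <- s) (1 + j ^+ L.+1))) //.
  by apply/funext => L; rewrite big_cons.
have /cvgrPdist_le/(_ 1 ltr01) [k _ Hk] := cv.
exists (maxn n k); first exact: leq_maxl.
have := Hk (maxn n k) (leq_maxr _ _); rewrite /= ler_norml => /andP[]; lra.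
Qed.

(* The inverse of a polynomial without zeros in the disc of radius [r] is, on
   that disc, the limit of polynomials having the coefficients of the formal
   inverse: replace each factor [1/(1-az)] by a geometric sum. *)
Lemma inv_poly_approx p (r m : R) n : 0 < r -> 0 < m -> p`_0 = 1 ->
  (forall z, cabs z <= r -> m <= cabs p.[z]) ->
  exists D, (forall k, (k <= n)%N -> (D * p)`_k = (k == 0)%:R) /\
    forall z, cabs z <= r -> cabs D.[z] <= 2 / m.
Proof.
move=> r0 m0 p0 Hp.
have [rt pE] := closed_field_poly_normal p.
have p00 : p.[0] = 1 by rewrite horner_coef0.
have pn0 : p != 0 by apply: contra_eq_neq p0 => ->; rewrite coef0 eq_sym oner_eq0.
have rtP z : z \in rt -> r < cabs z.
  move=> zrt; rewrite ltNge; apply/negP => zr; have := Hp z zr.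
  suff /eqP -> : p.[z] == 0 by rewrite cabs0 leNgt m0.
  by rewrite pE hornerZ horner_prod (big_rem z) //= hornerXsubC subrr mul0r mulr0.
have rt0 z : z \in rt -> z != 0.
  by move=> /rtP; rewrite -cabs_eq0 => H; rewrite gt_eqF // (lt_trans r0).
have pE2 : p = \prod_(z <- rt) (1 - z^-1 *: 'X).
  have e : \prod_(z <- rt) ('X - z%:P) = (\prod_(z <- rt) - z) *: \prod_(z <- rt) (1 - z^-1 *: 'X).
    rewrite -mul_polyC rmorph_prod -big_split /=; rewrite big_seq [RHS]big_seq.
    apply: eq_bigr => z /rt0 z0; rewrite mul_polyC scalerBr scalerA mulNr divff //.
    by rewrite scaleN1r opprK alg_polyC polyCN addrC.
  rewrite e scalerA in pE; rewrite [LHS]pE.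
  suff -> : lead_coef p * \prod_(z <- rt) - z = 1 by rewrite scale1r.
  have := congr1 (fun f => f.[0]) pE; rewrite p00 hornerZ horner_prod.
  rewrite [X in _ * X](_ : _ = 1) ?mulr1 // big1 // => z _.
  by rewrite hornerD hornerN hornerZ hornerX mulr0 oppr0 hornerC addr0.
pose b z := r / cabs z.
have bs : {in [seq b z | z <- rt], forall x, 0 <= x < 1}.
  move=> _ /mapP[z zrt ->]; have zr := rtP z zrt; have z0 := lt_trans r0 zr.
  by rewrite /b divr_ge0 ?cabs_ge0 ?(ltW r0) //= ltr_pdivrMr // mul1r.
have [L nL HL] := prod_geometric_le2 bs n.
have G z : (1 - z^-1 *: 'X) * \sum_(k < L.+1) (z^-1 *: 'X) ^+ k = 1 - (z^-1 *: 'X) ^+ L.+1 :> {poly R[i]}.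
  by rewrite -[RHS]opprB subrX1 -mulNr opprB.
pose D := \prod_(z <- rt) \sum_(k < L.+1) (z^-1 *: 'X : {poly R[i]}) ^+ k.
have Dp : D * p = \prod_(z <- rt) (1 - (z^-1 *: 'X) ^+ L.+1).
  by rewrite mulrC pE2 /D -big_split; apply: eq_bigr => z _ /=.
exists D; split=> [k kn|z zr].
  rewrite Dp; have kL : (k < L.+1)%N by rewrite ltnS (leq_trans kn).
  elim: rt {pE rtP rt0 pE2 HL D Dp bs} => [|z rt IH]; first by rewrite big_nil coef1.
  rewrite big_cons mulrC mulrBr mulr1 coefB IH exprZn -scalerAr coefZ coefMXn kL.
  by rewrite mulr0 subr0.
have pz0 : 0 < cabs p.[z] by apply: lt_le_trans m0 (Hp z zr).
rewrite ler_pdivlMr // (le_trans (ler_wpM2l (cabs_ge0 _) (Hp z zr))) //.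
rewrite -cabsM -hornerM Dp horner_prod; apply: le_trans HL; rewrite big_map.
have cprod (F : R[i] -> R[i]) : cabs (\prod_(z <- rt) F z) = \prod_(z <- rt) cabs (F z).
  by elim/big_rec2: _ => [|i x y _ <-]; rewrite ?cabs1 ?cabsM.
rewrite cprod big_seq [leRHS]big_seq; apply: ler_prod => t trt; rewrite cabs_ge0 /=.
have -> : (1 - (t^-1 *: 'X) ^+ L.+1).[z] = 1 - (t^-1 * z) ^+ L.+1.
  by rewrite hornerD hornerN horner_exp hornerZ hornerX hornerC.
apply: le_trans (cabsD _ _) _.
rewrite cabs1 cabsN lerD2l cabsX lerXn2r ?nnegrE ?cabs_ge0 //.
  by rewrite divr_ge0 ?cabs_ge0 ?ltW.
by rewrite cabsM cabsV mulrC ler_wpM2r ?invr_ge0 ?cabs_ge0.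
Qed.

End CauchyBound.

(** * Approximation of a function and of its inverse on the unit circle *)

Section CircleApproximation.
Context (R : realType).
Implicit Types (c : nat -> R[i]).

Lemma geometric_sum_le (x : R) n : 0 <= x -> x < 1 -> \sum_(k < n) x ^+ k <= (1 - x)^-1.
Proof.
move=> x0 x1; have d0 : 0 < 1 - x by rewrite subr_gt0.
rewrite -[leRHS]mul1r ler_pdivlMr // mulrC.
have -> : (1 - x) * \sum_(k < n) x ^+ k = 1 - x ^+ n.
  by rewrite -[RHS]opprB subrX1 -mulNr opprB.
by rewrite gerDl oppr_le0 exprn_ge0.
Qed.

Lemma analytic_coef0 (f : R[i] -> R[i]) c s : 0 <= s ->
  (forall z, cabs z <= s -> ccvg_to (series (fun n => c n * z ^+ n)) (f z)) -> f 0 = c 0.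
Proof.
move=> s0 Hf; apply/eqP; rewrite -subr_eq0 -cabs_eq0 eq_le cabs_ge0 andbT.
apply/ler_addgt0Pr => e e0; rewrite add0r.
have c0s : cabs (0 : R[i]) <= s by rewrite cabs0.
have [[//|m] _] := ccvg_toP (Hf _ c0s) e0 1.
rewrite seriesE /psum big_ord_recl expr0 mulr1 big1 ?addr0 // => k _.
by rewrite expr0n mulr0.
Qed.

(** A partial sum with more than [n] terms has the same inverse coefficients up to order [n], and a
    long one is still at least [m / 2] in modulus on the disc. [inv_poly_approx] then gives the
    bound [2 / (m / 2)] and [cauchy_poly] transfers it to the coefficient. *)
Lemma inv_coef_bound (f : R[i] -> R[i]) c (s S r m : R) n : 0 < r -> r < s -> 0 < m ->
  (forall j, \sum_(k < j) cabs (c k) * s ^+ k <= S) ->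
  (forall z, cabs z <= s -> ccvg_to (series (fun n => c n * z ^+ n)) (f z)) ->
  c 0 = 1 -> (forall z, cabs z <= r -> m <= cabs (f z)) ->
  cabs (inv_coef c n) * r ^+ n <= 4 / m.
Proof.
move=> r0 rs m0 HS Hf c0 Hm; have s0 : 0 < s by apply: lt_trans rs.
have q0 : 0 <= r / s by rewrite divr_ge0 ?(ltW r0) ?(ltW s0).
have q1 : `|r / s| < 1 by rewrite ger0_norm // ltr_pdivrMr // mul1r.
have [J nJ HJ] : exists2 J, (n < J)%N & S * (r / s) ^+ J <= m / 2.
  have : (fun K => S * (r / s) ^+ K) @ \oo --> S * 0.
    by apply: cvgMr; exact: cvg_expr.
  rewrite mulr0 => /cvgrPdist_le/(_ (m / 2)); rewrite divr_gt0 // => /(_ isT) [k _ Hk].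
  exists (maxn n.+1 k); first exact: leq_maxl.
  by have := Hk _ (leq_maxr n.+1 k); rewrite /= sub0r normrN; exact: le_trans (ler_norm _).
pose p := \poly_(k < J) c k.
have pz z : p.[z] = psum c J z by rewrite horner_poly.
have p0 : p`_0 = 1 by rewrite coef_poly (leq_ltn_trans _ nJ).
have m20 : 0 < m / 2 by rewrite divr_gt0.
have Hp z : cabs z <= r -> m / 2 <= cabs p.[z].
  move=> zr; rewrite pz.
  have h1 := psum_tail HS Hf J zr r0 (ltW rs).
  have h2 := cabsD (f z - psum c J z) (psum c J z); rewrite subrK in h2.
  have h3 := Hm z zr.
  have -> : m / 2 = m - m / 2 by field.
  rewrite lerBlDl; apply: le_trans h3 (le_trans h2 _); rewrite lerD2r.
  exact: le_trans h1 HJ.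
have [D [D1 D2]] := inv_poly_approx n r0 m20 p0 Hp.
have -> : inv_coef c n = D`_n.
  apply/esym/(inv_coef_uniq c0 (m := n)) => // k kn; rewrite -D1 // coefM.
  apply: eq_bigr => i _; rewrite coef_poly ifT //.
  exact: leq_ltn_trans (leq_subr _ _) (leq_ltn_trans kn nJ).
have -> : 4 / m = 2 / (m / 2) by field; rewrite gt_eqF.
exact: cauchy_poly.
Qed.

(** The product of the two truncations agrees with 1 through degree [K], and each later coefficient
    is at most [D * S * r^-1 ^+ k], which leaves a geometric tail. *)
Lemma psum_inv_le (c : nat -> R[i]) (r S D : R) K z : 1 < r -> c 0 = 1 ->
  (forall j, \sum_(k < j) cabs (c k) * r ^+ k <= S) ->
  (forall n, cabs (inv_coef c n) * r ^+ n <= D) -> cabs z <= 1 ->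
  cabs (psum c K.+1 z * psum (inv_coef c) K.+1 z - 1) <= D * S / (1 - r^-1) * r^-1 ^+ K.
Proof.
move=> r1 c0 HS HD z1; have r0 : 0 < r by lra.
have q0 : 0 <= r^-1 by rewrite invr_ge0 ltW.
have q1 : r^-1 < 1 by rewrite invf_lt1.
have D0 : 0 <= D by apply: le_trans (HD 0); rewrite expr0 mulr1 cabs_ge0.
have S0 : 0 <= S by have := HS 0; rewrite big_ord0.
pose P := \poly_(k < K.+1) c k; pose Q := \poly_(k < K.+1) inv_coef c k.
have -> : psum c K.+1 z * psum (inv_coef c) K.+1 z - 1 = (P * Q - 1).[z].
  by rewrite hornerD hornerM !horner_poly hornerN hornerC.
have small k : (k <= K)%N -> (P * Q - 1)`_k = 0.
  move=> kK; rewrite coefB coef1 mulrC coefM -(inv_coefE c0 k); apply/eqP.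
  rewrite subr_eq0; apply/eqP; apply: eq_bigr => i _.
  have iK : (i < K.+1)%N by exact: (leq_trans (ltn_ord i)).
  have kiK : (k - i < K.+1)%N by exact: leq_ltn_trans (leq_subr _ _) _.
  by rewrite !coef_poly iK kiK.
have rr (j k : nat) : (j <= k)%N -> r ^+ j * r^-1 ^+ k = r^-1 ^+ (k - j).
  move=> jk; rewrite -{1}(subnK jk) exprD mulrCA -exprMn divff ?gt_eqF //.
  by rewrite expr1n mulr1.
have large k : (K < k)%N -> cabs (P * Q - 1)`_k <= D * S * r^-1 ^+ k.
  move=> Kk; rewrite coefB coef1 gtn_eqF ?subr0 ?(leq_ltn_trans _ Kk) // coefM.
  apply: le_trans (cabs_sum _ _ _) _.
  apply: (@le_trans _ _ (\sum_(i < k.+1) (cabs (c i) * r ^+ i) * (D * r^-1 ^+ k))).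
    apply: ler_sum => i _; rewrite cabsM !coef_poly.
    have ik : (i <= k)%N by rewrite -ltnS.
    case: ifP => _; last first.
      by rewrite cabs0 mul0r !mulr_ge0 ?cabs_ge0 ?exprn_ge0 // ltW.
    rewrite -mulrA ler_wpM2l ?cabs_ge0 //.
    have -> : r ^+ i * (D * r^-1 ^+ k) = D * r^-1 ^+ (k - i).
      by rewrite mulrCA rr.
    case: ifP => _; last by rewrite cabs0 mulr_ge0 ?exprn_ge0.
    by rewrite exprVn ler_pdivlMr ?exprn_gt0 ?HD.
  rewrite -mulr_suml mulrCA mulrA; apply: ler_wpM2r; first by rewrite exprn_ge0.
  by apply: ler_wpM2l.
have Ez M : \sum_(k < M) cabs ((P * Q - 1)`_k * z ^+ k) <= D * S / (1 - r^-1) * r^-1 ^+ K.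
  have cz k : cabs ((P * Q - 1)`_k * z ^+ k) <= cabs (P * Q - 1)`_k.
    by rewrite cabsM cabsX ler_piMr ?cabs_ge0 // exprn_ile1 ?cabs_ge0.
  have B0 : 0 <= D * S * r^-1 ^+ K by rewrite !mulr_ge0 ?exprn_ge0.
  have [MK|KM] := leqP M K.
    rewrite big1 => [|k _].
      by rewrite !mulr_ge0 ?exprn_ge0 // invr_ge0 subr_ge0 ltW.
    apply/eqP; rewrite eq_le cabs_ge0 andbT; apply: le_trans (cz k) _.
    by rewrite small ?cabs0 // (leq_trans (ltnW (ltn_ord k))).
  rewrite -(subnKC (ltnW KM)) big_split_ord /= big1 ?add0r => [|k _]; last first.
    apply/eqP; rewrite eq_le cabs_ge0 andbT; apply: le_trans (cz k) _.
    by rewrite small ?cabs0 // ltnW.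
  apply: (@le_trans _ _ (\sum_(k < M - K) D * S * r^-1 ^+ K * r^-1 ^+ k)); last first.
    by rewrite -mulr_sumr [leRHS]mulrAC ler_wpM2l // geometric_sum_le.
  apply: ler_sum => k _; apply: le_trans (cz _) _; rewrite -mulrA -exprD.
  case: (val k) => [|j] /=; last by apply: large; rewrite addnS ltnS leq_addr.
  by rewrite addn0 small // cabs0 !mulr_ge0 ?exprn_ge0.
by rewrite horner_coef; apply: le_trans (cabs_sum _ _ _) _.
Qed.

(** [c] and [d] are the Taylor coefficients of [f] and [1/f]. They are kept real because conjugation
    of the truncated products must amount to a change of sign of the argument. *)
Definition circle_approx (f : R[i] -> R[i]) (c d : nat -> R) (B q : R) :=
  [/\ c 0 = 1, d 0 = 1,
      (forall t, f (expi t) != 0 /\ f (expi (- t)) = conjc (f (expi t))),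
      (forall t, cabs (f (expi t)) <= B /\ cabs (f (expi t))^-1 <= B) &
      (forall K t,
        cabs (f (expi t) - \sum_(k < K.+1) (c k)%:C%C * expi (k%:R * t)) <= B * q ^+ K /\
        cabs ((f (expi t))^-1 - \sum_(k < K.+1) (d k)%:C%C * expi (k%:R * t)) <= B * q ^+ K)].

Lemma analytic_circle_approx (f : R[i] -> R[i]) (c : nat -> R[i]) (s : R) :
  f 0 = 1 -> (forall x : R, f x%:C%C \is Num.real) -> 1 < s ->
  cvgn (series (fun n => cabs (c n) * s ^+ n)) ->
  (forall z, cabs z <= s ->
     ccvg_to (series (fun n => c n * z ^+ n)) (f z) /\ f z != 0) ->
  exists cr dr B q, [/\ 0 < q, q < 1 & circle_approx f cr dr B q].
Proof.
move=> f01 freal s1 cs Hfn.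
have Hf z (zs : cabs z <= s) := (Hfn z zs).1.
have fn0 z (zs : cabs z <= s) := (Hfn z zs).2.
have s0 : 0 < s by lra.
pose S := limn (series (fun n => cabs (c n) * s ^+ n)).
have HS j : \sum_(k < j) cabs (c k) * s ^+ k <= S.
  have <- : series (fun n => cabs (c n) * s ^+ n) j = \sum_(k < j) cabs (c k) * s ^+ k.
    by rewrite /series /= big_mkord.
  apply: nondecreasing_cvgn_le => //; apply: nondecreasing_series => k _ _.
  by rewrite mulr_ge0 ?cabs_ge0 // exprn_ge0 // ltW.
have c0 : c 0 = 1 by rewrite -f01; apply/esym/(analytic_coef0 (ltW s0) Hf).
have cr k : complex.Im (c k) = 0.
  apply: (real_coefs s1 HS Hf) => x; have /complex_realP[y ->] := freal x.
  by [].
(* Strictly below [s], where [analytic_min] bounds [f] away from 0, and strictly above 1, so that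
   the coefficients of the inverse decay on the unit circle. *)
pose r := (1 + s) / 2.
have r1 : 1 < r by rewrite /r; lra.
have rs : r < s by rewrite /r; lra.
have r0 : 0 < r by lra.
have [m m0 Hm] := analytic_min s1 HS Hf fn0 r0 rs.
pose D := 4 / m.
have HD n : cabs (inv_coef c n) * r ^+ n <= D by exact: (inv_coef_bound n r0 rs m0 HS Hf c0 Hm).
pose q := r^-1.
have q0 : 0 < q by rewrite invr_gt0.
have q1 : q < 1 by rewrite invf_lt1.
have S0 : 0 <= S by have := HS 0; rewrite big_ord0.
have D0 : 0 <= D by rewrite divr_ge0 // ltW.
have g0 : 0 <= (1 - q)^-1 by rewrite invr_ge0 subr_ge0 ltW.
have HSr j : \sum_(k < j) cabs (c k) * r ^+ k <= S.
  apply: le_trans (HS j); apply: ler_sum => k _; rewrite ler_wpM2l ?cabs_ge0 //.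
  by rewrite lerXn2r ?nnegrE ?(ltW rs) // ltW.
have E1 t : cabs (expi t : R[i]) <= 1 by rewrite cabs_expi.
have Es t : cabs (expi t : R[i]) <= s by rewrite cabs_expi ltW.
have Er t : cabs (expi t : R[i]) <= r by rewrite cabs_expi ltW.
have dr k : complex.Im (inv_coef c k) = 0.
  elim/ltn_ind: k => k IH.
  have := inv_coefE c0 k; rewrite big_ord_recr /= subnn c0 mulr1.
  move=> /(congr1 (@complex.Im R)); rewrite ImD.
  have -> : complex.Im ((k == 0%N)%:R : R[i]) = 0 by case: (k == 0%N).
  rewrite (_ : complex.Im (\sum_(i < k) _) = 0) ?add0r //.
  elim/big_rec: _ => // i z _ zz; rewrite ImD ImM cr IH // zz; ring.
have ps (b : nat -> R[i]) K t : (forall k, complex.Im (b k) = 0) ->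
    \sum_(k < K.+1) (complex.Re (b k))%:C%C * expi (k%:R * t) = psum b K.+1 (expi t).
  move=> br; apply: eq_bigr => k _; rewrite expi_natM; congr (_ * _).
  by apply: eq_cplx => //=; rewrite br.
pose B1 := S; pose B2 := m^-1 * (D * S * (1 - q)^-1 + S * (D * (1 - q)^-1)).
pose B := 1 + B1 + B2 + S + m^-1.
have mi : 0 < m^-1 by rewrite invr_gt0.
have B20 : 0 <= B2.
  apply: mulr_ge0 (ltW mi) _; apply: addr_ge0; first exact: mulr_ge0 (mulr_ge0 D0 S0) g0.
  exact: mulr_ge0 S0 (mulr_ge0 D0 g0).
have tc K t : cabs (f (expi t) - psum c K.+1 (expi t)) <= S * q ^+ K.
  apply: le_trans (psum_tail HS Hf _ (E1 t) ltr01 (ltW s1)) _.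
  rewrite ler_wpM2l // mul1r exprS.
  apply: (@le_trans _ _ (s^-1 ^+ K)).
    by rewrite ler_piMl ?exprn_ge0 ?invr_ge0 ?(ltW s0) // invf_le1 // ltW.
  by rewrite lerXn2r ?nnegrE ?invr_ge0 ?(ltW s0) ?(ltW r0) // lef_pV2 ?posrE // ltW.
have fV t : cabs (f (expi t))^-1 <= m^-1.
  by rewrite cabsV lef_pV2 ?posrE ?(lt_le_trans m0) ?Hm.
exists (fun k => complex.Re (c k)), (fun k => complex.Re (inv_coef c k)), B, q; split=> //.
split.
- by rewrite c0.
- by have := inv_coefE c0 0; rewrite big_ord1 subn0 c0 mulr1 => ->.
- move=> t; split; first exact: fn0.
  by rewrite expiN (analytic_conj Hf cr).
- move=> t; split; last by apply: le_trans (fV t) _; rewrite /B /B1; lra.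
  have h := tc 0 t; have h2 := cabsD (f (expi t) - psum c 1 (expi t)) (psum c 1 (expi t)).
  rewrite subrK {2}/psum big_ord1 expr0 mulr1 c0 cabs1 in h2.
  by rewrite expr0 mulr1 in h; apply: le_trans h2 _; rewrite /B /B1; lra.
move=> K t; rewrite !ps //; have qK : 0 <= q ^+ K by rewrite exprn_ge0 // ltW.
split; first by apply: le_trans (tc K t) _; rewrite ler_wpM2r // /B /B1; lra.
apply: (@le_trans _ _ (B2 * q ^+ K)); last by rewrite ler_wpM2r // /B /B1; lra.
set z := expi t; set p := psum c K.+1 z; set Q := psum (inv_coef c) K.+1 z.
have fz0 : f z != 0 by exact: (fn0 _ (Es t)).
(* Separates the failure of the truncations to be inverse to each other from the truncation error of
   [f]. *)
have -> : (f z)^-1 - Q = (f z)^-1 * ((1 - p * Q) + (p - f z) * Q).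
  by rewrite mulrDr !mulrBr mulrBl mulr1 mulrBr (mulrA _ (f z)) mulVf // mul1r; ring.
have HQ : cabs Q <= D * (1 - q)^-1.
  apply: le_trans (cabs_sum _ _ _) _.
  apply: (@le_trans _ _ (\sum_(k < K.+1) D * q ^+ k)); last first.
    by rewrite -mulr_sumr ler_wpM2l // geometric_sum_le // ltW.
  apply: ler_sum => k _; rewrite cabsM cabsX cabs_expi expr1n mulr1.
  by rewrite /q exprVn ler_pdivlMr ?exprn_gt0.
have HPQ := psum_inv_le K r1 c0 HSr HD (E1 t).
rewrite cabsM /B2 -mulrA; apply: ler_pM; rewrite ?cabs_ge0 //; first exact: fV.
apply: le_trans (cabsD _ _) _; rewrite [leRHS]mulrDl lerD //.
  by rewrite -cabsN opprB.
rewrite cabsM -cabsN opprB mulrAC; apply: ler_pM; rewrite ?cabs_ge0 //; exact: tc.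
Qed.

End CircleApproximation.

Section UniformApproximation.
Context (R : realType) (T : eqType).

Lemma circle_approx_mono (f : R[i] -> R[i]) c d (B q B' q' : R) :
  B <= B' -> 0 <= q -> q <= q' -> circle_approx f c d B q -> circle_approx f c d B' q'.
Proof.
move=> BB q0 qq [c0 d0 fJ fB fK].
have B0 : 0 <= B by apply: le_trans (fB 0).1; exact: cabs_ge0.
have BK K : B * q ^+ K <= B' * q' ^+ K.
  apply: ler_pM => //; first exact: exprn_ge0.
  by rewrite lerXn2r ?nnegrE // (le_trans q0).
split=> // [t|K t]; first by split; [exact: le_trans (fB t).1 _ | exact: le_trans (fB t).2 _].
by split; [exact: le_trans (fK K t).1 _ | exact: le_trans (fK K t).2 _].
Qed.

Lemma uniform_circle_approx (f : T -> R[i] -> R[i]) (P : pred T) (s : seq T) :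
  (forall a, P a -> exists c d B q, [/\ 0 < q, q < 1 & circle_approx (f a) c d B q]) ->
  exists c d B q, [/\ 1 <= B, 0 < q, q < 1 &
    forall a, a \in s -> P a -> circle_approx (f a) (c a) (d a) B q].
Proof.
move=> H; elim: s => [|a s [c [d [B [q [B1 q0 q1 Hs]]]]]].
  exists (fun _ _ => 0), (fun _ _ => 0), 1, 2^-1; split=> //.
  by rewrite invf_lt1 // ltr1n.
have [Pa|Pa] := boolP (P a); last first.
  exists c, d, B, q; split=> // b; rewrite inE => /orP[/eqP -> |]; last exact: Hs.
  by rewrite (negPf Pa).
have [ca [da [Ba [qa [qa0 qa1 Ha]]]]] := H a Pa.
exists (fun b => if b == a then ca else c b), (fun b => if b == a then da else d b).
exists (Num.max B Ba), (Num.max q qa); split.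
- by rewrite le_max B1.
- by rewrite lt_max q0.
- by rewrite gt_max q1 qa1.
move=> b; rewrite inE; have [-> _ _|ba /= bs Pb] := eqVneq b a.
  by apply: circle_approx_mono Ha; rewrite ?le_max ?lexx ?orbT // ltW.
by apply: circle_approx_mono (Hs _ bs Pb); rewrite ?le_max ?lexx // ltW.
Qed.

(** The constant is chosen before [f], [g] and [t], which makes the later bounds uniform in the
    point and in the degree of truncation. *)
Lemma prod_approx (s : seq T) (P : pred T) (B : R) : 0 <= B ->
  exists2 C, 0 <= C & forall (f g : T -> R[i]) (t : R), 0 <= t -> t <= 1 ->
    (forall a, a \in s -> P a -> cabs (f a) <= B /\ cabs (f a - g a) <= B * t) ->
    cabs (\prod_(a <- s | P a) f a) <= C /\
    cabs (\prod_(a <- s | P a) f a - \prod_(a <- s | P a) g a) <= C * t.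
Proof.
move=> B0; elim: s => [|a s [C C0 H]].
  exists 1 => // f g t t0 t1 _; rewrite !big_nil cabs1 subrr cabs0 mul1r.
  by split.
exists (B * C + 2 * B * C + C) => [|f g t t0 t1 fg]; first by rewrite !addr_ge0 ?mulr_ge0.
have [|Fb Fg] := H f g t t0 t1; first by move=> b bs; apply: fg; rewrite inE bs orbT.
rewrite !big_cons; case: ifP => Pa; last first.
  have CB : 0 <= B * C + 2 * B * C by rewrite !addr_ge0 ?mulr_ge0.
  split; first by apply: le_trans Fb _; rewrite lerDr.
  by apply: le_trans Fg _; rewrite ler_wpM2r // lerDr.
have [fB fgB] := fg a (mem_head _ _) Pa.
set F := \prod_(b <- s | P b) f b in Fb Fg *; set G := \prod_(b <- s | P b) g b in Fg *.
have gB : cabs (g a) <= 2 * B.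
  have -> : g a = f a + - (f a - g a) by ring.
  apply: le_trans (cabsD _ _) _; rewrite cabsN; rewrite mulr2n mulrDl !mul1r lerD //.
  by apply: le_trans fgB _; rewrite ler_piMr.
have h1 : cabs (f a) * cabs F <= B * C by rewrite ler_pM ?cabs_ge0.
have h2 : cabs (f a - g a) * cabs F <= B * t * C by rewrite ler_pM ?cabs_ge0.
have h3 : cabs (g a) * cabs (F - G) <= 2 * B * (C * t) by rewrite ler_pM ?cabs_ge0.
split; first by rewrite cabsM; apply: le_trans h1 _; rewrite -addrA lerDl addr_ge0 ?mulr_ge0.
have -> : f a * F - g a * G = (f a - g a) * F + g a * (F - G) by ring.
apply: le_trans (cabsD _ _) _; rewrite !cabsM; apply: le_trans (lerD h2 h3) _.
have -> : (B * C + 2 * B * C + C) * t = B * t * C + 2 * B * (C * t) + C * t by ring.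
by rewrite lerDl mulr_ge0.
Qed.

End UniformApproximation.

Section MeasurableLimits.
Context (R : realType) (n : nat).
Implicit Types f g : 'rV[R]_n.+1 -> R.

Lemma measR_cvg (g : nat -> 'rV[R]_n.+1 -> R) f :
  (forall k, measR (g k)) -> (forall v, (fun k => g k v) @ \oo --> f v) -> measR f.
Proof.
move=> mg gf.
by apply: (@measurable_fun_cvg _ _ _ _ (fun k x => g k (lebRn_vec x))) => [k|x _];
  [exact: mg | exact: gf].
Qed.

Lemma bmeas_cvg (g : nat -> 'rV[R]_n.+1 -> R) f (B q : R) : 0 <= q -> q < 1 ->
  (forall k, bmeas (g k)) -> (forall k v, `|f v - g k v| <= B * q ^+ k) -> bmeas f.
Proof.
move=> q0 q1 mg H; split.
  apply: (measR_cvg (fun k => (mg k).1)) => v.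
  have z : (fun k => B * q ^+ k) @ \oo --> B * 0.
    by apply: cvgMr; apply: cvg_expr; rewrite ger0_norm.
  rewrite mulr0 in z; apply/cvgrPdist_le => e e0.
  have /cvgrPdist_le/(_ e e0) := z; apply: filterS => k; rewrite sub0r normrN => h.
  exact: le_trans (H k v) (le_trans (ler_norm _) h).
have [_ [M HM]] := mg 0; exists (B + M) => v.
have := H 0 v; rewrite expr0 mulr1 => h.
rewrite -[f v](subrK (g 0 v)); apply: le_trans (ler_normD _ _) _.
by apply: lerD.
Qed.

Lemma bmeas_sqrt f : bmeas f -> bmeas (fun v => Num.sqrt (f v)).
Proof.
move=> [mf [M HM]]; split.
  have mS : measurable_fun setT (@Num.sqrt R).
    exact: continuous_measurable_fun (@sqrt_continuous R).
  exact: (measurableT_comp mS mf).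
exists (Num.sqrt M) => v; rewrite ger0_norm ?sqrtr_ge0 // ler_wsqrtr //.
exact: le_trans (ler_norm _) (HM v).
Qed.

Lemma cbm_real f : bmeas f -> cbm (fun v => (f v)%:C%C).
Proof. by move=> bf; split=> //; exact: bmeas_cst. Qed.

Lemma cbm_cabs (f : 'rV[R]_n.+1 -> R[i]) : cbm f -> cbm (fun v => (cabs (f v))%:C%C).
Proof.
move=> [f1 f2]; apply: cbm_real; apply: bmeas_sqrt.
by under eq_fun do rewrite !expr2; apply: bmeasD; exact: bmeasM.
Qed.

(** Source of the measurability of [Chat] and of its inverse, as uniform limits of trigonometric
    polynomials. *)
Lemma cbm_cvg (g : nat -> 'rV[R]_n.+1 -> R[i]) (f : 'rV[R]_n.+1 -> R[i]) (B q : R) :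
  0 <= q -> q < 1 -> (forall k, cbm (g k)) ->
  (forall k v, cabs (f v - g k v) <= B * q ^+ k) -> cbm f.
Proof.
move=> q0 q1 mg H; split.
  apply: (@bmeas_cvg (fun k v => complex.Re (g k v)) _ B q) => // k; first exact: (mg k).1.
  by move=> v; rewrite -ReN -ReD; apply: le_trans (le_Re_cabs _) (H k v).
apply: (@bmeas_cvg (fun k v => complex.Im (g k v)) _ B q) => // k; first exact: (mg k).2.
by move=> v; rewrite -ImN -ImD; apply: le_trans (le_Im_cabs _) (H k v).
Qed.

End MeasurableLimits.

(** * The product [Chat]: symmetries, bounds and approximation *)

Section ScatteringFactors.
Context (R : realType) (n : nat) (rs : seq 'rV[R]_n.+1) (h : 'rV[R]_n.+1).
Context (Hrs : is_root_system rs) (Hh : {in rs, forall a, dotp h a != 0}).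
Context (chat : 'rV[R]_n.+1 -> R[i] -> R[i]).
Context (Horb : forall a b, R1p rs h a -> R1p rs h b ->
  (exists w, inW rs w /\ b = a *m w) -> chat a = chat b).
Context (cr dr : 'rV[R]_n.+1 -> nat -> R) (B q : R).
Context (B1 : 1 <= B) (q0 : 0 < q) (q1 : q < 1).
Context (HA : forall a, a \in rs -> R1p rs h a -> circle_approx (chat a) (cr a) (dr a) B q).
Notation W := (inW rs).
Notation pos := (pos rs h).
Notation R1p := (R1p rs h).
Notation Chat := (Chat rs h chat).
Implicit Types (a b v : 'rV[R]_n.+1) (w : 'M[R]_n.+1).

Definition tpoly (c : nat -> R) K (t : R) : R[i] := \sum_(k < K.+1) (c k)%:C%C * expi (k%:R * t).

Definition tprod (P : pred 'rV[R]_n.+1) (c : 'rV[R]_n.+1 -> nat -> R) K v : R[i] :=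
  \prod_(a <- rs | P a) tpoly (c a) K (- dotp a v).

Lemma R1p_root a : R1p a -> a \in rs. Proof. by case/andP => /pos_root. Qed.

Lemma circle_approx_R1p a : R1p a -> circle_approx (chat a) (cr a) (dr a) B q.
Proof. by move=> Ra; apply: HA => //; exact: R1p_root. Qed.

Lemma mul_conjc_cabs (z : R[i]) : z * conjc z = (cabs z ^+ 2)%:C%C.
Proof. by apply: eq_cplx; [rewrite cabs_sqr | case: z => x y /=; ring]. Qed.

Lemma Chat_opp v : Chat (- v) = conjc (Chat v).
Proof.
rewrite /Defs.Chat conjc_prod; apply: eq_bigr => a Ra; rewrite dotpNr.
by have [_ _ /(_ (- dotp a v))[_ ->]] := circle_approx_R1p Ra.
Qed.

Lemma Chat_neq0 v : Chat v != 0.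
Proof.
rewrite prodf_seq_neq0; apply/allP => a _; apply/implyP => Ra.
by have [_ _ /(_ (- dotp a v))[]] := circle_approx_R1p Ra.
Qed.

Lemma tprod_conj P c K v : conjc (tprod P c K (- v)) = tprod P c K v.
Proof.
rewrite /tprod conjc_prod; apply: eq_bigr => a Ra; rewrite dotpNr opprK /tpoly conjc_sum.
apply: eq_bigr => k _; rewrite conjcM -expiN mulrN; congr (_ * _).
by apply: eq_cplx => //=; rewrite oppr0.
Qed.

Lemma cbm_tprod P c K : cbm (tprod P c K).
Proof.
apply: cbm_prod => a _; apply: cbm_sum => k _.
have mE : cbm (fun v => expi (k%:R * - dotp a v)).
  apply: eq_cbm (cbm_echar (- (k%:R *: a))) => v.
  by rewrite /echar dotpNl dotpZl mulrN.
exact: (cbmM (cbm_cst _ _) mE).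
Qed.

Lemma Chat_approx : exists2 C, 0 <= C & forall K v,
  [/\ cabs (Chat v) <= C, cabs (Chat v)^-1 <= C,
      cabs (Chat v - tprod R1p cr K v) <= C * q ^+ K &
      cabs ((Chat v)^-1 - tprod R1p dr K v) <= C * q ^+ K].
Proof.
have B0 : 0 <= B by apply: le_trans B1.
have [C C0 HC] := @prod_approx R _ rs R1p B B0; exists C => // K v.
have qK0 : 0 <= q ^+ K by rewrite exprn_ge0 // ltW.
have qK1 : q ^+ K <= 1 by rewrite exprn_ile1 // ltW.
have [|h1 h2] := HC (fun a => chat a (expi (- dotp a v)))
  (fun a => tpoly (cr a) K (- dotp a v)) _ qK0 qK1.
  move=> a ars Ra; have [_ _ _ /(_ (- dotp a v))[? _] /(_ K (- dotp a v))[? _]] := HA ars Ra.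
  by split.
have [|h3 h4] := HC (fun a => (chat a (expi (- dotp a v)))^-1)
  (fun a => tpoly (dr a) K (- dotp a v)) _ qK0 qK1.
  move=> a ars Ra; have [_ _ _ /(_ (- dotp a v))[_ ?] /(_ K (- dotp a v))[_ ?]] := HA ars Ra.
  by split.
have E : (Chat v)^-1 = \prod_(a <- rs | R1p a) (chat a (expi (- dotp a v)))^-1.
  by rewrite /Defs.Chat prodfV.
by split=> //; rewrite E.
Qed.

Lemma cbm_Chat : cbm Chat.
Proof.
have [C _ HC] := Chat_approx.
apply: (cbm_cvg (B := C) (ltW q0) q1 (cbm_tprod R1p cr)) => K v.
by have [] := HC K v.
Qed.

Lemma cbm_Chat_inv : cbm (fun v => (Chat v)^-1).
Proof.
have [C _ HC] := Chat_approx.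
apply: (cbm_cvg (B := C) (ltW q0) q1 (cbm_tprod R1p dr)) => K v.
by have [] := HC K v.
Qed.

(** The squared modulus is [Chat v * Chat (- v)], a product over R_1^+ of a function that becomes
    even on all roots once [chat] is extended to negative roots by [cc]; [even_reindex] then
    applies. *)
Lemma cabs_Chat_mulmx v w : W w -> cabs (Chat (v *m w)) = cabs (Chat v).
Proof.
move=> Ww; pose cc b := if pos b then chat b else chat (- b).
pose G b := cc b (expi (- dotp b v)) * cc b (expi (dotp b v)).
have ccN b : b \in rs -> cc (- b) = cc b.
  by move=> brs; rewrite /cc (posN Hrs Hh) // opprK; case: (pos b).
have GN : {in rs, forall b, G (- b) = G b}.
  by move=> b brs; rewrite /G ccN // !dotpNl opprK mulrC.
have ccw g a : W g -> R1p a -> cc (a *m g) = chat a.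
  move=> Wg Ra; have ars := R1p_root Ra; have agr := inW_root Hrs Wg ars.
  have [SN Sw] := rs_stable Hrs (2^-1).
  have /andP[pa Sa] := Ra; rewrite /cc; case: ifP => pg.
    apply/esym/Horb => //; last by exists g.
    by rewrite /Defs.R1p pg /= (Sw g a Wg).
  apply/esym/Horb => //; first by rewrite /Defs.R1p (posN Hrs Hh) // pg /= SN (Sw g a Wg).
  (* The positive root [- (a *m g)] is still in the orbit of [a], through the reflection in
     [a *m g]. *)
  exists (g *m refl (a *m g)); split; first exact: inW_mul Wg (inW_refl agr).
  by rewrite mulmxA refl_self // (root_neq0 Hrs).
have E g : W g -> Chat (v *m g) * Chat (- (v *m g)) = \prod_(a <- rs | R1p a) G (a *m g^T).
  move=> Wg; rewrite /Defs.Chat -big_split; apply: eq_bigr => a Ra.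
  by rewrite /G (ccw _ _ (inW_tr Wg)) //= dotpNr opprK dotp_mulmxr.
have sq x : cabs (Chat x) ^+ 2 = complex.Re (Chat x * Chat (- x)).
  by rewrite Chat_opp cabs_sqr.
apply/eqP; rewrite -(eqrXn2 (n := 2)) ?cabs_ge0 // !sq; apply/eqP; congr complex.Re.
rewrite E // (even_reindex Hrs Hh _ (inW_tr Ww) (rs_stable Hrs 2^-1) GN).
have := E 1%:M (inW1 _); rewrite mulmx1 => ->; apply: eq_bigr => a _.
by rewrite trmx1 mulmx1.
Qed.

Definition cmod v : R := cabs (Chat v).

Lemma cmod_gt0 v : 0 < cmod v.
Proof. by rewrite lt_def cabs_ge0 cabs_eq0 Chat_neq0. Qed.

Lemma DeltahatE v : Deltahat rs h chat v = ((cmod v)^-1 ^+ 2)%:C%C.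
Proof. by rewrite /Deltahat Chat_opp mul_conjc_cabs exprVn -rmorphV ?unitfE ?expf_neq0 ?gt_eqF ?cmod_gt0. Qed.

Lemma sqrtDeltahatE v : sqrtDeltahat rs h chat v = ((cmod v)^-1)%:C%C.
Proof.
rewrite /sqrtDeltahat DeltahatE rmorphXn /= sqrCK //.
by rewrite lecR invr_ge0 ltW // cmod_gt0.
Qed.

Lemma cbm_cmod : cbm (fun v => (cmod v)%:C%C).
Proof. exact: cbm_cabs cbm_Chat. Qed.

Lemma cbm_cmod_inv : cbm (fun v => ((cmod v)^-1)%:C%C).
Proof. by apply: eq_cbm (cbm_cabs cbm_Chat_inv) => v; rewrite cabsV. Qed.

End ScatteringFactors.

(** * Alternants and the Gram--Schmidt family *)

Section LowerSums.
Context (R : realType) (n : nat) (rs : seq 'rV[R]_n.+1) (h : 'rV[R]_n.+1).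
Implicit Types (a y z v : 'rV[R]_n.+1) (w : 'M[R]_n.+1) (b : R).
Notation posspan := (posspan rs h).

Lemma echarD y z v : echar (y + z) v = echar y v * echar z v.
Proof. by rewrite /echar dotpDl expiD. Qed.

Lemma echar0 v : echar 0 v = 1. Proof. by rewrite /echar dotp0l expi0. Qed.

Lemma echarJ y v : conjc (echar y v) = echar (- y) v.
Proof. by rewrite /echar dotpNl expiN. Qed.

Lemma echar_mulmx y v w : echar y (v *m w) = echar (y *m w^T) v.
Proof. by rewrite /echar dotp_mulmxr. Qed.

Lemma posspan_add_eq0 y z : posspan y -> posspan z -> (y + z == 0) = (y == 0) && (z == 0).
Proof.
move=> py pz; apply/eqP/andP => [yz|[/eqP -> /eqP ->]]; last by rewrite addr0.
have [hy hz] := (posspan_ge0 py, posspan_ge0 pz).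
have := congr1 (dotp h) yz; rewrite dotpDr dotp0r => e.
have ey : dotp h y = 0 by lra.
have ez : dotp h z = 0 by lra.
by rewrite (posspan_eq0 py ey) (posspan_eq0 pz ez) eqxx.
Qed.

(* Trigonometric polynomials [1 + \sum_y c_y e^{-i y}], with [y] running over nonzero
   nonnegative combinations of positive roots; [b] bounds the pairings of the [y]. *)
Definition lowsum b (f : 'rV[R]_n.+1 -> R[i]) := exists L : seq (R[i] * 'rV[R]_n.+1),
  [/\ forall p, p \in L -> posspan p.2,
      forall p a, p \in L -> a \in rs -> `|pairing p.2 a| <= b,
      \sum_(p <- L | p.2 == 0) p.1 = 1 &
      forall v, f v = \sum_(p <- L) p.1 * echar (- p.2) v].

Lemma lowsum1 b : 0 <= b -> lowsum b (fun=> 1).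
Proof.
move=> b0; exists [:: (1, 0)]; split.
- by move=> p; rewrite inE => /eqP -> /=; exact: posspan0.
- by move=> p a; rewrite inE => /eqP -> _ /=; rewrite /pairing dotp0l mulr0 mul0r normr0.
- by rewrite big_cons big_nil eqxx addr0.
- by move=> v; rewrite big_seq1 /= oppr0 echar0 mulr1.
Qed.

Lemma eq_lowsum b f g : f =1 g -> lowsum b f -> lowsum b g.
Proof. by move=> /funext ->. Qed.

Lemma lowsum_le b b' f : b <= b' -> lowsum b f -> lowsum b' f.
Proof.
move=> bb [L [L1 L2 L3 L4]]; exists L; split=> // p a pL ars.
exact: le_trans (L2 p a pL ars) bb.
Qed.

(** The cone of positive roots is pointed, so the exponent 0 arises only from two exponents 0 and
    the constant terms multiply to 1. *)
Lemma lowsumM b b' f g : lowsum b f -> lowsum b' g -> lowsum (b + b') (fun v => f v * g v).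
Proof.
move=> [L [L1 L2 L3 L4]] [L' [L1' L2' L3' L4']].
exists [seq (p.1 * p'.1, p.2 + p'.2) | p <- L, p' <- L']; split.
- by move=> _ /allpairsP[[p p'] /= [pL pL' ->]] /=; apply: posspanD; [exact: L1 | exact: L1'].
- move=> _ a /allpairsP[[p p'] /= [pL pL' ->]] ars /=; rewrite pairingDl.
  by apply: le_trans (ler_normD _ _) _; apply: lerD; [exact: L2 | exact: L2'].
- rewrite big_mkcond big_allpairs_dep -[RHS]mulr1 -{1}L3 -L3' mulr_suml [RHS]big_mkcond.
  apply: eq_big_seq => p pL; rewrite mulr_sumr.
  case: ifP => p0; last first.
    by rewrite big_seq big1 // => p' pL' /=; rewrite posspan_add_eq0 ?p0 //; [exact: L1|exact: L1'].
  rewrite [RHS]big_mkcond; apply: eq_big_seq => p' pL' /=.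
  by rewrite posspan_add_eq0 ?p0 //; [exact: L1|exact: L1'].
- move=> v; rewrite L4 L4' big_allpairs_dep mulr_suml; apply: eq_bigr => p _.
  by rewrite mulr_sumr; apply: eq_bigr => p' _ /=; rewrite opprD echarD; ring.
Qed.

Lemma lowsum_prod b (s : seq 'rV[R]_n.+1) (P : pred 'rV[R]_n.+1) F : 0 <= b ->
  (forall a, P a -> lowsum b (F a)) ->
  lowsum ((size s)%:R * b) (fun v => \prod_(a <- s | P a) F a v).
Proof.
move=> b0 HF; elim: s => [|a s IH].
  by apply: eq_lowsum (lowsum1 _) => [v|]; rewrite ?big_nil ?mul0r.
have e : (size (a :: s))%:R * b = b + (size s)%:R * b by rewrite /= -natr1; ring.
case: (boolP (P a)) => Pa.
  rewrite e; apply: eq_lowsum (lowsumM (HF a Pa) IH) => v.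
  by rewrite big_cons Pa.
apply: (@lowsum_le ((size s)%:R * b)); first by rewrite e lerDr.
by apply: eq_lowsum IH => v; rewrite big_cons (negPf Pa).
Qed.

Lemma lowsum_tpoly a (c : nat -> R) K b : pos rs h a -> c 0 = 1 ->
  (forall a', a' \in rs -> `|pairing a a'| <= b) ->
  lowsum (K%:R * b) (fun v => tpoly c K (- dotp a v)).
Proof.
move=> pa c0 Hb; have a0 : a != 0.
  by apply/eqP => a0; have := pos_gt0 pa; rewrite a0 dotp0r ltxx.
exists [seq ((c k)%:C%C, k%:R *: a) | k <- iota 0 K.+1]; split.
- by move=> _ /mapP[k _ ->]; apply: posspanMn; exact: posspan_root.
- move=> _ a' /mapP[k kK ->] ars /=; rewrite pairingZl normrM normr_nat.
  apply: ler_pM => //; last exact: Hb.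
  by rewrite ler_nat -ltnS; move: kK; rewrite mem_iota.
- rewrite big_map big_mkcond [iota _ _]/= big_cons /= scale0r eqxx c0 big_seq big1 ?addr0 // => k.
  by rewrite mem_iota scaler_eq0 pnatr_eq0 (negPf a0) orbF; case: k.
- move=> v; rewrite big_map /tpoly -(big_mkord xpredT (fun k => (c k)%:C%C * expi (k%:R * - dotp a v))).
  rewrite /index_iota subn0; apply: eq_bigr => k _ /=.
  by rewrite /echar dotpNl dotpZl mulrN.
Qed.

Lemma cbm_lowsum b f : lowsum b f -> cbm f.
Proof.
move=> [L [_ _ _ Lf]].
apply: (@eq_cbm _ _ (fun v => \sum_(p <- L) p.1 * echar (- p.2) v)) => [v|]; first by rewrite Lf.
by apply: cbm_sum => p _; exact: (cbmM (cbm_cst _ _) (cbm_echar _)).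
Qed.

End LowerSums.

(** * Alternating sums and the Weyl denominator *)

Section Alternants.
Context (R : realType) (n : nat) (rs : seq 'rV[R]_n.+1) (h : 'rV[R]_n.+1).
Context (Ws : seq 'M[R]_n.+1).
Context (Hrs : is_root_system rs) (Hh : {in rs, forall a, dotp h a != 0}).
Context (HWu : uniq Ws) (HW : forall w, w \in Ws <-> inW rs w).
Implicit Types (a x y z v la mu nu : 'rV[R]_n.+1) (w u : 'M[R]_n.+1).
Notation W := (inW rs).
Notation pos := (pos rs h).
Notation R0p := (R0p rs h).
Notation dominant := (dominant rs h).
Notation rho := (rho rs h).
Notation delta := (delta rs h).
Notation mfun := (Defs.mfun Ws).

Definition alternant x v : R[i] := \sum_(w <- Ws) (\det w)%:C%C * echar x (v *m w).

Lemma cbm_alternant x : cbm (alternant x).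
Proof.
apply: cbm_sum => w _; exact: (cbmM (cbm_cst _ _) (cbm_mulmx w (cbm_echar x))).
Qed.

Lemma alternant_mul x v u : W u -> alternant (x *m u) v = (\det u)%:C%C * alternant x v.
Proof.
move=> Wu; rewrite /alternant mulr_sumr.
rewrite -(big_Ws_mulr Hrs HWu HW _ (fun w => (\det u)%:C%C * ((\det w)%:C%C * echar x (v *m w))) (inW_tr Wu)).
apply: eq_bigr => w _; rewrite det_mulmx det_tr rmorphM /= echar_mulmx (echar_mulmx x).
rewrite trmx_mul trmxK mulmxA; set E := echar _ _.
have dd : (\det u)%:C%C * (\det u)%:C%C = 1 :> R[i] by rewrite -rmorphM /= -expr2 (det_sqr Hrs Wu).
by rewrite -[LHS]mul1r -dd; ring.
Qed.

Lemma alternant_singular x a v : a \in rs -> dotp x a = 0 -> alternant x v = 0.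
Proof.
move=> ars xa; have := alternant_mul x v (inW_refl ars).
rewrite reflE /pairing xa mulr0 mul0r scale0r subr0 det_refl ?(root_neq0 Hrs) //.
rewrite rmorphN1 mulN1r => /eqP; rewrite -subr_eq0 opprK -mulr2n mulrn_eq0 /=.
by move/eqP.
Qed.

(** For [b] in R_0^+, [rho - rho *m refl b] is [pairing rho b *: b], and by [rho_sub] it is also a
    sum of positive roots in which [b] occurs. The product with [h] shows that the pairing is
    positive. *)
Lemma rho_gt0 a : pos a -> 0 < dotp rho a.
Proof.
have R0 b : R0p b -> 0 < dotp rho b.
  move=> Rb; have pb := R0p_pos Rb; have brs := pos_root pb; have b0 := root_neq0 Hrs brs.
  have := rho_sub Hrs Hh (inW_refl brs); rewrite reflE opprB addrC subrK => /(congr1 (dotp h)).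
  rewrite dotpZr dotp_sumr big_mkcond (bigD1_seq b) //=; last by case: Hrs.
  rewrite refl_self // (posN Hrs Hh) // pb Rb opprK /= => e.
  have : 0 < pairing rho b * dotp h b.
    rewrite e ltr_wpDr ?(pos_gt0 pb) // big_seq_cond sumr_ge0 // => c /andP[crs cb].
    case: ifP => // /andP[_ cn]; have := refl_root Hrs brs crs => r.
    have pr : pos (- (c *m refl b)) by rewrite (posN Hrs Hh).
    exact: ltW (pos_gt0 pr).
  by rewrite pmulr_lgt0 ?(pos_gt0 pb) // pairing_gt0.
move=> pa; have [|/R0] := R0p_cover Hrs Hh pa; first exact: R0.
by rewrite dotpZr pmulr_rgt0.
Qed.

Context (Hu : forall x w, dominant x -> W w -> dominant (x *m w) -> x *m w = x).

Lemma rho_dominant_gt0 nu a : dominant nu -> pos a -> 0 < dotp (rho + nu) a.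
Proof.
move=> /dominantP[_ dn] pa; rewrite dotpDl ltr_wpDr ?rho_gt0 //.
by rewrite -pairing_ge0 ?dn // (root_neq0 Hrs) // (pos_root pa).
Qed.

Lemma rho_dominant_fix nu nu' w : dominant nu -> dominant nu' -> W w ->
  (rho + nu) *m w = rho + nu' -> w = 1%:M.
Proof.
move=> dn dn' Ww e; apply: (pos_fix_id Hrs Hh Hu Ww) => a pa.
have ars := pos_root pa; have awr := inW_root Hrs Ww ars.
apply/negPn/negP; rewrite -(posN Hrs Hh) // => /(rho_dominant_gt0 dn').
rewrite -e -mulNmx (inW_dotp Hrs _ _ Ww) dotpNr oppr_gt0 ltNge.
by rewrite (ltW (rho_dominant_gt0 dn pa)).
Qed.

Lemma delta_mul v w : W w -> delta (v *m w) = (\det w)%:C%C * delta v.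
Proof.
move=> Ww; have := @odd_prod _ _ _ _ Hrs Hh _ (real_complex R)
  (fun a => expi (dotp a v / 2%:R) - expi (- (dotp a v / 2%:R))) _ (inW_tr Ww).
rewrite det_tr => <-; last by move=> a _; rewrite dotpNl mulNr opprK opprB.
by apply: eq_bigr => a _; rewrite dotp_mulmxr.
Qed.

Lemma mfun_mul nu v w : W w -> mfun nu (v *m w) = mfun nu v.
Proof.
move=> Ww; congr (_ * _).
rewrite -[RHS](big_Ws_mull Hrs HWu HW _ (fun u => expi (dotp nu (v *m u))) Ww).
by apply: eq_bigr => u _; rewrite mulmxA.
Qed.

Lemma cbm_mfun nu : cbm (mfun nu).
Proof.
apply: (cbmM (cbm_cst _ _)); apply: cbm_sum => w _; exact: (cbm_mulmx w (cbm_echar nu)).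
Qed.

Lemma stab_gt0 nu : (0 < count (fun w => nu *m w == nu) Ws)%N.
Proof.
rewrite -has_count; apply/hasP; exists 1%:M; first by apply/HW; exact: inW1.
by rewrite mulmx1.
Qed.

Lemma cbm_delta : cbm delta.
Proof.
apply: cbm_prod => a _.
apply: (@eq_cbm _ _ (fun v => echar (2^-1 *: a) v + - echar (- (2^-1 *: a)) v)) => [v|].
  by rewrite /echar dotpNl dotpZl mulrC.
exact: cbmD (cbm_echar _) (cbmN (cbm_echar _)).
Qed.

Lemma root_pairing_bound : exists2 b : R, 0 <= b &
  forall a a', a \in rs -> a' \in rs -> `|pairing a a'| <= b.
Proof.
pose b := \sum_(a <- rs) \sum_(a' <- rs) `|pairing a a'|.
exists b; first by apply: sumr_ge0 => a _; apply: sumr_ge0 => a' _; exact: normr_ge0.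
move=> a a' ar ar'; have [us _ _ _ _] := Hrs.
rewrite /b (bigD1_seq a) // (bigD1_seq a') //= -addrA lerDl addr_ge0 //.
  by apply: sumr_ge0 => ? _; exact: normr_ge0.
by apply: sumr_ge0 => ? _; apply: sumr_ge0 => ? _; exact: normr_ge0.
Qed.

(** Taking [echar rho] out of [delta] leaves the product of the factors [1 - echar (- a)], each a
    [tpoly] of degree 1 with coefficients 1 and -1. *)
Lemma delta_lowsum : exists b, lowsum rs h b (fun v => delta v * echar (- rho) v).
Proof.
have [b b0 Hb] := root_pairing_bound.
exists ((size rs)%:R * b).
pose c (k : nat) : R := if k == 0%N then 1 else -1.
have F a : R0p a -> lowsum rs h b (fun v => tpoly c 1 (- dotp a v)).
  move=> Ra; have pa := R0p_pos Ra.
  rewrite -[b]mul1r; apply: (@lowsum_tpoly _ _ _ _ a c 1 b) => // a' ar'.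
  by apply: Hb => //; exact: pos_root pa.
apply: eq_lowsum (lowsum_prod rs b0 F) => v.
have -> : echar (- rho) v = \prod_(a <- rs | R0p a) echar (- (2^-1 *: a)) v.
  rewrite /Defs.rho scaler_sumr -sumrN.
  by elim/big_rec2: _ => [|a y z _ <-]; rewrite ?echar0 // echarD.
rewrite -big_split; apply: eq_bigr => a _ /=.
rewrite /tpoly big_ord_recl big_ord1 /c /= mul0r expi0 mulr1 mul1r.
rewrite /echar dotpNl dotpZl (mulrC 2^-1) mulrBl; congr (_ + _).
  by rewrite [RHS]mulrC expiNM.
rewrite rmorphN1 mulN1r -expiD; congr (- expi _); by field.
Qed.

Lemma delta_dexp : exists2 L : seq (R[i] * 'rV[R]_n.+1),
  (forall p, p \in L -> dexp rs h p.2) &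
  forall v, delta v = \sum_(p <- L) p.1 * echar p.2 v.
Proof.
have [us _ _ _ _] := Hrs.
suff H s : uniq s -> exists2 L : seq (R[i] * 'rV[R]_n.+1),
    (forall p, p \in L -> exists e : 'rV[R]_n.+1 -> bool,
       p.2 = 2^-1 *: \sum_(a <- s | R0p a) (-1) ^+ e a *: a) &
    forall v, \prod_(a <- s | R0p a)
     (expi (dotp a v / 2%:R) - expi (- (dotp a v / 2%:R))) = \sum_(p <- L) p.1 * echar p.2 v.
  exact: H us.
elim: s => [_|a s IH /= /andP[nas /IH[L L1 L2]]].
  exists [:: (1, 0)] => [p|v]; last by rewrite big_nil big_seq1 /= echar0 mulr1.
  by rewrite inE => /eqP ->; exists (fun=> false); rewrite big_nil scaler0.
have [Ra|Ra] := boolP (R0p a); last first.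
  exists L => [p /L1[e ->]|v]; first by exists e; rewrite big_cons (negPf Ra).
  by rewrite big_cons (negPf Ra) L2.
exists ([seq (p.1, 2^-1 *: a + p.2) | p <- L] ++ [seq (- p.1, - (2^-1 *: a) + p.2) | p <- L]).
  have ext (c : bool) p : p \in L -> exists e : 'rV[R]_n.+1 -> bool,
      (-1) ^+ c *: (2^-1 *: a) + p.2 = 2^-1 *: \sum_(x <- a :: s | R0p x) (-1) ^+ e x *: x.
    move=> /L1[e ->]; exists (fun x => if x == a then c else e x).
    rewrite big_cons Ra eqxx scalerDr; congr (_ + _); first by rewrite !scalerA mulrC.
    congr (_ *: _); rewrite [LHS]big_seq_cond [RHS]big_seq_cond; apply: eq_bigr => x /andP[xs _].
    by case: eqP => // xa; rewrite -xa xs in nas.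
  move=> p; rewrite mem_cat => /orP[] /mapP[p' /ext H ->] /=.
    by have := H false; rewrite expr0 scale1r.
  by have := H true; rewrite expr1 scaleN1r.
move=> v; rewrite big_cons Ra L2 big_cat !big_map /= mulrBl !mulr_sumr -sumrN.
congr (_ + _); apply: eq_bigr => p _ /=; rewrite echarD /echar ?dotpNl dotpZl [2^-1 * _]mulrC; ring.
Qed.

End Alternants.

(** * Constant terms and the expansion of [delta * mfun] in alternants *)

Section AlternantMeans.
Context (R : realType) (n : nat) (rs : seq 'rV[R]_n.+1) (h : 'rV[R]_n.+1).
Context (Ws : seq 'M[R]_n.+1).
Context (Hrs : is_root_system rs) (Hh : {in rs, forall a, dotp h a != 0}).
Context (HWu : uniq Ws) (HW : forall w, w \in Ws <-> inW rs w).
Context (vol0 : volA rs h != 0).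
Notation W := (inW rs).
Notation weight := (weight rs).
Notation dominant := (dominant rs h).
Notation rho := (rho rs h).
Notation posspan := (posspan rs h).
Notation delta := (delta rs h).
Notation mfun := (Defs.mfun Ws).
Notation Mc := (Mc rs h Ws).
Notation alternant := (alternant Ws).
Context (Hu : forall x w, dominant x -> W w -> dominant (x *m w) -> x *m w = x).
Implicit Types (a x y z v la mu nu : 'rV[R]_n.+1) (w u : 'M[R]_n.+1).

Lemma Mc_esum (I : eqType) (s : seq I) (c : I -> R[i]) (y : I -> 'rV[R]_n.+1) :
  (forall i, i \in s -> weight (y i)) ->
  Mc (fun v => \sum_(i <- s) c i * echar (y i) v) = \sum_(i <- s) c i * (y i == 0)%:R.
Proof.
move=> wy; pose F i v := c i * echar (y i) v.
have cF i : cbm (F i) by exact: (cbmM (cbm_cst _ _) (cbm_echar _)).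
rewrite -/(Mc (fun v => \sum_(i <- s) F i v)) (@Mc_sum _ _ rs h Ws vol0 _ s xpredT F) //.
apply: eq_big_seq => i si.
by rewrite /F (McZ Ws vol0 (c i) (cbm_echar _)) (Mc_echar Hrs Hh HWu HW vol0 (wy i si)).
Qed.

Lemma Mc_esum2 (I J : eqType) (s : seq I) (t : seq J) (c : I -> J -> R[i])
    (y : I -> J -> 'rV[R]_n.+1) :
  (forall i j, i \in s -> j \in t -> weight (y i j)) ->
  Mc (fun v => \sum_(i <- s) \sum_(j <- t) c i j * echar (y i j) v) =
  \sum_(i <- s) \sum_(j <- t) c i j * (y i j == 0)%:R.
Proof.
move=> wy; pose F i v := \sum_(j <- t) c i j * echar (y i j) v.
have cF i : cbm (F i).
  by apply: cbm_sum => j _; exact: (cbmM (cbm_cst _ _) (cbm_echar _)).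
rewrite -/(Mc (fun v => \sum_(i <- s) F i v)) (@Mc_sum _ _ rs h Ws vol0 _ s xpredT F) //.
by apply: eq_big_seq => i si; rewrite /F Mc_esum // => j tj; exact: wy.
Qed.

Lemma mem_Ws w : w \in Ws -> W w. Proof. by move/HW. Qed.

Lemma stab_count mu : \sum_(w <- Ws) (mu *m w^T == mu)%:R =
  (count (fun w => mu *m w == mu) Ws)%:R :> R[i].
Proof.
rewrite (big_Ws_tr HWu HW _ (fun w => (mu *m w == mu)%:R)) -natr_sum; congr _%:R.
by rewrite -sum1_count [RHS]big_mkcond; apply: eq_bigr => w _; case: eqP.
Qed.

(** A constant term requires [mu - la = p.2 + (mu - mu *m w^T)], with both summands in the cone. So
    [mu] lies above [la], hence equals it; then both summands vanish, and the stabiliser of [mu]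
    cancels the normalisation of [mfun]. *)
Lemma Mc_lowsum_mfun b f mu la : lowsum rs h b f -> dominant mu -> dominant la ->
  (posspan (mu - la) -> mu = la) ->
  Mc (fun v => f v * (mfun mu v * echar (- la) v)) = (mu == la)%:R.
Proof.
move=> [L [L1 _ L3 L4]] dm dl Hml.
have [[wm _] [wl _]] := (dominantP _ _ _ dm, dominantP _ _ _ dl).
pose k : R[i] := (count (fun w => mu *m w == mu) Ws)%:R^-1.
have -> : (fun v => f v * (mfun mu v * echar (- la) v)) =
    fun v => \sum_(p <- L) \sum_(w <- Ws) (p.1 * k) * echar (- p.2 + mu *m w^T - la) v.
  apply/funext => v; rewrite L4 mulr_suml; apply: eq_bigr => p _.
  rewrite /Defs.mfun -/k -!mulrA mulr_suml !mulr_sumr; apply: eq_bigr => w _.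
  by rewrite !echarD -[expi _]/(echar mu (v *m w)) echar_mulmx; ring.
rewrite Mc_esum2 => [|p w pL /mem_Ws Ww]; last first.
  apply: weightB => //; apply: weightD; last exact: (weight_mul Hrs (inW_tr Ww)).
  exact: weightN (weight_posspan Hrs (L1 p pL)).
transitivity (\sum_(p <- L) \sum_(w <- Ws) (p.1 * (p.2 == 0)%:R) *
    (k * (mu == la)%:R * (mu *m w^T == mu)%:R)).
  apply: eq_big_seq => p pL; apply: eq_big_seq => w /mem_Ws Ww.
  rewrite -!mulrA; congr (_ * _); rewrite mulrCA; congr (_ * _).
  rewrite -!natrM !mulnb; congr (nat_of_bool _)%:R.
  apply/eqP/and3P => [e|[/eqP -> /eqP -> /eqP ->]]; last by rewrite oppr0 add0r subrr.
  have pm := dominant_max Hrs HW Hu dm (inW_tr Ww).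
  have e1 : mu - la = p.2 + (mu - mu *m w^T).
    by move/eqP: e; rewrite subr_eq0 => /eqP <-; rewrite opprD opprK addrCA.
  have ml : mu = la by apply: Hml; rewrite e1; apply: posspanD => //; exact: L1.
  have /eqP : p.2 + (mu - mu *m w^T) = 0 by rewrite -e1 ml subrr.
  rewrite (posspan_add_eq0 (L1 p pL) pm) => /andP[p0 m0].
  by split=> //; [exact/eqP | rewrite eq_sym -subr_eq0].
rewrite -big_distrlr /= -mulr_sumr stab_count mulrAC.
have -> : \sum_(p <- L) p.1 * (p.2 == 0)%:R = 1.
  rewrite -[RHS]L3 [RHS]big_mkcond; apply: eq_bigr => p _.
  by case: eqP; rewrite ?mulr1 ?mulr0.
rewrite mul1r mulVf ?mul1r // pnatr_eq0 -lt0n.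
exact: (stab_gt0 HW).
Qed.

(** Only [w = 1] can produce a zero exponent, by [rho_dominant_fix]. *)
Lemma Mc_alternant nu nu' : dominant nu -> dominant nu' ->
  Mc (fun v => alternant (rho + nu) v * echar (- (rho + nu')) v) = (nu == nu')%:R.
Proof.
move=> dn dn'; have [[wn _] [wn' _]] := (dominantP _ _ _ dn, dominantP _ _ _ dn').
have -> : (fun v => alternant (rho + nu) v * echar (- (rho + nu')) v) =
    fun v => \sum_(w <- Ws) (\det w)%:C%C * echar ((rho + nu) *m w^T - (rho + nu')) v.
  apply/funext => v; rewrite mulr_suml; apply: eq_bigr => w _.
  by rewrite [in RHS]echarD echar_mulmx mulrA.
rewrite Mc_esum => [|w /mem_Ws Ww]; last first.
  have -> : (rho + nu) *m w^T - (rho + nu') = - (rho - rho *m w^T) + (nu *m w^T - nu').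
    by rewrite mulmxDl opprB opprD addrACA.
  apply: weightD; last by apply: weightB => //; exact: (weight_mul Hrs (inW_tr Ww)).
  exact: weightN (weight_posspan Hrs (rho_sub_posspan Hrs Hh (inW_tr Ww))).
have W1 : 1%:M \in Ws by apply/HW; exact: inW1.
rewrite (bigD1_seq 1%:M) //= trmx1 mulmx1 det1 mul1r big_seq_cond big1 => [|w /andP[/mem_Ws Ww w1]].
  by rewrite addr0 opprD addrACA subrr add0r subr_eq0.
case: eqP => [/eqP|]; last by rewrite mulr0.
rewrite subr_eq0 => /eqP /(rho_dominant_fix Hrs Hh Hu dn dn' (inW_tr Ww)) /(congr1 trmx).
by rewrite trmxK trmx1 => e; rewrite e eqxx in w1.
Qed.

(** An exponent on a mirror gives the zero alternant. Any other is moved into the open chamber,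
    where subtracting [rho] leaves a dominant weight; it lies below [nu] because [rho] dominates the
    [dexp] part and [nu] its own orbit. *)
Lemma alternant_dexp nu y w : dominant nu -> dexp rs h y -> W w ->
  exists c nu', [/\ dominant nu', posspan (nu - nu') &
    forall v, alternant (y + nu *m w) v = c * alternant (rho + nu') v].
Proof.
move=> dn dy Ww; have [wn _] := dominantP _ _ _ dn; set x := y + nu *m w.
case: (boolP (has (fun a => dotp x a == 0) rs)) => [/hasP[a ars /eqP xa]|].
  exists 0, nu; split=> //; first by rewrite subrr; exact: posspan0.
  by move=> v; rewrite mul0r; exact: (alternant_singular Hrs HWu HW v ars xa).
rewrite -all_predC => /allP xr.
have [u Wu pu] := regular_orbit h Hrs HW xr.
have e : nu - (x *m u - rho) = (rho - y *m u) + (nu - nu *m (w *m u)).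
  by rewrite /x mulmxDl mulmxA opprB opprD addrCA [RHS]addrACA addrA.
have ps : posspan (nu - (x *m u - rho)).
  rewrite e; apply: posspanD; first exact: dexp_posspan (dexp_mul Hrs Hh Wu dy).
  exact: (dominant_max Hrs HW Hu dn (inW_mul Ww Wu)).
exists ((\det u)%:C%C), (x *m u - rho); split=> // [|v].
  apply: (dominant_of_regular Hrs Hh) => [|a pa]; last by rewrite subrK; exact: pu.
  have -> : x *m u - rho = nu - (nu - (x *m u - rho)) by rewrite [in RHS]opprB [RHS]addrC subrK.
  by apply: weightB => //; exact: (weight_posspan Hrs ps).
rewrite addrC subrK (alternant_mul Hrs HWu HW) // mulrA -rmorphM /= -expr2 (det_sqr Hrs Wu).
by rewrite mul1r.
Qed.

(* The Weyl character property, from antisymmetrizing both factors. *)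
Lemma delta_mfun nu : dominant nu -> exists s : seq (R[i] * 'rV[R]_n.+1),
  (forall p, p \in s -> [/\ dominant p.2, posspan (nu - p.2) & p.2 != nu]) /\
  forall v, delta v * mfun nu v = alternant (rho + nu) v + \sum_(p <- s) p.1 * alternant (rho + p.2) v.
Proof.
move=> dn; have [L L1 L2] := delta_dexp h Hrs.
pose k : R[i] := (count (fun w => nu *m w == nu) Ws)%:R^-1.
pose N : R[i] := (size Ws)%:R.
have N0 : N != 0 by rewrite pnatr_eq0 -lt0n (sizeWs_gt0 HW).
have E v : delta v * mfun nu v =
    \sum_(p <- L) \sum_(w <- Ws) (N^-1 * p.1 * k) * alternant (p.2 + nu *m w^T) v.
  have step u : W u -> delta v * mfun nu v = (\det u)%:C%C * (delta (v *m u) * mfun nu (v *m u)).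
    move=> Wu; rewrite (mfun_mul Hrs HWu HW) // (delta_mul Hrs Hh) // !mulrA -rmorphM /= -expr2.
    by rewrite (det_sqr Hrs Wu) mul1r.
  have -> : delta v * mfun nu v =
      N^-1 * \sum_(u <- Ws) (\det u)%:C%C * (delta (v *m u) * mfun nu (v *m u)).
    have -> : \sum_(u <- Ws) (\det u)%:C%C * (delta (v *m u) * mfun nu (v *m u)) =
        \sum_(u <- Ws) delta v * mfun nu v by apply: eq_big_seq => u /mem_Ws /step <-.
    by rewrite big_const_seq count_predT iter_addr_0 -[X in N^-1 * X]mulr_natl (mulrA N^-1) mulVf // mul1r.
  transitivity (\sum_(u <- Ws) \sum_(p <- L) \sum_(w <- Ws)
      (N^-1 * p.1 * k) * ((\det u)%:C%C * echar (p.2 + nu *m w^T) (v *m u))).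
    rewrite mulr_sumr; apply: eq_bigr => u _; rewrite L2 mulr_suml !mulr_sumr.
    apply: eq_bigr => p _; rewrite /Defs.mfun -/k !mulr_sumr; apply: eq_bigr => w _.
    by rewrite echarD -[expi _]/(echar nu (v *m u *m w)) (echar_mulmx nu); ring.
  rewrite exchange_big; apply: eq_bigr => p _; rewrite exchange_big; apply: eq_bigr => w _.
  by rewrite /alternant mulr_sumr.
have [s0 [s01 s02]] : exists s : seq (R[i] * 'rV[R]_n.+1),
    (forall p, p \in s -> dominant p.2 /\ posspan (nu - p.2)) /\
    forall v, delta v * mfun nu v = \sum_(p <- s) p.1 * alternant (rho + p.2) v.
  suff H (s : seq (R[i] * 'rV[R]_n.+1)) : (forall p, p \in s -> exists y w,
        [/\ dexp rs h y, W w & p.2 = y + nu *m w]) ->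
      exists s' : seq (R[i] * 'rV[R]_n.+1),
      (forall p, p \in s' -> dominant p.2 /\ posspan (nu - p.2)) /\
      forall v, \sum_(p <- s) p.1 * alternant p.2 v = \sum_(p <- s') p.1 * alternant (rho + p.2) v.
    have [|s [s1 s2]] := H [seq (N^-1 * p.1 * k, p.2 + nu *m w^T) | p <- L, w <- Ws].
      move=> _ /allpairsP[[p w] /= [pL /mem_Ws Ww ->]]; exists p.2, w^T.
      by split=> //; [exact: L1 | exact: inW_tr].
    by exists s; split=> // v; rewrite -s2 E big_allpairs_dep.
  elim: s => [|p s IH] Hs; first by exists [::]; split=> // v; rewrite !big_nil.
  have [|s' [s1 s2]] := IH; first by move=> p' ps; apply: Hs; rewrite inE ps orbT.
  have [y [w [dy Ww pe]]] := Hs p (mem_head _ _).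
  have [c [nu' [d1 d2 d3]]] := alternant_dexp dn dy Ww.
  exists ((p.1 * c, nu') :: s'); split=> [p'|v]; first by rewrite inE => /orP[/eqP -> //|]; exact: s1.
  by rewrite !big_cons s2 pe d3 mulrA.
(* Instead of tracking the leading coefficient through the expansion, it is read off as a constant
   term computed in two ways, by [Mc_lowsum_mfun] and by [Mc_alternant]. *)
have C1 : \sum_(p <- s0) p.1 * (p.2 == nu)%:R = 1.
  have [b lb] := delta_lowsum h Hrs.
  have M1 := Mc_lowsum_mfun lb dn dn (fun=> erefl); rewrite eqxx mulr1n in M1; rewrite -[RHS]M1.
  have -> : (fun v => delta v * echar (- rho) v * (mfun nu v * echar (- nu) v)) =
      fun v => \sum_(p <- s0) p.1 * (alternant (rho + p.2) v * echar (- (rho + nu)) v).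
    apply/funext => v; rewrite mulrACA s02 -echarD -opprD mulr_suml.
    by apply: eq_bigr => p _; rewrite mulrA.
  pose F (p : R[i] * 'rV[R]_n.+1) v := p.1 * (alternant (rho + p.2) v * echar (- (rho + nu)) v).
  have cF (p : R[i] * 'rV[R]_n.+1) : cbm (fun v => alternant (rho + p.2) v * echar (- (rho + nu)) v).
    exact: (cbmM (cbm_alternant _ _) (cbm_echar _)).
  rewrite -/(Mc (fun v => \sum_(p <- s0) F p v)) (@Mc_sum _ _ rs h Ws vol0 _ s0 xpredT F).
    apply: eq_big_seq => p ps; rewrite /F (McZ Ws vol0 p.1 (cF p)).
    have [dp _] := s01 p ps; rewrite Mc_alternant //.
  by move=> p _; exact: (cbmM (cbm_cst _ _) (cF p)).
exists [seq p <- s0 | p.2 != nu]; split=> [p|v].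
  by rewrite mem_filter => /andP[pn /s01[]].
rewrite s02 (bigID (fun p => p.2 == nu)) /= -big_filter big_filter; congr (_ + _).
  rewrite (eq_bigr (fun p => p.1 * alternant (rho + nu) v)) => [|p /eqP -> //].
  rewrite -mulr_suml; have -> : \sum_(p <- s0 | p.2 == nu) p.1 = 1; last by rewrite mul1r.
  rewrite -C1 big_mkcond; apply: eq_bigr => p _.
  by case: eqP; rewrite ?mulr1 ?mulr0.
by rewrite big_filter.
Qed.

End AlternantMeans.

(** * Triangularity of the Gram--Schmidt family *)

Section GramSchmidt.
Context (R : realType) (n : nat) (rs : seq 'rV[R]_n.+1) (h : 'rV[R]_n.+1).
Context (Ws : seq 'M[R]_n.+1).
Context (Hrs : is_root_system rs) (Hh : {in rs, forall a, dotp h a != 0}).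
Context (HWu : uniq Ws) (HW : forall w, w \in Ws <-> inW rs w).
Context (chat : 'rV[R]_n.+1 -> R[i] -> R[i]).
Context (ord : 'rV[R]_n.+1 -> 'rV[R]_n.+1 -> Prop) (P : 'rV[R]_n.+1 -> 'rV[R]_n.+1 -> R[i]).
Context (Hord : admissible_order rs h ord) (HP : gram_schmidt_family rs h Ws chat ord P).
Context (cbmDh : cbm (Deltahat rs h chat)).
Notation W := (inW rs).
Notation dominant := (dominant rs h).
Notation rho := (rho rs h).
Notation delta := (delta rs h).
Notation mfun := (Defs.mfun Ws).
Notation Dh := (Deltahat rs h chat).
Notation ip := (ipD rs h Ws chat).
Notation Lc := (Lc rs h Ws).
Notation alternant := (alternant Ws).
Implicit Types (a x y z v la mu nu : 'rV[R]_n.+1) (w u : 'M[R]_n.+1).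

Lemma dominant0 : dominant 0.
Proof.
apply/dominantP; split; first exact: weight0.
by move=> a _; rewrite /pairing dotp0l mulr0 mul0r.
Qed.

(** Since [0^-1] is 0, a vanishing volume would make every [ipD] zero, against the normalisation of
    [P 0]. *)
Lemma gram_schmidt_volA : volA rs h != 0.
Proof.
apply/eqP => v0; have := HP.2 0 0 dominant0 dominant0.
rewrite /ipD v0 mulr0 invr0 rmorph0 mul0r eqxx => /eqP.
by rewrite eq_sym oner_eq0.
Qed.
Let vol0 := gram_schmidt_volA.

(** Finite lower sets make the order well founded: a list containing the lower set of [mu] still
    contains that of a strictly smaller [nu] after [mu] is removed. *)
Lemma ord_ind (Q : 'rV[R]_n.+1 -> Prop) :
  (forall mu, dominant mu ->
     (forall nu, dominant nu -> ord mu nu -> nu != mu -> Q nu) -> Q mu) ->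
  forall mu, dominant mu -> Q mu.
Proof.
have [r1 r2 r3 _ r5] := Hord; move=> IH.
have H k : forall (s : seq 'rV[R]_n.+1) mu, (size s < k)%N -> dominant mu ->
    (forall m, dominant m -> ord mu m -> m \in s) -> Q mu.
  elim: k => // k IHk s mu sk dm Hs; apply: IH => // nu dn on nm.
  apply: (IHk [seq m <- s | m != mu]) => // [|m dmm om].
    have ms : mu \in s by apply: Hs => //; exact: r1.
    have : (size [seq m <- s | m != mu] < size s)%N.
      rewrite size_filter -(count_predC (fun m => m != mu) s) -[X in (X < _)%N]addn0 ltn_add2l.
      by rewrite -has_count; apply/hasP; exists mu => //=; rewrite negbK.
    by move=> l1; exact: leq_trans l1 _.
  rewrite mem_filter; apply/andP; split; last by apply: Hs => //; exact: r3 on om.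
  by apply: contraNneq nm => mm; apply/eqP; apply: r2 => //; rewrite -mm.
by move=> mu dm; have [s Hs] := r5 mu dm; apply: (H (size s).+1 s).
Qed.

Lemma cbm_P la : dominant la -> cbm (P la).
Proof.
move=> /HP.1[s [c [_ _ _ _ e]]].
apply: (@eq_cbm _ _ (fun v => \sum_(m <- s) c m * mfun m v)) => [v|]; first by rewrite e.
by apply: cbm_sum => m _; exact: (cbmM (cbm_cst _ _) (cbm_mfun _ _)).
Qed.

Lemma ip_sum (I : Type) (s : seq I) (c : I -> R[i]) f g : (forall i, cbm (f i)) -> cbm g ->
  ip (fun v => \sum_(i <- s) c i * f i v) g = \sum_(i <- s) c i * ip (f i) g.
Proof.
move=> cf cg; pose F i v := f i v * conjc (g v) * Dh v * (delta v * conjc (delta v)).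
have cF i : cbm (F i).
  have cd := cbm_delta rs h.
  exact: (cbmM (cbmM (cbmM (cf i) (cbmJ cg)) cbmDh) (cbmM cd (cbmJ cd))).
rewrite -[LHS]/(Lc (fun v => (\sum_(i <- s) c i * f i v) * conjc (g v) * Dh v * (delta v * conjc (delta v)))).
have -> : (fun v => (\sum_(i <- s) c i * f i v) * conjc (g v) * Dh v * (delta v * conjc (delta v)))
    = (fun v => \sum_(i <- s) c i * F i v).
  by apply/funext => v; rewrite !mulr_suml; apply: eq_bigr => i _; rewrite /F !mulrA.
rewrite (@Lc_sum _ _ rs h Ws vol0 _ s xpredT (fun i v => c i * F i v)).
  by apply: eq_bigr => i _; rewrite (LcZ Ws vol0 (c i) (cF i)).
by move=> i _; exact: (cbmM (cbm_cst _ _) (cF i)).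
Qed.

Lemma ip_P_mfun la nu (s : seq 'rV[R]_n.+1) c : dominant nu ->
  (forall v, P la v = \sum_(m <- s) c m * mfun m v) ->
  ip (P la) (P nu) = \sum_(m <- s) c m * ip (mfun m) (P nu).
Proof.
move=> dn e; have -> : P la = fun v => \sum_(m <- s) c m * mfun m v by apply/funext.
exact: (ip_sum s c (fun m => cbm_mfun Ws m) (cbm_P dn)).
Qed.

(** Expand [P mu], which is orthogonal to [P la]: the lower monomials drop out by induction and
    transitivity, and the coefficient of [mfun mu] is nonzero. *)
Lemma ip_mfun_eq0 mu la : dominant mu -> dominant la -> ~ ord mu la -> ip (mfun mu) (P la) = 0.
Proof.
have [r1 r2 r3 _ _] := Hord; move=> dm dl; move: mu dm; apply: ord_ind => mu dm IH ml.
have [s [c [us sP ms cm e]]] := HP.1 mu dm.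
have := HP.2 mu la dm dl; rewrite (ip_P_mfun dl e) (bigD1_seq mu) //=.
rewrite big_seq_cond big1 => [|nu /andP[/sP[dn on] nm]]; last first.
  by rewrite IH ?mulr0 // => onl; apply: ml; exact: r3 on onl.
rewrite addr0; case: eqP => [e1|_ /eqP]; first by rewrite e1 in ml; case: ml; exact: r1.
by rewrite mulf_eq0 (gt_eqF cm) => /eqP.
Qed.

Lemma ip_mfun_diag la (s : seq 'rV[R]_n.+1) c : dominant la -> uniq s -> la \in s ->
  {in s, forall m, dominant m /\ ord la m} ->
  (forall v, P la v = \sum_(m <- s) c m * mfun m v) -> c la * ip (mfun la) (P la) = 1.
Proof.
have [r1 r2 r3 _ _] := Hord; move=> dl us ls sP e.
have := HP.2 la la dl dl; rewrite eqxx (ip_P_mfun dl e) (bigD1_seq la) //=.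
rewrite big_seq_cond big1 ?addr0 // => nu /andP[/sP[dn on] nm].
by rewrite ip_mfun_eq0 ?mulr0 // => onl; case/eqP: nm; exact: r2.
Qed.

(* Uniqueness of the dominant weight of an orbit need not be proved from the geometry of
   chambers: monomial functions of one orbit coincide, and the triangularity of the
   Gram--Schmidt family tells dominant weights apart. *)
Lemma dominant_uniq x w : dominant x -> W w -> dominant (x *m w) -> x *m w = x.
Proof.
move=> dx Ww dxw; have [_ r2 _ _ _] := Hord.
have Em : mfun (x *m w) = mfun x.
  have HwT := inW_tr Ww; apply/funext => v; rewrite /Defs.mfun; congr (_^-1 * _).
    congr _%:R; rewrite -!sum1_count big_mkcond [RHS]big_mkcond /=.
    pose F u : nat := if x *m u == x then 1%N else 0%N.
    rewrite -(big_Ws_mull Hrs HWu HW _ F Ww) -(big_Ws_mulr Hrs HWu HW _ (fun u => F (w *m u)) HwT).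
    apply: eq_bigr => u _; rewrite /F; congr (if _ then _ else _).
    rewrite !mulmxA; apply/eqP/eqP => [->|e].
      by rewrite -mulmxA (inW_mulT Hrs Ww) mulmx1.
    by rewrite -[LHS]mulmx1 -(inW_Tmul Hrs Ww) mulmxA e.
  rewrite -(big_Ws_mulr Hrs HWu HW _ (fun u => expi (dotp x (v *m u))) HwT).
  by apply: eq_bigr => u _; rewrite mulmxA dotp_mulmxl.
have H y z : dominant y -> dominant z -> mfun y = mfun z -> ord y z.
  move=> dy dz e; apply: contrapT => /(ip_mfun_eq0 dy dz); rewrite e.
  have [s [c [us sP zs _ ez]]] := HP.1 z dz.
  have := ip_mfun_diag dz us zs sP ez; move=> + e0.
  by rewrite e0 mulr0 => /eqP; rewrite eq_sym oner_eq0.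
by apply: r2 => //; apply: H.
Qed.
Let Hu := dominant_uniq.

(** The pairing of [alternant x / delta] with [P la], the denominator having been absorbed by the
    factor [delta * conjc delta] of the weight. *)
Definition alternant_coef x la : R[i] :=
  Lc (fun v => Dh v * (alternant x v * conjc (delta v * P la v))).

Lemma cbm_alternant_coef x la : dominant la ->
  cbm (fun v => Dh v * (alternant x v * conjc (delta v * P la v))).
Proof.
move=> dl; apply: (cbmM cbmDh); apply: (cbmM (cbm_alternant _ _)); apply: cbmJ.
exact: (cbmM (cbm_delta _ _) (cbm_P dl)).
Qed.

Lemma ip_mfun_alternant nu la (s : seq (R[i] * 'rV[R]_n.+1)) : dominant la ->
  (forall v, delta v * mfun nu v =
     alternant (rho + nu) v + \sum_(p <- s) p.1 * alternant (rho + p.2) v) ->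
  ip (mfun nu) (P la) = alternant_coef (rho + nu) la +
    \sum_(p <- s) p.1 * alternant_coef (rho + p.2) la.
Proof.
move=> dl E; pose F x v := Dh v * (alternant x v * conjc (delta v * P la v)).
have cF x : cbm (F x) by exact: cbm_alternant_coef.
pose G (p : R[i] * 'rV[R]_n.+1) v := p.1 * F (rho + p.2) v.
have cG p : cbm (G p) by exact: (cbmM (cbm_cst _ _) (cF _)).
transitivity (Lc (fun v => F (rho + nu) v + \sum_(p <- s) G p v)).
  congr Lc; apply/funext => v.
  transitivity (Dh v * ((delta v * mfun nu v) * conjc (delta v * P la v))).
    by rewrite conjcM; ring.
  rewrite E mulrDl mulrDr mulr_suml mulr_sumr; congr (_ + _); apply: eq_bigr => p _.
  by rewrite /G /F; ring.
rewrite (LcD Ws vol0 (cF _)); last by apply: cbm_sum => p _; exact: cG.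
congr (_ + _); rewrite (@Lc_sum _ _ rs h Ws vol0 _ s xpredT G) => [|p _]; last exact: cG.
by apply: eq_bigr => p _; rewrite /G (LcZ Ws vol0 p.1 (cF _)).
Qed.

(** The expansion in [delta_mfun] is unitriangular, so the vanishing known for monomials passes to
    alternants by induction along the order. *)
Lemma alternant_coef_eq0 nu la : dominant nu -> dominant la -> ~ ord nu la ->
  alternant_coef (rho + nu) la = 0.
Proof.
have [r1 r2 r3 r4 _] := Hord; move=> dn dl; move: nu dn; apply: ord_ind => nu dn IH nl.
have [s [s1 s2]] := delta_mfun Hrs Hh HWu HW vol0 Hu dn.
have := ip_mfun_alternant dl s2; rewrite ip_mfun_eq0 // big_seq big1 ?addr0 // => p ps.
have [dp pp pn] := s1 p ps; have op : ord nu p.2 by exact: r4.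
by rewrite IH ?mulr0 // => opl; apply: nl; exact: r3 op opl.
Qed.

Lemma alternant_coef_diag la : dominant la ->
  alternant_coef (rho + la) la = ip (mfun la) (P la).
Proof.
have [r1 r2 r3 r4 _] := Hord; move=> dl.
have [s [s1 s2]] := delta_mfun Hrs Hh HWu HW vol0 Hu dl.
rewrite (ip_mfun_alternant dl s2) big_seq big1 ?addr0 // => p ps.
have [dp pp pn] := s1 p ps; have op : ord la p.2 by exact: r4.
rewrite alternant_coef_eq0 ?mulr0 // => opl; case/eqP: pn.
exact: r2.
Qed.

End GramSchmidt.

(** * The exact pairings of the truncated waves *)

Section Pairings.
Context (R : realType) (n : nat) (rs : seq 'rV[R]_n.+1) (h : 'rV[R]_n.+1).
Context (Ws : seq 'M[R]_n.+1).
Context (Hrs : is_root_system rs) (Hh : {in rs, forall a, dotp h a != 0}).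
Context (HWu : uniq Ws) (HW : forall w, w \in Ws <-> inW rs w).
Context (chat : 'rV[R]_n.+1 -> R[i] -> R[i]).
Context (ord : 'rV[R]_n.+1 -> 'rV[R]_n.+1 -> Prop) (P : 'rV[R]_n.+1 -> 'rV[R]_n.+1 -> R[i]).
Context (Hord : admissible_order rs h ord) (HP : gram_schmidt_family rs h Ws chat ord P).
Context (cbmDh : cbm (Deltahat rs h chat)).
Notation W := (inW rs).
Notation pos := (pos rs h).
Notation weight := (weight rs).
Notation dominant := (dominant rs h).
Notation rho := (rho rs h).
Notation posspan := (posspan rs h).
Notation delta := (delta rs h).
Notation mfun := (Defs.mfun Ws).
Notation Dh := (Deltahat rs h chat).
Notation ip := (ipD rs h Ws chat).
Notation Lc := (Lc rs h Ws).
Notation Mc := (Mc rs h Ws).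
Notation alternant := (alternant Ws).
Notation lowsum := (lowsum rs h).
Implicit Types (a x y z v la mu nu : 'rV[R]_n.+1) (w u : 'M[R]_n.+1).
Let vol0 := gram_schmidt_volA HP.
Let Hu := dominant_uniq Hrs HWu HW Hord HP cbmDh.

(** The sum in [Psi_inf] is the case [f = Chat]; truncated products of [chat] or of its inverse are
    substituted later. *)
Definition altsum (f : 'rV[R]_n.+1 -> R[i]) x v : R[i] :=
  \sum_(w <- Ws) (\det w)%:C%C * f (v *m w) * echar x (v *m w).

Lemma cbm_altsum f x : cbm f -> cbm (altsum f x).
Proof.
move=> cf; apply: cbm_sum => w _.
exact: (cbmM (cbmM (cbm_cst _ _) (cbm_mulmx w cf)) (cbm_mulmx w (cbm_echar x))).
Qed.

Lemma altsum_expand (L : seq (R[i] * 'rV[R]_n.+1)) f la v :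
  (forall v, f v = \sum_(p <- L) p.1 * echar (- p.2) v) ->
  altsum f (rho + la) v = \sum_(p <- L) p.1 * alternant (rho + (la - p.2)) v.
Proof.
move=> Lf; rewrite /altsum.
transitivity (\sum_(w <- Ws) \sum_(p <- L)
    p.1 * ((\det w)%:C%C * echar (rho + (la - p.2)) (v *m w))).
  apply: eq_bigr => w _; rewrite Lf mulr_sumr mulr_suml; apply: eq_bigr => p _.
  by rewrite !echarD; ring.
by rewrite exchange_big; apply: eq_bigr => p _; rewrite /alternant mulr_sumr.
Qed.

Lemma altsum_mul f x v u : W u -> altsum f x (v *m u) = (\det u)%:C%C * altsum f x v.
Proof.
move=> Wu; rewrite /altsum mulr_sumr.
rewrite -[RHS](big_Ws_mull Hrs HWu HW _
  (fun w => (\det u)%:C%C * ((\det w)%:C%C * f (v *m w) * echar x (v *m w))) Wu).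
apply: eq_bigr => w _; rewrite det_mulmx rmorphM /= mulmxA !mulrA -[in RHS]rmorphM /= -expr2.
by rewrite (det_sqr Hrs Wu) mul1r.
Qed.

Lemma Lc_orbit F : cbm F -> Lc (fun v => \sum_(w <- Ws) F (v *m w)) = Mc F.
Proof.
move=> cF; rewrite (@Lc_sum _ _ rs h Ws vol0 _ Ws xpredT (fun w v => F (v *m w))) // => w _.
exact: cbm_mulmx.
Qed.

Lemma P_mul la v w : dominant la -> W w -> P la (v *m w) = P la v.
Proof.
move=> /HP.1[s [c [_ _ _ _ e]]] Ww; rewrite !e; apply: eq_bigr => m _.
by rewrite (mfun_mul Hrs HWu HW).
Qed.

(** This is (Psi, V), the weights having cancelled. Antisymmetry of [delta * P la] folds the
    alternating sum into [Mc], and [Mc_lowsum_mfun] keeps only the leading monomial. *)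
Lemma Lc_P_altsum la b (g : 'rV[R]_n.+1 -> R[i]) (s : seq 'rV[R]_n.+1) c : dominant la ->
  lowsum b g -> uniq s -> la \in s -> {in s, forall m, dominant m /\ ord la m} ->
  (forall v, P la v = \sum_(m <- s) c m * mfun m v) ->
  Lc (fun v => delta v * P la v * altsum g (- (rho + la)) v) = c la.
Proof.
have [r1 r2 r3 r4 _] := Hord; move=> dl lg us ls sP e.
pose F v := delta v * P la v * (g v * echar (- (rho + la)) v).
have cP := cbm_P HP dl.
have cF : cbm F.
  exact: (cbmM (cbmM (cbm_delta _ _) cP) (cbmM (cbm_lowsum lg) (cbm_echar _))).
transitivity (Mc F).
  rewrite -Lc_orbit //; congr Lc; apply/funext => v; rewrite /altsum mulr_sumr.
  apply: eq_big_seq => w /HW Ww; rewrite /F (delta_mul Hrs Hh) // P_mul //; ring.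
have [b' ld] := delta_lowsum h Hrs; have lD := lowsumM ld lg.
pose G m v := (delta v * echar (- rho) v * g v) * (mfun m v * echar (- la) v).
have cG m : cbm (G m).
  exact: (cbmM (cbm_lowsum lD) (cbmM (cbm_mfun _ _) (cbm_echar _))).
have -> : F = fun v => \sum_(m <- s) c m * G m v.
  apply/funext => v; rewrite /F /G e mulr_sumr mulr_suml; apply: eq_bigr => m _.
  by rewrite opprD echarD; ring.
rewrite (@Mc_sum _ _ rs h Ws vol0 _ s xpredT (fun m v => c m * G m v)); last first.
  by move=> m _; exact: (cbmM (cbm_cst _ _) (cG m)).
rewrite (bigD1_seq la) //= (McZ Ws vol0 (c la) (cG la)).
rewrite (Mc_lowsum_mfun Hrs Hh HWu HW vol0 Hu lD) // eqxx mulr1.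
rewrite big_seq_cond big1 ?addr0 // => m /andP[/sP[dm om] ml].
rewrite (McZ Ws vol0 (c m) (cG m)).
rewrite (Mc_lowsum_mfun Hrs Hh HWu HW vol0 Hu lD) ?(negPf ml) ?mulr0 // => pp.
by apply: r2 => //; exact: r4.
Qed.

(** The point at which the size of [mlam] enters the orthogonality relations. *)
Lemma dominant_shift la y (b : R) : dominant la -> weight y ->
  (forall a, a \in rs -> `|pairing y a| <= b) -> b <= mlam rs h la ->
  dominant (la - y) /\ dominant (la + y).
Proof.
move=> /dominantP[wl _] wy Hy bl.
have Hp a : pos a -> pairing y a <= pairing la a /\ - pairing y a <= pairing la a.
  move=> pa; have := Hy a (pos_root pa); rewrite ler_norml => /andP[y1 y2].
  have := le_trans bl (mlam_le la pa) => bp.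
  by split; [exact: le_trans y2 bp | apply: le_trans bp; rewrite lerNl].
split; apply/dominantP; split.
- exact: weightB.
- by move=> a /Hp[y1 _]; rewrite pairingBl subr_ge0.
- exact: weightD.
- by move=> a /Hp[_ y1]; rewrite pairingDl -lerBlDr sub0r.
Qed.

(** This is (U, Psi). Each nonzero exponent of [f] gives an alternant attached to a dominant weight
    strictly below [la], which is orthogonal to [P la]; the constant term 1 of [f] gives the
    value. *)
Lemma Lc_altsum_P la b f : dominant la -> lowsum b f -> b <= mlam rs h la ->
  Lc (fun v => Dh v * (altsum f (rho + la) v * conjc (delta v * P la v))) =
  ip (mfun la) (P la).
Proof.
have [r1 r2 r3 r4 _] := Hord; move=> dl [L [L1 L2 L3 L4]] bl.
pose F (p : R[i] * 'rV[R]_n.+1) v :=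
  Dh v * (alternant (rho + (la - p.2)) v * conjc (delta v * P la v)).
have cF p : cbm (F p) by exact: cbm_alternant_coef HP cbmDh _ _ dl.
have -> : (fun v => Dh v * (altsum f (rho + la) v * conjc (delta v * P la v))) =
    fun v => \sum_(p <- L) p.1 * F p v.
  apply/funext => v; rewrite (altsum_expand _ _ L4) mulr_suml mulr_sumr.
  by apply: eq_bigr => p _; rewrite /F; ring.
rewrite (@Lc_sum _ _ rs h Ws vol0 _ L xpredT (fun p v => p.1 * F p v)); last first.
  by move=> p _; exact: (cbmM (cbm_cst _ _) (cF p)).
rewrite -(alternant_coef_diag Hrs Hh HWu HW Hord HP cbmDh dl) -[RHS]mul1r -L3 mulr_suml.
rewrite [RHS]big_mkcond; apply: eq_big_seq => p pL; rewrite (LcZ Ws vol0 p.1 (cF p)).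
case: eqP => p0; first by rewrite /F p0 subr0.
have wp := weight_posspan Hrs (L1 p pL).
have [dp _] := dominant_shift dl wp (fun a ar => L2 p a pL ar) bl.
rewrite -/(alternant_coef rs h Ws chat P (rho + (la - p.2)) la).
rewrite (alternant_coef_eq0 Hrs Hh HWu HW Hord HP cbmDh dp dl) ?mulr0 // => ol.
have : la - p.2 = la.
  apply: r2 => //; apply: r4 => //.
  have : posspan (la - (la - p.2)) by rewrite opprB addrC subrK; exact: L1.
  by [].
by move/eqP; rewrite -subr_eq0 addrAC subrr add0r oppr_eq0 => /eqP.
Qed.

(** This is (U, V). The exponents of [f] lower [la] and those of [g] raise it, within the dominant
    weights, so the two can meet only when both shifts are 0. *)
Lemma Lc_altsum_altsum la b f g : dominant la -> lowsum b f -> lowsum b g ->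
  b <= mlam rs h la ->
  Lc (fun v => altsum f (rho + la) v * altsum g (- (rho + la)) v) = 1.
Proof.
move=> dl lf lg bl; pose F v := altsum f (rho + la) v * (g v * echar (- (rho + la)) v).
have cF : cbm F.
  exact: (cbmM (cbm_altsum _ (cbm_lowsum lf)) (cbmM (cbm_lowsum lg) (cbm_echar _))).
transitivity (Mc F).
  rewrite -Lc_orbit //; congr Lc; apply/funext => v; rewrite {2}/altsum mulr_sumr.
  apply: eq_big_seq => w /HW Ww; rewrite /F altsum_mul //; ring.
have [L [L1 L2 L3 L4]] := lf; have [L' [L1' L2' L3' L4']] := lg.
pose G (p p' : R[i] * 'rV[R]_n.+1) v :=
  alternant (rho + (la - p.2)) v * echar (- (rho + (la + p'.2))) v.
have cG p p' : cbm (G p p') by exact: (cbmM (cbm_alternant _ _) (cbm_echar _)).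
pose H p v := \sum_(p' <- L') (p.1 * p'.1) * G p p' v.
have cH p : cbm (H p).
  by apply: cbm_sum => p' _; exact: (cbmM (cbm_cst _ _) (cG p p')).
have -> : F = fun v => \sum_(p <- L) H p v.
  apply/funext => v; rewrite /F (altsum_expand _ _ L4) L4' mulr_suml.
  apply: eq_bigr => p _; rewrite /H mulr_suml mulr_sumr; apply: eq_bigr => p' _.
  have E : - (rho + (la + p'.2)) = - p'.2 + - (rho + la).
    by rewrite -opprD (addrC p'.2) addrA.
  by rewrite /G E echarD; ring.
rewrite (@Mc_sum _ _ rs h Ws vol0 _ L xpredT H) //.
transitivity (\sum_(p <- L) \sum_(p' <- L') (p.1 * (p.2 == 0)%:R) * (p'.1 * (p'.2 == 0)%:R)).
  apply: eq_big_seq => p pL.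
  rewrite (@Mc_sum _ _ rs h Ws vol0 _ L' xpredT (fun p' v => (p.1 * p'.1) * G p p' v)); last first.
    by move=> p' _; exact: (cbmM (cbm_cst _ _) (cG p p')).
  apply: eq_big_seq => p' pL'; rewrite (McZ Ws vol0 (p.1 * p'.1) (cG p p')).
  have wp := weight_posspan Hrs (L1 p pL); have wp' := weight_posspan Hrs (L1' p' pL').
  have [dp _] := dominant_shift dl wp (fun a ar => L2 p a pL ar) bl.
  have [_ dp'] := dominant_shift dl wp' (fun a ar => L2' p' a pL' ar) bl.
  rewrite (Mc_alternant Hrs Hh HWu HW vol0 Hu dp dp').
  have -> : (la - p.2 == la + p'.2) = (p.2 == 0) && (p'.2 == 0).
    rewrite -(posspan_add_eq0 (L1 p pL) (L1' p' pL')) -subr_eq0 opprD addrACA subrr add0r.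
    by rewrite -opprD oppr_eq0.
  by rewrite -mulnb natrM; ring.
have one (M : seq (R[i] * 'rV[R]_n.+1)) : \sum_(p <- M | p.2 == 0) p.1 = 1 ->
    \sum_(p <- M) p.1 * (p.2 == 0)%:R = 1.
  move=> M1; rewrite -[RHS]M1 [RHS]big_mkcond; apply: eq_bigr => p _.
  by case: eqP; rewrite ?mulr1 ?mulr0.
by rewrite -big_distrlr /= !one // mulr1.
Qed.

End Pairings.

(** * The norm estimate from four pairings *)

Section BiorthogonalEstimate.
Context (R : realType) (n : nat) (rs : seq 'rV[R]_n.+1) (h : 'rV[R]_n.+1).
Context (Ws : seq 'M[R]_n.+1) (HW : forall w, w \in Ws <-> inW rs w).
Context (vol0 : volA rs h != 0).
Notation Lc := (Lc rs h Ws).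
Implicit Types X Y U V : 'rV[R]_n.+1 -> R[i].

Lemma hnormE X : hnorm rs h Ws X =
  Num.sqrt (complex.Re (Lc (fun v => (cabs (X v) ^+ 2)%:C%C))).
Proof. by rewrite Re_Lc. Qed.

(** The cross terms cost at most [2 * e * cabs A + e ^+ 2]; completing the square bounds
    [2 * e * cabs A] by half of [cabs A ^+ 2] plus [2 * e ^+ 2]. *)
Lemma Re_mul_conj_ge (A E1 E2 : R[i]) (e : R) : cabs E1 <= e -> cabs E2 <= e ->
  2^-1 * cabs A ^+ 2 - 3 * e ^+ 2 <= complex.Re ((A + E1) * conjc (A + E2)).
Proof.
move=> h1 h2; have -> : (A + E1) * conjc (A + E2) =
    A * conjc A + (A * conjc E2 + (E1 * conjc A + E1 * conjc E2)).
  by rewrite conjcD; ring.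
rewrite !ReD -cabs_sqr; set x := cabs A.
have bd z w (r : R) : cabs z * cabs w <= r -> - r <= complex.Re (z * conjc w).
  move=> zw; have := le_Re_cabs (z * conjc w); rewrite cabsM cabsJ => k.
  by have := le_trans k zw; rewrite ler_norml => /andP[].
have x0 : 0 <= x by exact: cabs_ge0.
have e0 : 0 <= e by apply: le_trans h1; exact: cabs_ge0.
have k1 : - (x * e) <= complex.Re (A * conjc E2) by apply: bd; rewrite ler_wpM2l.
have k2 : - (e * x) <= complex.Re (E1 * conjc A) by apply: bd; rewrite ler_wpM2r.
have k3 : - (e * e) <= complex.Re (E1 * conjc E2).
  by apply: bd; apply: ler_pM => //; exact: cabs_ge0.
apply: (@le_trans _ _ (x ^+ 2 + (- (x * e) + (- (e * x) + - (e * e))))); last first.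
  by rewrite lerD2l; apply: lerD => //; exact: lerD.
have := sqr_ge0 (x - 2 * e); rewrite -subr_ge0 => k.
have -> : x ^+ 2 + (- (x * e) + (- (e * x) + - (e * e))) =
  2^-1 * x ^+ 2 - 3 * e ^+ 2 + 2^-1 * (x - 2 * e) ^+ 2 by field.
by rewrite lerDl mulr_ge0 ?sqr_ge0.
Qed.

(* [Re (X - U, X - V) = 2 - a - 1/a <= 0] by AM-GM, whereas this pairing is
   close to the squared norm of [X - Y]. *)
Lemma biorthogonal_close X Y U V (a a' : R[i]) (e : R) :
  cbm X -> cbm Y -> cbm U -> cbm V ->
  (forall v, cabs (Y v - U v) <= e) -> (forall v, cabs (Y v - V v) <= e) ->
  Lc (fun v => X v * conjc (X v)) = 1 ->
  Lc (fun v => X v * conjc (V v)) = a -> Lc (fun v => U v * conjc (X v)) = a' ->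
  Lc (fun v => U v * conjc (V v)) = 1 -> 0 < a -> a * a' = 1 ->
  hnorm rs h Ws (fun v => X v - Y v) <= 3 * e.
Proof.
move=> cX cY cU cV YU YV XX XV UX UV a0 aa.
have e0 : 0 <= e by apply: le_trans (YU 0); exact: cabs_ge0.
pose g v := X v * conjc (X v) + (- (X v * conjc (V v)) + (- (U v * conjc (X v)) + U v * conjc (V v))).
have c1 := cbmM cX (cbmJ cX); have c2 := cbmN (cbmM cX (cbmJ cV)).
have c3 := cbmN (cbmM cU (cbmJ cX)); have c4 := cbmM cU (cbmJ cV).
have Lg : Lc g = 1 + (- a + (- a' + 1)).
  rewrite /g (LcD Ws vol0 c1 (cbmD c2 (cbmD c3 c4))) (LcD Ws vol0 c2 (cbmD c3 c4)).
  rewrite (LcD Ws vol0 c3 c4) (LcN Ws vol0 (cbmM cX (cbmJ cV))).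
  by rewrite (LcN Ws vol0 (cbmM cU (cbmJ cX))) XX XV UX UV.
have Rg : complex.Re (Lc g) <= 0.
  rewrite Lg !ReD !ReN.
  have [ai ar] : complex.Im a = 0 /\ 0 < complex.Re a.
    by move: a0; rewrite ltcE => /andP[/eqP].
  have := congr1 (@complex.Re R) aa; rewrite ReM ai mul0r subr0 => /= rr.
  rewrite /=; set r := complex.Re a in ar rr *; set s := complex.Re a' in rr *.
  suff : 0 <= r * (r + s - 2) by rewrite pmulr_rge0 // => ?; lra.
  have -> : r * (r + s - 2) = r ^+ 2 - 2 * r + r * s by ring.
  by rewrite rr; have := sqr_ge0 (r - 1); rewrite sqrrB expr1n mulr1; lra.
pose A v := (cabs (X v - Y v) ^+ 2)%:C%C : R[i].
have cA : cbm A.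
  have cc := cbm_cabs (cbmD cX (cbmN cY)).
  by apply: eq_cbm (cbmM cc cc) => v; rewrite /A expr2 rmorphM.
have cf := cbmM (cbm_cst n ((2^-1 : R)%:C%C)) cA.
have ck := cbm_cst n ((- (3 * e ^+ 2))%:C%C).
have fg : complex.Re (Lc (fun v => (2^-1 : R)%:C%C * A v + (- (3 * e ^+ 2))%:C%C)) <=
    complex.Re (Lc g).
  apply: (Re_Lc_le HW vol0) => [||v].
  - exact: cbmD cf ck.
  - exact: (cbmD c1 (cbmD c2 (cbmD c3 c4))).
  have -> : g v = ((X v - Y v) + (Y v - U v)) * conjc ((X v - Y v) + (Y v - V v)).
    by rewrite /g !addrA !subrK conjcD (rmorphN (@conjc R)) /=; ring.
  apply: le_trans (Re_mul_conj_ge _ (YU v) (YV v)).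
  by rewrite /A -rmorphM -rmorphD /=.
rewrite (LcD Ws vol0 cf ck) (LcZ Ws vol0 _ cA) ReD (Re_Lc_cst HW vol0) in fg.
rewrite hnormE -/A; set Z := Lc A in fg *.
have W1 : 1 <= (size Ws)%:R :> R by rewrite ler1n (sizeWs_gt0 HW).
have Wi : (size Ws)%:R^-1 <= 1 :> R by rewrite invf_le1 // (lt_le_trans ltr01).
have e3 : 0 <= 3 * e ^+ 2 by rewrite mulr_ge0 ?sqr_ge0.
(* The normalised mean of the constant 1 over the alcove is the inverse of the group order, hence at
   most 1, so half of the squared norm is at most [3 * e ^+ 2]. The 6 is then rounded up to the
   square 9. *)
have Zb : complex.Re Z <= 6 * e ^+ 2.
  have k : (size Ws)%:R^-1 * (3 * e ^+ 2) <= 3 * e ^+ 2 by rewrite ler_piMl.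
  have ZE : complex.Re ((2^-1)%:C%C * Z) = 2^-1 * complex.Re Z.
    by rewrite ReM [X in X * complex.Im Z](_ : _ = 0) // mul0r subr0.
  have := le_trans fg Rg; rewrite ZE mulrN => fz.
  clear - k fz; set y := complex.Re Z in fz *; lra.
have -> : 3 * e = Num.sqrt ((3 * e) ^+ 2) by rewrite sqrtr_sqr ger0_norm // mulr_ge0.
apply: ler_wsqrtr; apply: le_trans Zb _; have := sqr_ge0 e; rewrite exprMn => ?; lra.
Qed.

End BiorthogonalEstimate.

(** * Assembly of the exponential estimate *)

Section Asymptotics.
Context (R : realType) (n : nat) (rs : seq 'rV[R]_n.+1) (h : 'rV[R]_n.+1).
Context (Ws : seq 'M[R]_n.+1).
Context (Hrs : is_root_system rs) (Hh : {in rs, forall a, dotp h a != 0}).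
Context (HWu : uniq Ws) (HW : forall w, w \in Ws <-> inW rs w).
Context (chat : 'rV[R]_n.+1 -> R[i] -> R[i]).
Context (ord : 'rV[R]_n.+1 -> 'rV[R]_n.+1 -> Prop) (P : 'rV[R]_n.+1 -> 'rV[R]_n.+1 -> R[i]).
Context (Hord : admissible_order rs h ord) (HP : gram_schmidt_family rs h Ws chat ord P).
Context (Horb : forall a b, R1p rs h a -> R1p rs h b ->
  (exists w, inW rs w /\ b = a *m w) -> chat a = chat b).
Context (cr dr : 'rV[R]_n.+1 -> nat -> R) (B q : R).
Context (B1 : 1 <= B) (q0 : 0 < q) (q1 : q < 1).
Context (HA : forall a, a \in rs -> R1p rs h a -> circle_approx (chat a) (cr a) (dr a) B q).
Notation W := (inW rs).
Notation dominant := (dominant rs h).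
Notation R1p := (R1p rs h).
Notation rho := (rho rs h).
Notation delta := (delta rs h).
Notation Chat := (Chat rs h chat).
Notation Lc := (Lc rs h Ws).
Notation alts := (altsum Ws).
Notation cmodh := (cmod rs h chat).
Notation Psi := (Psi rs h chat P).
Notation Psi_inf := (Psi_inf rs h Ws chat).
Implicit Types (a x v la : 'rV[R]_n.+1) (w : 'M[R]_n.+1).

Lemma cbm_Deltahat : cbm (Deltahat rs h chat).
Proof.
have cc := cbm_cmod_inv B1 q0 q1 HA.
by apply: eq_cbm (cbmM cc cc) => v; rewrite (DeltahatE HA) expr2 rmorphM.
Qed.

Lemma cabs_det w : W w -> cabs ((\det w)%:C%C : R[i]) = 1.
Proof.
move=> Ww; rewrite cabs_real; apply/eqP.
by rewrite -(eqrXn2 (n := 2)) // expr1n -normrX (det_sqr Hrs Ww) normr1.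
Qed.

Lemma altsum_sub_le (F G : 'rV[R]_n.+1 -> R[i]) x v (D : R) :
  (forall v, cabs (F v - G v) <= D) ->
  cabs (alts F x v - alts G x v) <= (size Ws)%:R * D.
Proof.
move=> FG; rewrite /altsum -sumrB.
have -> : (size Ws)%:R * D = \sum_(w <- Ws) D.
  by rewrite big_const_seq count_predT iter_addr_0 mulr_natl.
apply: le_trans (cabs_sum _ _ _) _; rewrite big_seq [leRHS]big_seq.
apply: ler_sum => w /HW Ww; rewrite -mulrBl -mulrBr !cabsM cabs_det // cabs_expi.
by rewrite mul1r mulr1.
Qed.

Lemma Psi_infE la v : Psi_inf la v = ((cmodh v)^-1)%:C%C * alts Chat (rho + la) v.
Proof. by rewrite /Defs.Psi_inf (sqrtDeltahatE HA). Qed.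

(** [Chat x * Chat (- x)] is [cmod x ^+ 2], and [cmod] is the same at [v *m w] and at [v]. *)
Lemma Psi_infE_inv la v :
  Psi_inf la v = (cmodh v)%:C%C * alts (fun x => (Chat (- x))^-1) (rho + la) v.
Proof.
rewrite Psi_infE /altsum !mulr_sumr; apply: eq_big_seq => w /HW Ww.
rewrite !mulrA; congr (_ * _); rewrite mulrAC [RHS]mulrAC; congr (_ * _).
have C0 := Chat_neq0 HA (- (v *m w)).
apply: (mulIf C0); rewrite mulfVK // (Chat_opp HA) -mulrA mul_conjc_cabs.
rewrite -/(cmodh (v *m w)) /cmod (cabs_Chat_mulmx Hrs Hh Horb HA) // -rmorphM /=.
by rewrite expr2 mulrA mulVf ?mul1r // gt_eqF // (cmod_gt0 HA).
Qed.

Lemma PsiE la v : Psi la v = ((cmodh v)^-1)%:C%C * (delta v * P la v).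
Proof. by rewrite /Defs.Psi (sqrtDeltahatE HA) mulrA. Qed.

Lemma tprod_lowsum (c : 'rV[R]_n.+1 -> nat -> R) K (b : R) : 0 <= b ->
  (forall a a', a \in rs -> a' \in rs -> `|pairing a a'| <= b) ->
  (forall a, R1p a -> c a 0 = 1) ->
  lowsum rs h ((size rs)%:R * (K%:R * b)) (tprod rs R1p c K).
Proof.
move=> b0 Hb c0; have Kb : 0 <= K%:R * b by rewrite mulr_ge0.
apply: (@lowsum_prod _ _ _ _ _ rs R1p (fun a v => tpoly (c a) K (- dotp a v)) Kb) => a Ra.
have ars := R1p_root Ra; have /andP[pa _] := Ra.
by apply: lowsum_tpoly => // [|a' ar']; [exact: c0 | exact: Hb].
Qed.

Lemma Psi_asymptotics (b : R) : 0 <= b ->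
  (forall a a', a \in rs -> a' \in rs -> `|pairing a a'| <= b) ->
  exists C : R, forall la K, dominant la -> (size rs)%:R * (K%:R * b) <= mlam rs h la ->
    hnorm rs h Ws (fun v => Psi la v - Psi_inf la v) <= C * q ^+ K.
Proof.
move=> b0 Hb; have [C C0 HC] := Chat_approx B1 q0 q1 HA.
have vol0 := gram_schmidt_volA HP; have cD := cbm_Deltahat.
(* The 3 comes from [biorthogonal_close], one [C] bounds the prefactor [cmodh] or its inverse, the
   group order counts the alternating terms, and the last [C] belongs to the truncation error
   [C * q ^+ K]. *)
exists (3 * (C * (size Ws)%:R * C)) => la K dl bl.
have [s [c [us sP ls cl e]]] := HP.1 la dl.
pose f := tprod rs R1p cr K; pose g := tprod rs R1p dr K.
have lf : lowsum rs h ((size rs)%:R * (K%:R * b)) f.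
  apply: tprod_lowsum => // a Ra.
  by have [] := circle_approx_R1p HA Ra.
have lg : lowsum rs h ((size rs)%:R * (K%:R * b)) g.
  apply: tprod_lowsum => // a Ra.
  by have [] := circle_approx_R1p HA Ra.
pose U v := ((cmodh v)^-1)%:C%C * alts f (rho + la) v.
(* The sign in [g (- x)] disappears under conjugation, since the coefficients are real:
   [conjc (V v)] involves [g] itself with exponent [- (rho + la)], as the pairing lemmas require. *)
pose V v := (cmodh v)%:C%C * alts (fun x => g (- x)) (rho + la) v.
have cf := cbm_lowsum lf; have cg := cbm_lowsum lg.
have cgN : cbm (fun x => g (- x)).
  by apply: eq_cbm (cbm_mulmx (-1)%:M cg) => v; rewrite mul_mx_scalar scaleN1r.
have ci := cbm_cmod_inv B1 q0 q1 HA; have cm := cbm_cmod B1 q0 q1 HA.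
have cP := cbm_P HP dl; have cd := cbm_delta rs h.
have cX : cbm (Psi la).
  by apply: eq_cbm (cbmM ci (cbmM cd cP)) => v; rewrite PsiE.
have cY : cbm (Psi_inf la).
  apply: eq_cbm (cbmM ci (cbm_altsum Ws (rho + la) (cbm_Chat B1 q0 q1 HA))) => v.
  by rewrite Psi_infE.
have cU : cbm U by exact: (cbmM ci (cbm_altsum _ _ cf)).
have cV : cbm V by exact: (cbmM cm (cbm_altsum _ _ cgN)).
have rJ (x : R) : conjc (x%:C%C) = x%:C%C by apply: eq_cplx => //=; rewrite oppr0.
have VJ v : conjc (V v) = (cmodh v)%:C%C * alts g (- (rho + la)) v.
  rewrite conjcM; congr (_ * _); first exact: rJ.
  rewrite conjc_sum; apply: eq_bigr => w _; rewrite !conjcM echarJ tprod_conj.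
  by congr (_ * _ * _); exact: rJ.
have mm v : ((cmodh v)^-1)%:C%C * (cmodh v)%:C%C = 1 :> R[i].
  by rewrite -rmorphM /= mulVf // gt_eqF // (cmod_gt0 HA).
have sq v : Deltahat rs h chat v = ((cmodh v)^-1)%:C%C * ((cmodh v)^-1)%:C%C.
  by rewrite (DeltahatE HA) expr2 rmorphM.
have qK : 0 <= q ^+ K by rewrite exprn_ge0 // ltW.
have S0 : 0 <= (size Ws)%:R * (C * q ^+ K) by rewrite !mulr_ge0.
have -> : 3 * (C * (size Ws)%:R * C) * q ^+ K = 3 * (C * ((size Ws)%:R * (C * q ^+ K))) by ring.
apply: (biorthogonal_close HW vol0 cX cY cU cV (a := c la)
    (a' := ipD rs h Ws chat (Defs.mfun Ws la) (P la))) => //.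
- move=> v; rewrite Psi_infE /U -mulrBr cabsM; apply: ler_pM; rewrite ?cabs_ge0 //.
    by rewrite cabs_real ger0_norm ?invr_ge0 ?cabs_ge0 // -cabsV; have [] := HC K v.
  by apply: altsum_sub_le => x; have [] := HC K x.
- move=> v; rewrite Psi_infE_inv /V -mulrBr cabsM; apply: ler_pM; rewrite ?cabs_ge0 //.
    by rewrite cabs_real ger0_norm ?cabs_ge0 //; have [] := HC K v.
  by apply: altsum_sub_le => x; have [] := HC K (- x).
- have := HP.2 la la dl dl; rewrite eqxx => <-; congr Lc; apply/funext => v.
  by rewrite PsiE conjcM conjcM rJ sq; ring.
- rewrite -(Lc_P_altsum Hrs Hh HWu HW Hord HP cD dl lg us ls sP e); congr Lc.
  by apply/funext => v; rewrite PsiE VJ mulrACA mm mul1r.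
- rewrite -(Lc_altsum_P Hrs Hh HWu HW Hord HP cD dl lf bl); congr Lc.
  by apply/funext => v; rewrite PsiE /U (conjcM ((cmodh v)^-1)%:C%C) rJ sq; ring.
- rewrite -(Lc_altsum_altsum Hrs Hh HWu HW Hord HP cD dl lf lg bl); congr Lc.
  by apply/funext => v; rewrite VJ /U mulrACA mm mul1r.
- exact: (ip_mfun_diag Hord HP cD dl us ls sP e).
Qed.

End Asymptotics.

(** Rounding [m / b] down loses less than one unit in the exponent, whence the single factor
    [q^-1]. *)
Lemma floor_power_le (R : realType) (q m b : R) : 0 < q -> q < 1 -> 0 < b -> 0 <= m ->
  q ^+ Num.truncn (m / b) <= q^-1 * expR (- (- ln q / b * m)).
Proof.
move=> q0 q1 b0 m0; set K := Num.truncn _.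
have mb : 0 <= m / b by rewrite divr_ge0 // ltW.
have Kb : m / b < K.+1%:R by exact: truncnS_gt.
have lq : ln q < 0 by rewrite ln_lt0 // q0.
rewrite mulrC ler_pdivlMr // -exprSr.
have -> : q ^+ K.+1 = expR (ln q * K.+1%:R).
  by rewrite mulrC expRM_natl lnK.
have -> : - (- ln q / b * m) = ln q * (m / b) by field; rewrite gt_eqF.
by rewrite ler_expR ler_nM2l // ltW.
Qed.

Theorem theorem4p1 (R : realType) (N : nat)
  (rs : seq 'rV[R]_N) (h : 'rV[R]_N) (Ws : seq 'M[R]_N)
  (chat : 'rV[R]_N -> R[i] -> R[i])
  (ord : 'rV[R]_N -> 'rV[R]_N -> Prop)
  (P : 'rV[R]_N -> 'rV[R]_N -> R[i])
  (Hrs : is_root_system rs)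
  (Hirr : irreducible_rs rs)
  (Hh : {in rs, forall a, dotp h a != 0})
  (HWuniq : uniq Ws)
  (HW : forall w, w \in Ws <-> inW rs w)
  (Hc : chat_hyp rs h chat)
  (Hord : admissible_order rs h ord)
  (HP : gram_schmidt_family rs h Ws chat ord P) :
  exists eps : R, 0 < eps /\
  exists K M : R, forall l : 'rV[R]_N, dominant rs h l -> M <= mlam rs h l ->
    hnorm rs h Ws (fun xi => Psi rs h chat P l xi - Psi_inf rs h Ws chat l xi)
      <= K * expR (- (eps * mlam rs h l)).
Proof.
case: N rs h Ws chat ord P Hrs Hirr Hh HWuniq HW Hc Hord HP =>
  [|n] rs h Ws chat ord P Hrs [rs0 _] Hh HWuniq HW Hc Hord HP.
  (* In dimension 0 the only vector is 0, so no nonempty root system exists. *)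
  case: rs rs0 Hrs {Hh HW Hc Hord HP} => // a s _ [_ + _ _ _].
  by rewrite inE negb_or [a]thinmx0 eqxx.
have [Horb Hca] := Hc.
have [cr [dr [B [q [B1 q0 q1 HA]]]]] : exists c d B q, [/\ 1 <= B, 0 < q, q < 1 &
    forall a, a \in rs -> R1p rs h a -> circle_approx (chat a) (c a) (d a) B q].
  apply: uniform_circle_approx => a /Hca[c1 cR [s [s1 [c [cs Hs]]]]].
  exact: analytic_circle_approx c1 cR s1 cs Hs.
have [b b0 Hb] := root_pairing_bound Hrs.
have [C HC] := Psi_asymptotics Hrs Hh HWuniq HW Hord HP Horb B1 q0 q1 HA b0 Hb.
(* Truncation at degree [K] shifts pairings by at most [size rs * K * b], so [K] of size [mlam / b1]
   is allowed; the added 1 keeps the divisor positive whatever [b] is. The rate is then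
   [- ln q / b1]. *)
pose b1 := (size rs)%:R * b + 1.
have b10 : 0 < b1 by rewrite ltr_pwDr // mulr_ge0.
have lq : ln q < 0 by rewrite ln_lt0 // q0.
exists (- ln q / b1); split; first by rewrite divr_gt0 // oppr_gt0.
exists (`|C| * q^-1), 0 => l dl l0; pose K := Num.truncn (mlam rs h l / b1).
have Kl : (size rs)%:R * (K%:R * b) <= mlam rs h l.
  apply: (@le_trans _ _ (K%:R * b1)).
    by rewrite mulrCA ler_wpM2l // lerDl.
  by rewrite -ler_pdivlMr // truncn_le // divr_ge0 // ltW.
apply: le_trans (HC l K dl Kl) _; rewrite -mulrA.
apply: (@le_trans _ _ (`|C| * q ^+ K)).
  by rewrite ler_wpM2r ?ler_norm // exprn_ge0 // ltW.
by rewrite ler_wpM2l // floor_power_le.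
Qed.
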